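(* Let $X$ be a connected weighted graph of bounded valency, possibly infinite, of finite total weight, and let $\mathcal{E}\subset \mathrm{OE}$ be a set of oriented edges. Let $T_{\mathcal{E}}$ be the operator on $\ell^2(\mathrm{OE})$ given by $T_{\mathcal{E}}e=\sum_{e'}w(e')e'$, the sum running over all oriented edges $e'$ such that $o(e')=t(e)$, and $e'\ne e^{-1}$ unless $e\in\mathcal{E}$. Then $T_{\mathcal{E}}$ is of trace class. The infinite product $Z_{\mathcal{E}}(u)=\prod_p\left(1-w(p)u^{l(p)}\right)^{-1}$, over all prime $\mathcal{E}$-cycles $p$, converges for $|u|$ sufficiently small. The limit function extends to a meromorphic function on $\mathbb{C}$ without zeros; more precisely, the function $Z_{\mathcal{E}}(u)^{-1}$ is entire and satisfies $$Z_{\mathcal{E}}(u)^{-1}=\det(1-uT_{\mathcal{E}}).$$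
   Context: Graph: $X$ is a connected (simple, undirected) graph with vertex set $VX$ and edge set $EX$ consisting of two-element subsets of $VX$; $X$ may be infinite, but has bounded valency (there is $M>0$ such that every vertex has at most $M$ neighbours). $\mathrm{OE}$ is the set of oriented edges (each edge gives two); for $e\in \mathrm{OE}$, $o(e)$ is the origin vertex, $t(e)$ the target vertex, $e^{-1}$ the reverse of $e$. The oriented edge from $x$ to $x'$ is written $(x,x')$. Weight: $w:\mathrm{OE}\to(0,\infty)$ with finite total weight $\sum_{e\in \mathrm{OE}}w(e)<\infty$. A path is a sequence $p=(x_0,\dots,x_n)$ of vertices with consecutive vertices adjacent; its length is $l(p)=n$ and its weight is $w(p)=w(x_0,x_1)\cdots w(x_{n-1},x_n)$. $\mathcal{E}$-cycles: a path $(x_0,\dots,x_n)$ is $\mathcal{E}$-regular if, for $1\le j\le n-1$, whenever $x_{j-1}=x_{j+1}$ the oriented edge $(x_{j-1},x_j)$ belongs to $\mathcal{E}$. A path of length $n\ge1$ is closed if $x_n=x_0$. Closed paths are considered up to the equivalence relation generated by $(x_0,x_1,\dots,x_n)\sim(x_1,x_2,\dots,x_n,x_1)$. An $\mathcal{E}$-cycle is an equivalence class of closed paths consisting of $\mathcal{E}$-regular paths only. It is prime if it is not a power (repetition) of a shorter one. Length and weight are well defined on $\mathcal{E}$-cycles. $\ell^2(\mathrm{OE})$ is the Hilbert space with orthonormal basis $(e)_{e\in \mathrm{OE}}$. For a trace class operator $S$, $\det(1-S)=\sum_{k\ge0}(-1)^k\operatorname{tr}\bigwedge^kS$ is the Fredholm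 determinant. *)

(* Defs.v *)
From HB Require Import structures.
From mathcomp Require Import all_boot all_order all_algebra all_fingroup finmap.
From mathcomp Require Import complex ring.
From mathcomp Require Import all_classical all_reals all_analysis.
From mathcomp.analysis Require Import summability.
From Stdlib Require Import Relation_Operators.

Set Implicit Arguments.
Unset Strict Implicit.
Unset Printing Implicit Defensive.

Import Order.TTheory GRing.Theory Num.Theory numFieldNormedType.Exports.

Local Open Scope classical_set_scope.
Local Open Scope ring_scope.

(* R[i] packed as a numClosedFieldType, so that it gets the topology that
   MathComp-Analysis attaches to such fields. *)
Definition cplx (R : realType) : numClosedFieldType :=
  Num.ClosedField.clone R[i] _.

Definition cplx_of (R : realType) (x : R) : cplx R := real_complex R x.
Definition cabs (R : realType) (z : cplx R) : R := Normc.normc z.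

(* {fset I} directed by inclusion ([totally]): unconditional convergence of
   sums and products. *)
Definition is_sum (R : realType) (I : choiceType) (f : I -> cplx R)
    (l : cplx R) : Prop :=
  partial_sum f @ totally --> l.

Definition partial_prod (R : realType) (I : choiceType) (f : I -> cplx R)
    (A : {fset I}) : cplx R := \prod_(i : A) f (val i).

Definition is_prod (R : realType) (I : choiceType) (f : I -> cplx R)
    (l : cplx R) : Prop :=
  partial_prod f @ totally --> l.

Section Hilbert.
Variables (R : realType) (I : choiceType).
Local Notation C := (cplx R).

Definition sqsum (x : I -> C) : \bar R :=
  (\esum_(i in [set: I]) (cabs (x i) ^+ 2)%:E)%E.

Definition square_summable : {pred I -> C} :=
  fun x => `[< (sqsum x < +oo)%E >].

Lemma sqsum_ltyP (x : I -> C) :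
  (sqsum x < +oo)%E <->
  exists B : R, forall A : {fset I}, \sum_(i <- A) cabs (x i) ^+ 2 <= B.
Proof.
split=> [xfin|[B xB]].
- exists (fine (sqsum x)) => A.
  rewrite -lee_fin fineK; last first.
    by rewrite ge0_fin_numE //; apply: esum_ge0 => i _; rewrite lee_fin sqr_ge0.
  apply: esum_ge; exists [set` A] => //.
  by rewrite fsbig_finite //= set_fsetK -sumEFin.
- apply: (@le_lt_trans _ _ B%:E); last exact: ltry.
  apply: ge_ereal_sup => _ [F [Ffin _] <-].
  by rewrite fsbig_finite //= sumEFin lee_fin; exact: xB.
Qed.

Lemma cabsD (x y : C) : cabs (x + y) <= cabs x + cabs y.
Proof. exact: le_normcD. Qed.

Lemma cabsM (x y : C) : cabs (x * y) = cabs x * cabs y.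
Proof. exact: Normc.normcM. Qed.

Lemma cabs_ge0 (x : C) : 0 <= cabs x.
Proof. by case: x => a b; exact: sqrtr_ge0. Qed.

Lemma square_summable_closed : submod_closed square_summable.
Proof.
split.
  apply/asboolP/sqsum_ltyP; exists 0 => A.
  by rewrite big1 // => i _; rewrite /cabs Normc.normc0 expr0n.
move=> a x y /asboolP/sqsum_ltyP [B xB] /asboolP/sqsum_ltyP [D yD].
apply/asboolP/sqsum_ltyP; exists (2 * cabs a ^+ 2 * B + 2 * D) => A.
have term i : cabs ((a *: x + y) i) ^+ 2 <=
    2 * cabs a ^+ 2 * cabs (x i) ^+ 2 + 2 * cabs (y i) ^+ 2.
  have -> : (a *: x + y) i = a * x i + y i by [].
  apply: (@le_trans _ _ ((cabs (a * x i) + cabs (y i)) ^+ 2)).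
    by rewrite ler_sqr ?nnegrE ?addr_ge0 ?cabs_ge0 // cabsD.
  rewrite -mulrA -exprMn -cabsM -mulrDr -subr_ge0.
  set p := cabs _; set q := cabs _.
  have -> : 2 * (p ^+ 2 + q ^+ 2) - (p + q) ^+ 2 = (p - q) ^+ 2.
    by ring.
  exact: sqr_ge0.
apply: (le_trans (ler_sum _ (fun i _ => term i))).
rewrite big_split /= -!mulr_sumr.
by apply: lerD; apply: ler_wpM2l => //; rewrite mulr_ge0 ?sqr_ge0.
Qed.

HB.instance Definition _ :=
  GRing.isSubmodClosed.Build _ _ square_summable square_summable_closed.

Record l2 := L2 { l2_val :> I -> C; l2_valP : l2_val \in square_summable }.

HB.instance Definition _ := [isSub for l2_val].
HB.instance Definition _ := [Choice of l2 by <:].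
HB.instance Definition _ := [SubChoice_isSubLmodule of l2 by <:].

Lemma delta_square_summable (i : I) :
  (fun j => (j == i)%:R : C) \in square_summable.
Proof.
apply/asboolP; rewrite /sqsum (esum_mkcond [set: I]).
under eq_esum do rewrite in_setT.
rewrite (_ : esum _ _ = \esum_(j in [set i]) 1%:E)%E.
  by rewrite esum_set1 ?ltry.
rewrite [RHS]esum_mkcond; apply: eq_esum => j _; rewrite in_set1.
have [_|_] := eqVneq j i; rewrite /cabs.
  by rewrite Normc.normc1 expr1n.
by rewrite Normc.normc0 expr0n.
Qed.

Definition std_basis (i : I) : l2 := L2 (delta_square_summable i).

Definition l2norm (x : l2) : R := Num.sqrt (fine (sqsum x)).

End Hilbert.

Arguments l2 R I : clear implicits.
Arguments std_basis {R I} i.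

Section Operators.
Variables (R : realType).
Local Notation C := (cplx R).

(* Stated on functions, as it is used on ell^2 of I and of the powers of I. *)
Definition inner (I : choiceType) (x y : I -> C) : C :=
  sum (fun i => x i * (y i)^* : C).

Variable I : choiceType.
Local Notation H := (l2 R I).

Definition bounded_op (T : H -> H) : Prop :=
  exists K : R, forall x : H, l2norm (T x) <= K * l2norm x.

Definition adjoint_of (S T : H -> H) : Prop :=
  forall x y : H, inner (T x) y = inner x (S y).

(* [0 <= z] in C means that z is real and nonnegative. *)
Definition positive_op (P : H -> H) : Prop :=
  forall x : H, 0 <= inner (P x) x.

(* P = |T| = (T^* T)^(1/2), the positive square root. *)
Definition is_abs_op (T P : {linear H -> H}) : Prop :=
  [/\ bounded_op P, positive_op P &
      exists S : {linear H -> H},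
        [/\ bounded_op S, adjoint_of S T & forall x, P (P x) = S (T x)]].

Definition trace_class (T : {linear H -> H}) : Prop :=
  bounded_op T /\
  exists P : {linear H -> H}, is_abs_op T P /\
    exists t : C, is_sum (fun i => inner (P (std_basis i)) (std_basis i)) t.

(* x_1 /\ ... /\ x_n in the n-th Hilbert exterior power of ell^2(I), realized as
   the antisymmetric elements of ell^2(I^n).  The normalization is the one with
   <x_1 /\ ... /\ x_n, y_1 /\ ... /\ y_n> = det (<x_a, y_b>). *)
Definition wedge_prod (n : nat) (x : 'I_n -> H) : {ffun 'I_n -> I} -> C :=
  fun j => (sqrtC (n`!%:R : C))^-1 *
    \sum_(s : 'S_n) (-1) ^+ s * \prod_(a < n) x (s a) (j a).

Definition fset_nth (F : {fset I}) (a : 'I_#|{: F}|) : I := val (enum_val a).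

(* For F = {i_1, ..., i_k} with basis vectors b_1, ..., b_k: the vectors
   b_1 /\ ... /\ b_k form an orthonormal basis of the k-th exterior power as F
   varies, and the k-th exterior power of S maps b_1 /\ ... /\ b_k to
   S b_1 /\ ... /\ S b_k.  The order in which F is enumerated does not matter,
   as the sign occurs twice. *)
Definition ext_power_diag (S : H -> H) (F : {fset I}) : C :=
  inner (wedge_prod (fun a : 'I_#|{: F}| => S (std_basis (fset_nth a))))
        (wedge_prod (fun a : 'I_#|{: F}| => std_basis (fset_nth a))).

Definition is_ext_power_trace (S : H -> H) (k : nat) (t : C) : Prop :=
  is_sum (fun F : {F : {fset I} | #|` F| == k} => ext_power_diag S (val F)) t.

(* d is the Fredholm determinant det (1 - S). *)
Definition is_fredholm_det (S : H -> H) (d : C) : Prop :=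
  exists t : nat -> C, (forall k, is_ext_power_trace S k (t k)) /\
    series (fun k => (-1) ^+ k * t k) @ \oo --> d.

End Operators.

Section ComplexAnalysis.
Variable R : realType.
Local Notation C := (cplx R).

Definition entire (f : C -> C) : Prop := forall z : C, derivable f z 1.

(* f is meromorphic on the plane with set of poles P; its values on P are
   irrelevant. *)
Definition meromorphic (f : C -> C) (P : set C) : Prop :=
  [/\ forall z : C, \forall y \near z^', ~ P y,
      forall z : C, ~ P z -> derivable f z 1 &
      forall p : C, P p -> cabs (f z) @[z --> p^'] --> +oo].

(* 1 / f, for f meromorphic with set of poles P. *)
Definition recip (f : C -> C) (P : set C) : C -> C :=
  fun z => if `[< P z >] then 0 else (f z)^-1.

End ComplexAnalysis.

Record sgraph (V : choiceType) := SGraph {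
  adj : rel V;
  adj_sym : symmetric adj;
  adj_irr : irreflexive adj }.

Section Graph.
Variables (V : choiceType) (X : sgraph V).

Definition connected_graph : Prop :=
  forall x y : V, exists p : seq V, path (adj X) x p /\ last x p = y.

Definition bounded_valency : Prop :=
  exists2 M : nat, (0 < M)%N &
    forall (x : V) (s : seq V), uniq s -> all (adj X x) s -> (size s <= M)%N.

Definition OE := {e : V * V | adj X e.1 e.2}.

HB.instance Definition _ := Choice.on OE.

Definition org (e : OE) : V := (val e).1.
Definition tgt (e : OE) : V := (val e).2.

Lemma rev_subproof (e : OE) : adj X (tgt e, org e).1 (tgt e, org e).2.
Proof. by rewrite /= adj_sym; exact: (valP e). Qed.

Definition rev_edge (e : OE) : OE := exist _ (tgt e, org e) (rev_subproof e).

(* A path (x_0, ..., x_n) is represented by the sequence x_0 :: ... :: x_n. *)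
Definition is_path (s : seq V) : bool :=
  if s is x :: s' then path (adj X) x s' else false.

Definition plen (s : seq V) : nat := (size s).-1.

(* The oriented edges (x_0, x_1), ..., (x_(n-1), x_n) of a path. *)
Definition path_edges (s : seq V) : seq OE :=
  pmap insub (zip s (behead s)).

Definition closed_path (s : seq V) : bool :=
  if s is x :: s' then [&& is_path s, 0 < plen s & last x s' == x]%N else false.

(* (x_0, x_1, ..., x_n) |-> (x_1, ..., x_n, x_1) *)
Definition cycle_shift (s : seq V) : seq V :=
  if s is x0 :: (x1 :: _) as s' then rcons s' x1 else s.

(* x0 is only a default value for nth. *)
Definition regular_path (E : set OE) (s : seq V) : Prop :=
  forall (x0 : V) (j : nat), (0 < j < plen s)%N ->
    nth x0 s j.-1 = nth x0 s j.+1 ->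
    exists2 e : OE, E e & val e = (nth x0 s j.-1, nth x0 s j).

Definition closed_path_eq : seq V -> seq V -> Prop :=
  clos_refl_sym_trans _ (fun s t => closed_path s /\ t = cycle_shift s).

Definition cycle_of (s : seq V) : set (seq V) := [set t | closed_path_eq s t].

(* An equivalence class of closed paths, all of them E-regular. *)
Definition is_cycle (E : set OE) (c : set (seq V)) : Prop :=
  (exists2 s, closed_path s & c = cycle_of s) /\
  (forall t, c t -> regular_path E t).

Definition repeat_path (k : nat) (s : seq V) : seq V :=
  if s is x :: s' then x :: flatten (nseq k s') else [::].

Definition is_power (k : nat) (c c0 : set (seq V)) : Prop :=
  exists2 s, c0 s & c = cycle_of (repeat_path k s).

(* Length and weight are read off a representative; see closed_path_eq_plen
   and closed_path_eq_weight. *)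
Definition cycle_length (c : set (seq V)) : nat := plen (xget [::] c).

Definition is_prime_cycle (E : set OE) (c : set (seq V)) : Prop :=
  is_cycle E c /\
  ~ exists k c0, [/\ is_cycle E c0, (cycle_length c0 < cycle_length c)%N &
                     is_power k c c0].

Definition prime_cycles (E : set OE) : set (set (seq V)) :=
  [set p | is_prime_cycle E p].

Section Weight.
Variables (R : realType) (w : OE -> R).

Definition path_weight (s : seq V) : R := \prod_(e <- path_edges s) w e.

Definition cycle_weight (c : set (seq V)) : R := path_weight (xget [::] c).

Lemma closed_path_eq_plen (s t : seq V) :
  closed_path_eq s t -> plen s = plen t.
Proof.
elim=> {s t} [s t [_ ->]|//|s t _ ->//|s t u _ -> _ ->//].
by case: s => [|x [|y s]] //=; rewrite /plen /= size_rcons.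
Qed.

Lemma closed_path_eq_weight (s t : seq V) :
  closed_path_eq s t -> path_weight s = path_weight t.
Proof.
elim=> {s t} [s t [+ ->]|//|s t _ ->//|s t u _ -> _ ->//].
case: s => [|x [|y s]] //= /andP[_ /eqP sx].
rewrite /path_weight /path_edges /=.
have zipE (z : V) : zip (z :: rcons s y) (rcons s y) =
    rcons (zip (z :: s) s) (last z s, y).
  by elim: s z {sx} => //= a s IH z; rewrite -IH.
rewrite zipE -cats1 pmap_cat big_cat /= sx.
by case: insubP => [e _ _|_] /=; rewrite ?big_cons ?big_nil ?mulr1 // mulrC.
Qed.

(* The summation condition in the definition of T_E e. *)
Definition successor (E : set OE) (e e' : OE) : Prop :=
  org e' = tgt e /\ (e' <> rev_edge e \/ E e).

(* The sum is finite when X has bounded valency. *)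
Definition is_edge_operator (E : set OE)
    (T : {linear l2 R OE -> l2 R OE}) : Prop :=
  bounded_op T /\
  forall e : OE,
    T (std_basis e) = \sum_(e' \in [set e' | successor E e e'])
                     cplx_of (w e') *: std_basis e'.

(* 1 - w(p) u^l(p) *)
Definition euler_factor (u : cplx R) (c : set (seq V)) : cplx R :=
  1 - cplx_of (cycle_weight c) * u ^+ cycle_length c.

End Weight.
End Graph.

(* Main.v *)
Require Import Defs.
From HB Require Import structures.
From mathcomp Require Import all_boot all_order all_algebra all_fingroup finmap.
From mathcomp Require Import complex ring lra.
From mathcomp Require Import all_classical all_reals all_analysis.
From mathcomp.analysis Require Import summability.
From Stdlib Require Import Relation_Operators.

(** Proof idea.

    [T] maps the span of the edges ending at a vertex [v] into the span of the edges
    starting at [v], so [T^* T] is block diagonal with finite blocks.  The absolute value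
    [|T|] is therefore obtained from roots of finite positive matrices, and its trace is at
    most the sum of the norms of the [T e], which is finite since the total weight is.

    The trace of the [k]-th exterior power of [T] is the sum of the principal [k]-minors of
    the matrix of [T].  With [M] a bound for the valency, a minor on [F] is at most
    the product over [b] in [F] of [M w(b)], so these traces are, up to sign, the
    coefficients of an entire function [d].

    For a finite alphabet [A] of edges, the coefficients of the determinant of [1 - u T_A],
    [T_A] being the compression of [T] to [A], and those of the finite product of the factors
    [1 - w(p) u^l(p)] over the prime cycles in [A] of length at most [n] satisfy the same
    Newton recursion up to order [n]: the trace of [T_A^j] is the weighted number of cyclic
    words of length [j], each of which is in a unique way a power of a primitive word.
    Letting [n] and [A] grow, with tail bounds uniform in [A], gives the product formula for
    small [u].

    Finally [Z = 1 / d], and the zeros of [d] are isolated because each Horner division by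
    [u - z] shrinks a coefficient bound of [d] by the factor 3 relative to [d(0) = 1]. *)

Set Implicit Arguments.
Unset Strict Implicit.
Unset Printing Implicit Defensive.

Import Order.TTheory GRing.Theory Num.Theory numFieldNormedType.Exports.

Local Open Scope classical_set_scope.
Local Open Scope ring_scope.

(** * Unconditional sums and power series over the complex numbers *)

(** Two limits meet in the product formula: the determinant is a limit over finite sets [A] of
    edges, while even a finite [A] may carry infinitely many prime cycles. Coefficients are compared
    because up to order [n] the comparison is exact and purely algebraic: in characteristic zero the
    Newton recursion determines them, so no logarithm of a determinant or of a product is taken.
    What lies beyond order [n] is controlled by coefficient bounds independent of [A] and [n]. These
    hold on the disc of radius [1 / (5 (W + 1))], where [W] bounds the total weight: there the terms
    [w(p) |u|^l(p)] sum to at most 1/4, so every finite partial product stays within 1/2 of 1 and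
    can be inverted.

    The operator [|T|] must be shown positive. It is built as [Q Q] with [Q] self-adjoint, so that
    its quadratic form is a square norm; this is why each finite block contributes the fourth root
    of a Gram matrix and not only the square root. *)

Section ComplexModulus.
Variable R : realType.
Local Notation C := (cplx R).
Implicit Types x y z : C.

Lemma cabs0 : cabs (0 : C) = 0. Proof. exact: Normc.normc0. Qed.
Lemma cabs1 : cabs (1 : C) = 1. Proof. exact: Normc.normc1. Qed.
Lemma cabsN x : cabs (- x) = cabs x. Proof. exact: normcN. Qed.
Lemma cabsV x : cabs x^-1 = (cabs x)^-1. Proof. exact: Normc.normcV. Qed.

Lemma cabs_eq0 x : (cabs x == 0) = (x == 0).
Proof. by apply/eqP/eqP => [/Normc.eq0_normc//|->]; exact: cabs0. Qed.

Lemma cabs_gt0 x : (0 < cabs x) = (x != 0).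
Proof. by rewrite lt_def cabs_ge0 andbT cabs_eq0. Qed.

Lemma cabsX x n : cabs (x ^+ n) = cabs x ^+ n.
Proof. by elim: n => [|n IH]; rewrite ?expr0 ?cabs1 // !exprS cabsM IH. Qed.

Lemma cabsBC x y : cabs (x - y) = cabs (y - x).
Proof. by rewrite -cabsN opprB. Qed.

Lemma cabs_of (a : R) : cabs (cplx_of a) = `|a|.
Proof. by rewrite /cabs /= expr0n /= addr0 sqrtr_sqr. Qed.

Lemma normC_cabs z : `|z| = cplx_of (cabs z).
Proof. by case: z. Qed.

Lemma cabs_conj z : cabs z^* = cabs z.
Proof.
apply: (@complexI R); change (cplx_of (cabs z^*) = cplx_of (cabs z)).
by rewrite -!normC_cabs norm_conjC.
Qed.

Lemma cabs_sum (I : Type) (s : seq I) (P : pred I) (f : I -> C) :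
  cabs (\sum_(i <- s | P i) f i) <= \sum_(i <- s | P i) cabs (f i).
Proof.
elim/big_ind2: _ => //; first by rewrite cabs0.
by move=> x a y b xa yb; apply: (le_trans (cabsD _ _)); exact: lerD.
Qed.

Lemma cabs_prod (I : Type) (s : seq I) (P : pred I) (f : I -> C) :
  cabs (\prod_(i <- s | P i) f i) = \prod_(i <- s | P i) cabs (f i).
Proof. by elim/big_ind2: _ => //; [exact: cabs1|move=> x a y b <- <-; exact: cabsM]. Qed.

Lemma cplx_ofM (a b : R) : cplx_of (a * b) = cplx_of a * cplx_of b.
Proof. exact: (rmorphM (real_complex R)). Qed.

Lemma cplx_of_prod (I : Type) (s : seq I) (P : pred I) (f : I -> R) :
  cplx_of (\prod_(i <- s | P i) f i) = \prod_(i <- s | P i) cplx_of (f i).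
Proof. exact: (rmorph_prod (real_complex R)). Qed.

Lemma cplx_of_sum (I : Type) (s : seq I) (P : pred I) (f : I -> R) :
  cplx_of (\sum_(i <- s | P i) f i) = \sum_(i <- s | P i) cplx_of (f i).
Proof. exact: (rmorph_sum (real_complex R)). Qed.

Lemma cplx_of_ge0 (a : R) : (0 <= cplx_of a) = (0 <= a).
Proof. exact: (ler0c a). Qed.

Lemma cabs_re (z : C) : `|complex.Re z| <= cabs z.
Proof.
case: z => a b; rewrite /cabs /= -sqrtr_sqr.
by apply: ler_wsqrtr; rewrite lerDl sqr_ge0.
Qed.

Lemma cabs_im (z : C) : `|complex.Im z| <= cabs z.
Proof.
case: z => a b; rewrite /cabs /=; rewrite -sqrtr_sqr.
by apply: ler_wsqrtr; rewrite lerDr sqr_ge0.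
Qed.

Lemma cabs_sqr z : z * z^* = cplx_of (cabs z ^+ 2).
Proof. by rewrite -normCK normC_cabs !expr2 cplx_ofM. Qed.

(** Distances in [cplx R] are compared with positive complex numbers, and these are exactly the
    positive reals; all later estimates therefore work with a real [e]. *)
Lemma cvg_cabsP (T : Type) (F : set_system T) {FF : Filter F} (f : T -> C) (l : C) :
  (f @ F --> l) <-> forall e : R, 0 < e -> \forall x \near F, cabs (l - f x) < e.
Proof.
split=> [/cvgrPdist_lt fl e e0|fl].
  have /fl : (0 : C) < cplx_of e by rewrite (ltcR 0 e).
  by apply: filterS => x; rewrite normC_cabs /= (ltcR _ _).
apply/cvgrPdist_lt => -[a b].
rewrite [_ < _]ltcE /= => /andP[/eqP -> a0].
by apply: filterS (fl a a0) => x lx; rewrite normC_cabs (ltcR _ a).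
Qed.

End ComplexModulus.

#[local] Existing Instance totally_filter.

Section UnconditionalSums.
Variable R : realType.
Local Notation C := (cplx R).

Section Families.
Variable I : choiceType.
Implicit Types (f g : I -> C) (A B : {fset I}).

Lemma is_sumP f l :
  is_sum f l <-> forall e : R, 0 < e -> exists A0, forall A, (A0 `<=` A)%fset ->
    cabs (l - \sum_(i <- A) f i) < e.
Proof.
rewrite /is_sum; split.
  move=> /cvg_cabsP fl e /fl [A0 _ H]; exists A0 => A /H /=.
  by rewrite /partial_sum -(big_seq_fsetE _ A xpredT f).
move=> fl; apply/cvg_cabsP => e /fl [A0 H]; exists A0 => // A /H /=.
by rewrite /partial_sum -(big_seq_fsetE _ A xpredT f).
Qed.

Lemma is_prodP f l :
  is_prod f l <-> forall e : R, 0 < e -> exists A0, forall A, (A0 `<=` A)%fset ->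
    cabs (l - \prod_(i <- A) f i) < e.
Proof.
rewrite /is_prod; split.
  move=> /cvg_cabsP fl e /fl [A0 _ H]; exists A0 => A /H /=.
  by rewrite /partial_prod -(big_seq_fsetE _ A xpredT f).
move=> fl; apply/cvg_cabsP => e /fl [A0 H]; exists A0 => // A /H /=.
by rewrite /partial_prod -(big_seq_fsetE _ A xpredT f).
Qed.

Lemma is_sum_sum f l : is_sum f l -> sum f = l.
Proof. by move=> fl; apply/cvg_lim => //; exact: norm_hausdorff. Qed.

Lemma is_sumD f g l m : is_sum f l -> is_sum g m ->
  is_sum (fun i => f i + g i) (l + m).
Proof.
move=> /is_sumP fl /is_sumP gm; apply/is_sumP => e e0.
have e20 : 0 < e / 2 by rewrite divr_gt0.
have [[A HA] [B HB]] := (fl _ e20, gm _ e20).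
exists (A `|` B)%fset => D; rewrite fsubUset => /andP[/HA a /HB b].
rewrite big_split /= opprD addrACA [e]splitr.
by apply: le_lt_trans (cabsD _ _) _; exact: ltrD.
Qed.

Lemma is_sumZ (a : C) f l : is_sum f l -> is_sum (fun i => a * f i) (a * l).
Proof.
move=> /is_sumP fl; apply/is_sumP => e e0.
have d0 : 0 < cabs a + 1 by rewrite ltr_wpDl ?cabs_ge0.
have [A HA] := fl (e / (cabs a + 1)) (divr_gt0 e0 d0).
exists A => B /HA; rewrite -mulr_sumr -mulrBr cabsM ltr_pdivlMr // mulrC.
apply: le_lt_trans; apply: ler_wpM2r; first exact: cabs_ge0.
by rewrite lerDl.
Qed.

Lemma big_fsetIDsub (T : Type) (idx : T) (op : Monoid.com_law idx) A B (h : I -> T) :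
  (A `<=` B)%fset ->
  \big[op/idx]_(i <- B) h i =
    op (\big[op/idx]_(i <- A) h i) (\big[op/idx]_(i <- (B `\` A)%fset) h i).
Proof.
move=> AB; rewrite (big_fsetID _ (mem A)) /=; congr (op _ _); apply: congr_big => //.
  congr enum_fset; apply/fsetP => x; rewrite !inE /= andbC.
  by case xA: (x \in A) => //=; exact: (fsubsetP AB).
by congr enum_fset; apply/fsetP => x; rewrite !inE /= andbC.
Qed.

Lemma is_sum_fin f A : (forall i, i \notin A -> f i = 0) ->
  is_sum f (\sum_(i <- A) f i).
Proof.
move=> f0; apply/is_sumP => e e0; exists A => B AB.
rewrite (big_fsetIDsub _ _ AB) /= [X in _ - (_ + X)]big1_fset ?addr0 ?subrr ?cabs0 //.
by move=> i; rewrite !inE /= => /andP[/f0].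
Qed.

Lemma is_sum_le f l (b : R) A0 :
  (forall A, (A0 `<=` A)%fset -> cabs (\sum_(i <- A) f i) <= b) ->
  is_sum f l -> cabs l <= b.
Proof.
move=> fb /is_sumP fl; apply/ler_addgt0Pr => e /fl [A HA].
have /HA le : (A `<=` A `|` A0)%fset by rewrite fsubsetUl.
have /fb lb : (A0 `<=` A `|` A0)%fset by rewrite fsubsetUr.
rewrite -[l](subrK (\sum_(i <- (A `|` A0)%fset) f i)) addrC.
by apply: (le_trans (cabsD _ _)); apply: lerD => //; exact: ltW.
Qed.

Definition abs_summable f := exists B : R,
  forall A, \sum_(i <- A) cabs (f i) <= B.

Lemma sum_fset_mono (h : I -> R) A B : (forall i, 0 <= h i) -> (A `<=` B)%fset ->
  \sum_(i <- A) h i <= \sum_(i <- B) h i.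
Proof.
by move=> h0 AB; rewrite (big_fsetIDsub _ _ AB) /= lerDl sumr_ge0.
Qed.

Lemma sum_fsetU_disjoint (S : nmodType) (h : I -> S) A B : [disjoint A & B]%fset ->
  \sum_(i <- (A `|` B)%fset) h i = \sum_(i <- A) h i + \sum_(i <- B) h i.
Proof.
move=> AB; rewrite (big_fsetIDsub _ _ (fsubsetUl A B)) /=; congr (_ + _).
apply: congr_big => //; congr enum_fset; apply/fsetP => x; rewrite !inE.
case xA: (x \in A) => //=; case xB: (x \in B) => //.
by move/fdisjointP: AB => /(_ x xA); rewrite xB.
Qed.

(** The number [l] is the supremum of the finite partial sums; the two properties given are all that
    is used of an infinite nonnegative sum. *)
Lemma nonneg_sum_tail (h : I -> R) (b : R) : (forall i, 0 <= h i) ->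
  (forall A, \sum_(i <- A) h i <= b) ->
  exists2 l, forall A, \sum_(i <- A) h i <= l &
    forall e, 0 < e -> exists A, l - e < \sum_(i <- A) h i.
Proof.
move=> h0 hb; pose S := [set \sum_(i <- A) h i | A in [set: {fset I}]].
have S0 : S (\sum_(i <- fset0) h i) by exists fset0.
have supS : has_sup S.
  by split; [eexists; exact: S0|exists b => _ [A _ <-]].
exists (sup S); first by move=> A; apply: ub_le_sup; [case: supS|exists A].
by move=> e e0; have [_ [A _ <-] H] := sup_adherent e0 supS; exists A.
Qed.

(** A set [A0] whose sum is within [e] of the supremum leaves less than [e] for any set disjoint
    from it. *)
Lemma abs_summable_tail f (e : R) : abs_summable f -> 0 < e ->
  exists A0, forall A, [disjoint A0 & A]%fset -> \sum_(i <- A) cabs (f i) < e.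
Proof.
move=> [b fb] e0.
have [l Al le] := nonneg_sum_tail (fun i => cabs_ge0 (f i)) fb.
have [A0 HA0] := le e e0; exists A0 => A dA.
have := Al (A0 `|` A)%fset; rewrite sum_fsetU_disjoint //.
by move: HA0; lra.
Qed.

Lemma is_sum_real (h : I -> R) (b : R) : (forall i, 0 <= h i) ->
  (forall A, \sum_(i <- A) h i <= b) ->
  exists l, is_sum (fun i => cplx_of (h i)) l.
Proof.
move=> h0 hb; have [l Al le] := nonneg_sum_tail h0 hb.
exists (cplx_of l); apply/is_sumP => e /le [A HA]; exists A => B AB.
rewrite -cplx_of_sum -(rmorphB (real_complex R)) (cabs_of (l - _)).
rewrite ger0_norm ?subr_ge0 // ltrBlDr -ltrBlDl.
by apply: (lt_le_trans HA); exact: sum_fset_mono.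
Qed.

(* Split into real and imaginary, positive and negative parts. *)
Lemma abs_summable_is_sum f : abs_summable f -> exists l, is_sum f l.
Proof.
move=> [b fb].
pose part (s : bool) (t : R) := (`|t| + (-1) ^+ s * t) / 2.
have part_ge0 s t : 0 <= part s t.
  rewrite /part; case: s; rewrite ?expr0 ?expr1; move: (ler_norm t) (ler_norm (- t));
  rewrite normrN; lra.
have part_le s t : part s t <= `|t|.
  rewrite /part; case: s; rewrite ?expr0 ?expr1; move: (ler_norm t) (ler_norm (- t));
  rewrite normrN; lra.
have sumpart (p : C -> R) s : (forall z, `|p z| <= cabs z) ->
    exists l, is_sum (fun i => cplx_of (part s (p (f i)))) l.
  move=> pz; apply: (@is_sum_real _ b) => // A; apply: le_trans (fb A).
  by apply: ler_sum => i _; exact: le_trans (part_le _ _) (pz _).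
have [l1 s1] := sumpart _ false (@cabs_re R).
have [l2 s2] := sumpart _ true (@cabs_re R).
have [l3 s3] := sumpart _ false (@cabs_im R).
have [l4 s4] := sumpart _ true (@cabs_im R).
pose ic : C := 'i%C; exists (l1 + - 1 * l2 + (ic * l3 + - ic * l4)).
have := is_sumD (is_sumD s1 (is_sumZ (a := -1) s2))
                (is_sumD (is_sumZ (a := ic) s3) (is_sumZ (a := - ic) s4)).
congr is_sum; apply/funext => i.
have partB t : cplx_of (part false t) - cplx_of (part true t) = cplx_of t.
  rewrite -(rmorphB (real_complex R)); apply: (congr1 (@cplx_of R)).
  by rewrite /part expr0 expr1; field.
by rewrite mulN1r partB mulNr -mulrBr partB -[LHS](@complexE R (f i)).
Qed.

End Families.

Lemma big_fset_seq (T : choiceType) (S : Type) (idx : S) (op : Monoid.com_law idx)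
    (s : seq T) (h : T -> S) : uniq s ->
  \big[op/idx]_(i <- [fset x in s]%fset) h i = \big[op/idx]_(i <- s) h i.
Proof.
move=> us; apply: perm_big; apply: uniq_perm => // x; first by rewrite !inE.
Qed.

Lemma sum_fset_nat (S : nmodType) (h : nat -> S) n :
  \sum_(i <- [fset x in iota 0 n]%fset) h i = \sum_(0 <= i < n) h i.
Proof. by rewrite big_fset_seq ?iota_uniq // /index_iota subn0. Qed.

Lemma fset_nat_bound (A : {fset nat}) : exists n, forall m, (n <= m)%N ->
  (A `<=` [fset x in iota 0 m])%fset.
Proof.
exists (\max_(i <- A) i).+1 => m nm; apply/fsubsetP => i iA.
rewrite !inE /= mem_iota /= add0n; apply: leq_trans nm; rewrite ltnS.
by rewrite (big_rem i) //= leq_maxl.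
Qed.

Lemma is_sum_series (f : nat -> C) l : is_sum f l -> series f @ \oo --> l.
Proof.
move=> /is_sumP fl; apply/cvg_cabsP => e /fl [A HA].
have [n nA] := fset_nat_bound A; exists n => // m /nA /HA.
by rewrite sum_fset_nat.
Qed.

End UnconditionalSums.

(** * Power series controlled by Cauchy estimates *)

Section PowerSeries.
Variable R : realType.
Local Notation C := (cplx R).
Implicit Types (c : nat -> C) (r B : R) (z u : C).

Lemma near_cabs (z : C) (P : C -> Prop) :
  (exists2 d : R, 0 < d & forall u, cabs (u - z) < d -> P u) ->
  \forall u \near z, P u.
Proof.
move=> [d d0 H]; apply/nbhs_ballP; exists (cplx_of d); first by rewrite /= (ltcR 0 d).
by move=> u; rewrite -ball_normE /= distrC normC_cabs (ltcR _ d) => /H.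
Qed.

Lemma dnear_cabs (z : C) (P : C -> Prop) :
  (exists2 d : R, 0 < d & forall u, u != z -> cabs (u - z) < d -> P u) ->
  \forall u \near z^', P u.
Proof.
move=> [d d0 H]; suff: \forall u \near z, u != z -> P u by [].
by apply: near_cabs; exists d => // u uz zu; exact: H.
Qed.

Lemma cvg_at_cabsP (f : C -> C) (z l : C) :
  (f u @[u --> z] --> l) <-> forall e : R, 0 < e -> exists2 d : R, 0 < d &
    forall u, cabs (u - z) < d -> cabs (l - f u) < e.
Proof.
split=> [/(@cvg_cabsP R C (nbhs z) _ f l) H e /H|H]; last first.
  apply/(@cvg_cabsP R C (nbhs z) _ f l) => e /H; exact: near_cabs.
move=> /nbhs_ballP[[d1 d2]] d0 Hd; move: (d0).
rewrite /= [_ < _]ltcE /= => /andP[/eqP d20 d10].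
exists d1 => // u uz; apply: Hd; rewrite -ball_normE /= distrC normC_cabs.
by rewrite d20 (ltcR _ d1).
Qed.

Lemma eq0_or_neq0 (z : C) : z = 0 \/ z != 0.
Proof. by case: (z =P 0) => [|/eqP]; [left|right]. Qed.

(** A Cauchy estimate on the circle of radius [r]. Shifts and Horner division preserve it with
    explicit new constants, so that continuity, derivability and isolation of zeros all follow from
    bounds on coefficients. *)
Definition ps_bound c r B := forall k, cabs (c k) * r ^+ k <= B.

Definition psum c z : C := lim (series (fun k => c k * z ^+ k) @ \oo).

Lemma geometric_fset_le (q : R) (A : {fset nat}) : 0 <= q < 1 ->
  \sum_(k <- A) q ^+ k <= (1 - q)^-1.
Proof.
move=> /andP[q0 q1]; have [n /(_ n (leqnn n)) An] := fset_nat_bound A.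
apply: le_trans (sum_fset_mono (fun k => exprn_ge0 k q0) An) _.
rewrite sum_fset_nat big_mkord -[leRHS]mul1r ler_pdivlMr ?subr_gt0 //.
have := subrX1 q n; set S := \sum_(i < n) _ => E.
have -> : S * (1 - q) = 1 - q ^+ n by move: E; lra.
by rewrite gerBl exprn_ge0.
Qed.

Lemma ps_abs_le c r B z (A : {fset nat}) : ps_bound c r B -> 0 < r -> cabs z < r ->
  \sum_(k <- A) cabs (c k * z ^+ k) <= B / (1 - cabs z / r).
Proof.
move=> cB r0 zr; have B0 : 0 <= B.
  by apply: le_trans (cB 0%N); rewrite expr0 mulr1 cabs_ge0.
have q1 : 0 <= cabs z / r < 1.
  by rewrite divr_ge0 ?cabs_ge0 ?(ltW r0) // ltr_pdivrMr // mul1r.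
apply: (@le_trans _ _ (\sum_(k <- A) B * (cabs z / r) ^+ k)); last first.
  by rewrite -mulr_sumr ler_wpM2l // geometric_fset_le.
apply: ler_sum => k _; rewrite cabsM cabsX expr_div_n mulrA ler_pdivlMr ?exprn_gt0 //.
by rewrite mulrAC ler_wpM2r // exprn_ge0 // cabs_ge0.
Qed.

Lemma psumP c r B z : ps_bound c r B -> 0 < r -> cabs z < r ->
  is_sum (fun k => c k * z ^+ k) (psum c z) /\
  series (fun k => c k * z ^+ k) @ \oo --> psum c z.
Proof.
move=> cB r0 zr.
have [|l sl] := @abs_summable_is_sum R _ (fun k => c k * z ^+ k).
  by exists (B / (1 - cabs z / r)) => A; exact: ps_abs_le.
have sc := is_sum_series sl.
have -> : psum c z = l by apply/cvg_lim => //; exact: norm_hausdorff.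
by [].
Qed.

Lemma psum_unique c z l : series (fun k => c k * z ^+ k) @ \oo --> l -> psum c z = l.
Proof. by move=> H; apply/cvg_lim => //; exact: norm_hausdorff. Qed.

Lemma psum_le c r B z : ps_bound c r B -> 0 < r -> cabs z < r ->
  cabs (psum c z) <= B / (1 - cabs z / r).
Proof.
move=> cB r0 zr; have [H _] := psumP cB r0 zr.
apply: (is_sum_le (A0 := fset0) _ H) => A _.
by apply: le_trans (cabs_sum _ _ _) _; exact: ps_abs_le.
Qed.

(** On [cabs z <= r / 2] the ratio is at most 1/2, so the geometric tail is twice its first term.
    The coefficients enter only through [B], which makes the estimate uniform over families of
    series. *)
Lemma psum_tail c r B z n : ps_bound c r B -> 0 < r -> cabs z <= r / 2 ->
  cabs (psum c z - \sum_(k < n) c k * z ^+ k) <= 2 * B / 2 ^+ n.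
Proof.
move=> cB r0 zr; have zr' : cabs z < r by move: zr; lra.
have B0 : 0 <= B by apply: le_trans (cB 0%N); rewrite expr0 mulr1 cabs_ge0.
have [_ H] := psumP cB r0 zr'.
apply/ler_addgt0Pr => e e0; move/cvg_cabsP: H => /(_ e e0) [N _ HN].
have /= := HN (n + N)%N (leq_addl _ _).
rewrite /series /= (big_cat_nat (n := n)) //= ?leq_addr // big_mkord.
set s := \sum_(i < n) _; set t := \sum_(_ <= i < _) _ => Hl.
have tB : cabs t <= 2 * B / 2 ^+ n.
  apply: le_trans (cabs_sum _ _ _) _.
  apply: (@le_trans _ _ (\sum_(n <= i < n + N) B * 2^-1 ^+ i)).
    apply: ler_sum => k _; rewrite cabsM cabsX.
    apply: (@le_trans _ _ (cabs (c k) * r ^+ k * 2^-1 ^+ k)).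
      rewrite -mulrA -exprMn; apply: ler_wpM2l; first exact: cabs_ge0.
      by apply: lerXn2r; rewrite ?nnegrE ?cabs_ge0 // divr_ge0 // ltW.
    by apply: ler_wpM2r; rewrite // exprn_ge0.
  rewrite -mulr_sumr -{1}[n]add0n big_addn addKn.
  under eq_bigr do rewrite exprD.
  rewrite -mulr_suml -sum_fset_nat mulrA [2 * B]mulrC -exprVn.
  apply: ler_wpM2r; first exact: exprn_ge0.
  apply: ler_wpM2l => //; apply: le_trans (geometric_fset_le _ _) _.
    by apply/andP; split; lra.
  by rewrite (_ : 1 - 2^-1 = 2^-1) ?invrK //; lra.
have -> : psum c z - s = (psum c z - (s + t)) + t by rewrite opprD addrA subrK.
apply: le_trans (cabsD _ _) _; rewrite addrC; apply: lerD => //; exact: ltW.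
Qed.

Lemma ps_bound_shift c r B n : 0 < r -> ps_bound c r B ->
  ps_bound (fun j => c (n + j)%N) r (B / r ^+ n).
Proof.
move=> r0 cB k; rewrite ler_pdivlMr ?exprn_gt0 // -mulrA -exprD addnC; exact: cB.
Qed.

Lemma psum_shift c r B z : ps_bound c r B -> 0 < r -> cabs z < r ->
  psum c z = c 0%N + z * psum (fun j => c j.+1) z.
Proof.
move=> cB r0 zr; apply: psum_unique.
have [_ H] := psumP (ps_bound_shift 1 r0 cB) r0 zr.
rewrite -cvg_shiftS.
rewrite (_ : (fun n => _) = fun n => c 0%N +
    z * series (fun k => c k.+1 * z ^+ k) n).
  by apply: cvgD; [exact: cvg_cst|apply: cvgMr].
apply/funext => n; rewrite /series /= big_nat_recl //= expr0 mulr1 mulr_sumr.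
by congr (_ + _); apply: eq_bigr => i _; rewrite exprS mulrCA.
Qed.

(** The coefficients of [(f(u) - f(z0)) / (u - z0)] for [f = psum c], obtained by synthetic
    division: [c_(k+1) + c_(k+2) z0 + ...]. *)
Definition ps_quot c z0 k : C := psum (fun j => c (k.+1 + j)%N) z0.

Section Division.
Variables (c : nat -> C) (r B : R) (z0 : C).
Hypotheses (cB : ps_bound c r B) (r0 : 0 < r) (z0r : 4 * cabs z0 <= r).

Let z0r' : cabs z0 < r. Proof. by have := cabs_ge0 z0; move: z0r r0; lra. Qed.

(** The factor 4/3 is [1 / (1 - 1/4)], the geometric sum for a ratio [cabs z0 / r] of at most
    1/4. *)
Lemma ps_quot_bound : ps_bound (ps_quot c z0) r (4 / 3 * B / r).
Proof.
move=> k.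
have B0 : 0 <= B by apply: le_trans (cB 0%N); rewrite expr0 mulr1 cabs_ge0.
have := psum_le (ps_bound_shift k.+1 r0 cB) r0 z0r'; rewrite -/(ps_quot c z0 k).
set q := cabs z0 / r => H.
have q4 : q <= 4^-1 by rewrite /q ler_pdivrMr // ; move: z0r; lra.
have rk : 0 < r ^+ k.+1 by rewrite exprn_gt0.
have : cabs (ps_quot c z0 k) * r ^+ k.+1 <= B * (4 / 3).
  rewrite -ler_pdivlMr //; apply: le_trans H _; rewrite mulrAC.
  apply: ler_wpM2r; first by rewrite invr_ge0 ltW.
  apply: ler_wpM2l => //; rewrite -[leRHS]invf_div.
  by rewrite lef_pV2 ?posrE; lra.
by rewrite exprSr mulrA => H'; rewrite ler_pdivlMr // [4 / 3 * B]mulrC.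
Qed.

Lemma ps_quot_coef k :
  psum (fun j => c (k + j)%N) z0 = c k + z0 * ps_quot c z0 k.
Proof.
rewrite (psum_shift (ps_bound_shift k r0 cB) r0 z0r') addn0 /ps_quot.
by under eq_fun do rewrite addnS -addSn.
Qed.

(* Horner's division by [u - z0], with remainder the value at [z0]. *)
Lemma psum_div u : cabs u < r ->
  psum c u = psum c z0 + (u - z0) * psum (ps_quot c z0) u.
Proof.
move=> ur; apply: psum_unique.
have [_ H] := psumP ps_quot_bound r0 ur.
set b := ps_quot c z0 in H *.
rewrite -cvg_shiftS.
rewrite (_ : (fun n => _) = fun n => psum c z0 +
   (u * series (fun k => b k * u ^+ k) n - z0 * series (fun k => b k * u ^+ k) n.+1)).
  rewrite mulrBl; apply: cvgD; first exact: cvg_cst.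
  apply: cvgB; apply: cvgMr => //.
  by move: H; rewrite -cvg_shiftS.
apply/funext => n; rewrite /series /=; elim: n => [|n IH].
  rewrite !big_nat1 big_geq // mulr0 expr0 !mulr1 sub0r.
  by apply/eqP; rewrite eq_sym subr_eq -(ps_quot_coef 0).
rewrite big_nat_recr //= IH [in RHS]big_nat_recr //= [X in _ = _ + (_ - _ * X)]big_nat_recr //=.
have -> : c n.+1 = b n - z0 * b n.+1.
  by apply/eqP; rewrite eq_sym subr_eq -ps_quot_coef.
by rewrite exprS; ring.
Qed.

Lemma psum_continuous : psum c u @[u --> z0] --> psum c z0.
Proof.
apply/cvg_at_cabsP => e e0.
have B0 : 0 <= B by apply: le_trans (cB 0%N); rewrite expr0 mulr1 cabs_ge0.
(* On [cabs u <= r / 2] the quotient series is bounded by twice its constant; the added 1 keeps [K]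
   positive when [B = 0]. *)
pose K := 2 * (4 / 3 * B / r) + 1.
have K0 : 0 < K by rewrite ltr_wpDl // mulr_ge0 // divr_ge0 ?mulr_ge0 // ltW.
exists (Num.min (r / 4) (e / K)) => [|u].
  by rewrite lt_min !divr_gt0.
rewrite lt_min => /andP[ur ue].
have ur2 : cabs u <= r / 2.
  rewrite -[u](subrK z0); apply: le_trans (cabsD _ _) _.
  by move: ur z0r; lra.
have ur1 : cabs u < r by move: ur2 r0; lra.
rewrite cabsBC (psum_div ur1) addrC addKr cabsM.
move: ue; rewrite ltr_pdivlMr //; apply: le_lt_trans.
apply: ler_wpM2l; first exact: cabs_ge0.
apply: le_trans (psum_le ps_quot_bound r0 ur1) _.
have b0 : 0 <= 4 / 3 * B / r by rewrite divr_ge0 ?mulr_ge0 // ltW.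
rewrite /K mulrC; apply: ler_wpDr => //; apply: ler_wpM2r => //.
rewrite -[leRHS]invrK lef_pV2 ?posrE ?invr_gt0 ?subr_gt0 ?ltr_pdivrMr ?mul1r //.
by rewrite lerBrDr -lerBrDl ler_pdivrMr //; move: ur2; lra.
Qed.

End Division.

Definition ps_entire c := forall r, 0 < r -> exists B, ps_bound c r B.

Lemma psum_entire_continuous c : ps_entire c -> forall z, psum c u @[u --> z] --> psum c z.
Proof.
move=> ce z; have r0 : 0 < 4 * cabs z + 1 by rewrite ltr_wpDl // mulr_ge0 // cabs_ge0.
have [B cB] := ce _ r0.
by apply: (psum_continuous cB r0); rewrite lerDl.
Qed.

(** The difference quotient at [z] is the Horner quotient series evaluated at [z + h], and that
    series is continuous at [z]. *)
Lemma psum_entire c : ps_entire c -> entire (psum c).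
Proof.
move=> ce z; have z0 := cabs_ge0 z.
have r0 : 0 < 4 * cabs z + 1 by rewrite ltr_wpDl // mulr_ge0.
have zr : 4 * cabs z <= 4 * cabs z + 1 by rewrite lerDl.
have [B cB] := ce _ r0.
have := psum_continuous (ps_quot_bound cB r0 zr) r0 zr => /cvg_at_cabsP H.
apply: (cvgP (psum (ps_quot c z) z)); apply/cvg_cabsP => e /H [d1 d0 Hd].
(* The bound 1 on [h] keeps [z + h] inside the disc of radius [4 * cabs z + 1]. *)
apply: dnear_cabs; exists (Num.min d1 1); first by rewrite lt_min d0 ltr01.
move=> h; rewrite subr0 lt_min => hn0 /andP[hd h1].
rewrite /= (_ : h *: 1 + z = z + h); last by rewrite addrC; congr (_ + _); exact: mulr1.
rewrite (psum_div cB r0 zr (u := z + h)); last first.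
  by apply: le_lt_trans (cabsD _ _) _; move: h1; lra.
rewrite [z + h - z]addrAC subrr add0r [psum c z + _]addrC addrK.
rewrite [_ *: _]mulrA mulVf // mul1r; apply: Hd.
by rewrite addrAC subrr add0r.
Qed.

(* Each division by [u - z0] divides the bound [B] by a factor 3 relative to
   [c 0], so the order of vanishing at [z0] is at most [m]. *)
Lemma psum_isolated_zeros_bound m c r B z0 :
  ps_bound c r B -> 0 < r -> 4 * cabs z0 <= r -> B < 3 ^+ m * cabs (c 0%N) ->
  \forall u \near z0^', psum c u != 0.
Proof.
elim: m c B => [|m IH] c B cB r0 z0r Bm.
  have := cB 0%N; rewrite expr0 mulr1 => H.
  by move: Bm; rewrite expr0 mul1r ltNge H.
have [fz|fz] := eq0_or_neq0 (psum c z0); last first.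
  have := psum_continuous cB r0 z0r => /cvg_at_cabsP/(_ (cabs (psum c z0))).
  rewrite cabs_gt0 => /(_ fz)[d d0 H]; apply: dnear_cabs; exists d.
    exact: d0.
  move=> u _ /H fu; apply/negP => /eqP u0; move: fu.
  by rewrite u0 subr0 ltxx.
have c0 := ps_quot_coef cB r0 z0r 0; rewrite -/(psum c z0) fz in c0.
have /IH : ps_bound (ps_quot c z0) r (4 / 3 * B / r) by exact: ps_quot_bound.
move=> /(_ r0 z0r) []; last first.
  move=> d /= d0 Hd.
  have : \forall u \near z0^', cabs (u - z0) < r - cabs z0.
    apply: dnear_cabs; exists (r - cabs z0) => //.
    by have := cabs_ge0 z0; move: z0r r0; lra.
  have : \forall u \near z0^', psum (ps_quot c z0) u != 0 by exists d.
  have : \forall u \near z0^', u != z0 by apply: dnear_cabs; exists 1.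
  apply: filterS3 => u uz qu ur.
  have ur' : cabs u < r.
    by rewrite -[u](subrK z0); apply: le_lt_trans (cabsD _ _) _; move: ur; lra.
  by rewrite (psum_div cB r0 z0r ur') fz add0r mulf_neq0 // subr_eq0.
(* At a zero [z0] the constant coefficients satisfy [c 0 = - z0 * b 0] with [cabs z0 <= r / 4].
   Division thus multiplies the constant coefficient by at least [4 / r] in modulus and the bound by
   [4 / 3 / r], which accounts for the factor 3. *)
have E : cabs (c 0%N) = cabs z0 * cabs (ps_quot c z0 0).
  by rewrite -cabsM -cabsN; congr cabs; apply/eqP; rewrite eq_sym -addr_eq0 addrC -c0.
rewrite ltr_pdivrMr // mulrC.
have := Bm; rewrite exprS E => Bm'.
have H : 4 * (cabs z0 * cabs (ps_quot c z0 0)) <= r * cabs (ps_quot c z0 0).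
  by rewrite mulrA ler_wpM2r // cabs_ge0.
have H' : 3 ^+ m * (4 * (cabs z0 * cabs (ps_quot c z0 0))) <= 3 ^+ m * (r * cabs (ps_quot c z0 0)).
  by rewrite ler_wpM2l // exprn_ge0.
by move: H' Bm'; lra.
Qed.

Lemma psum_isolated_zeros c : ps_entire c -> c 0%N != 0 ->
  forall z, \forall u \near z^', psum c u != 0.
Proof.
move=> ce c0 z; have r0 : 0 < 4 * cabs z + 1 by rewrite ltr_wpDl // mulr_ge0 // cabs_ge0.
have [B cB] := ce _ r0.
have c0' : 0 < cabs (c 0%N) by rewrite cabs_gt0.
have [m Hm] : exists m, B < 3 ^+ m * cabs (c 0%N).
  exists (Num.truncn (B / cabs (c 0%N))).+1.
  rewrite -ltr_pdivrMr //; apply: lt_le_trans (truncnS_gt _) _.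
  by rewrite -natrX ler_nat ltnW // ltn_expl.
by apply: (psum_isolated_zeros_bound cB r0 _ Hm); rewrite lerDl.
Qed.

End PowerSeries.

(** * Banded operators on l2 *)

Section FiniteSums.

(** A duplicate-free list in [P] of maximal length must exhaust [P]. This turns the valency bound,
    stated on lists, into finite sets of edges. *)
Lemma bounded_fset (I : choiceType) (P : I -> Prop) (M : nat) :
  (forall s : seq I, uniq s -> (forall i, i \in s -> P i) -> (size s <= M)%N) ->
  exists2 A : {fset I}, (forall i, (i \in A) <-> P i) & (#|` A| <= M)%N.
Proof.
move=> PM.
pose Q n := `[< exists s : seq I, [/\ uniq s, forall i, i \in s -> P i & size s = n] >].
have Q0 : exists n, Q n by exists 0%N; apply/asboolP; exists [::].
have QM n : Q n -> (n <= M)%N by move=> /asboolP[s [us sP <-]]; exact: PM.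
case: (ex_maxnP Q0 QM) => n /asboolP[s [us sP sn]] nmax.
exists [fset x in s]%fset; last first.
  by rewrite card_fseq undup_id // sn; apply: QM; apply/asboolP; exists s.
move=> i; rewrite !inE /=; split=> [/sP//|Pi]; apply: contraT => si.
have : Q n.+1.
  apply/asboolP; exists (i :: s); split => //=; [by rewrite si|move=> j|by rewrite sn].
  by rewrite inE => /orP[/eqP ->|/sP].
by move=> /nmax; rewrite ltnn.
Qed.

Lemma big_fset_cond (I : choiceType) (S : nmodType) (A B : {fset I}) (h : I -> S) :
  (A `<=` B)%fset -> \sum_(i <- A) h i = \sum_(i <- B | i \in A) h i.
Proof.
move=> AB; rewrite [RHS]big_mkcond /= -(big_fset_incl _ AB).
  by apply: eq_big_seq => i ->.
by move=> i _ /negbTE ->.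
Qed.

(** [row] and [col] describe one locally finite incidence relation from its two sides; [B] has to
    contain every column met by the rows in [A]. *)
Lemma exchange_fset (I J : choiceType) (S : nmodType) (row : I -> {fset J})
    (col : J -> {fset I}) (A : {fset I}) (B : {fset J}) (g : I -> J -> S) :
  (forall i j, (j \in row i) = (i \in col j)) ->
  (forall i, i \in A -> (row i `<=` B)%fset) ->
  \sum_(i <- A) \sum_(j <- row i) g i j =
  \sum_(j <- B) \sum_(i <- A | i \in col j) g i j.
Proof.
move=> rc AB; rewrite [LHS]big_seq.
under eq_bigr => i iA do rewrite (big_fset_cond _ (AB i iA)).
rewrite -big_seq (exchange_big_dep xpredT) //=.
by apply: eq_bigr => j _; apply: eq_bigl => i; rewrite rc.
Qed.

Lemma sum_const_fset_le (R : realType) (I : choiceType) (A : {fset I}) (c : R) M :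
  (#|` A| <= M)%N -> 0 <= c -> \sum_(i <- A) c <= M%:R * c.
Proof.
move=> AM c0; rewrite big_const_seq count_predT iter_addr_0 -(mulr_natl c).
by apply: ler_wpM2r => //; rewrite ler_nat.
Qed.

Lemma sum_cond_fset_le (R : realType) (I : choiceType) (A B : {fset I}) (h : I -> R) :
  (forall i, 0 <= h i) -> \sum_(i <- A | i \in B) h i <= \sum_(i <- B) h i.
Proof.
move=> h0; rewrite big_fset_condE.
apply: (sum_fset_mono (R := R)) => //; apply/fsubsetP => i; by rewrite !inE /= => /andP[].
Qed.

(** A crude form of the Cauchy-Schwarz inequality: every term is at most the square root of the sum
    of squares. This gives [M ^ 2] where [M] would be sharp, enough for boundedness. *)
Lemma sqr_sum_le (R : realType) (I : choiceType) (A : {fset I}) (h : I -> R) (M : nat) :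
  (#|` A| <= M)%N -> (forall i, 0 <= h i) ->
  (\sum_(i <- A) h i) ^+ 2 <= M%:R ^+ 2 * \sum_(i <- A) h i ^+ 2.
Proof.
move=> AM h0; set Q := \sum_(i <- A) h i ^+ 2.
have Q0 : 0 <= Q by apply: sumr_ge0 => i _; exact: sqr_ge0.
have hQ i : i \in A -> h i <= Num.sqrt Q.
  move=> iA; rewrite -(ger0_norm (h0 i)) -sqrtr_sqr; apply: ler_wsqrtr.
  rewrite /Q (big_fsetD1 i) //= lerDl; apply: sumr_ge0 => j _; exact: sqr_ge0.
have : \sum_(i <- A) h i <= M%:R * Num.sqrt Q.
  apply: (@le_trans _ _ (\sum_(i <- A) Num.sqrt Q)).
    by rewrite big_seq [leRHS]big_seq; apply: ler_sum.
  by apply: sum_const_fset_le => //; exact: sqrtr_ge0.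
move=> H; rewrite -[X in _ * X](sqr_sqrtr Q0) -exprMn.
apply: lerXn2r => //; rewrite nnegrE; first exact: sumr_ge0.
by rewrite mulr_ge0 ?sqrtr_ge0.
Qed.

End FiniteSums.

Section SumExchange.
Variables (R : realType) (I J : choiceType).
Local Notation C := (cplx R).

(** Choose finitely many rows [A] carrying almost all of the absolute mass. A finite set of columns
    that contains every [row i] with [i] in [A] sees these row sums in full; the other rows
    contribute at most the small remaining mass. *)
Lemma is_sum_exchange (row : I -> {fset J}) (col : J -> {fset I}) (g : I -> J -> C) l :
  (forall i j, (j \in row i) = (i \in col j)) ->
  (exists b : R, forall A : {fset I}, \sum_(i <- A) \sum_(j <- row i) cabs (g i j) <= b) ->
  is_sum (fun i => \sum_(j <- row i) g i j) l ->
  is_sum (fun j => \sum_(i <- col j) g i j) l.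
Proof.
move=> rc [b gb] /is_sumP H; apply/is_sumP => e e0.
have e20 : 0 < e / 2 by rewrite divr_gt0.
pose h i := cplx_of (\sum_(j <- row i) cabs (g i j)).
have hE i : cabs (h i) = \sum_(j <- row i) cabs (g i j).
  by rewrite cabs_of ger0_norm // sumr_ge0 // => j _; exact: cabs_ge0.
have [|A0 HA0] := abs_summable_tail (f := h) _ e20.
  by exists b => A; under eq_bigr do rewrite hE.
have [A1 HA1] := H _ e20.
pose A := (A0 `|` A1)%fset.
exists (\bigcup_(i <- A) row i)%fset => B BA.
pose A' := (A `|` \bigcup_(j <- B) col j)%fset.
have AA' : (A `<=` A')%fset by exact: fsubsetUl.
have -> : \sum_(j <- B) \sum_(i <- col j) g i j =
    \sum_(i <- A) \sum_(j <- row i) g i j +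
    \sum_(i <- (A' `\` A)%fset) \sum_(j <- B | j \in row i) g i j.
  rewrite (exchange_fset (row := col) (col := row) (B := A')); last 2 first.
  - by move=> j i; rewrite rc.
  - move=> j jB; apply: fsubset_trans (fsubsetUr _ _).
    exact: bigfcup_sup.
  rewrite (big_fsetIDsub _ _ AA') /=; congr (_ + _).
  rewrite big_seq [RHS]big_seq; apply: eq_bigr => i iA.
  rewrite (big_fset_cond _ (B := B)) //; apply: fsubset_trans BA.
  exact: bigfcup_sup.
rewrite opprD addrA [e]splitr; apply: le_lt_trans (cabsD _ _) _.
apply: ltrD; first by apply: HA1; exact: fsubsetUr.
rewrite cabsN; apply: le_lt_trans (cabs_sum _ _ _) _.
apply: le_lt_trans (HA0 (A' `\` A)%fset _); last first.
  by apply/fdisjointP => i iA0; rewrite !inE iA0.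
apply: ler_sum => i _; rewrite hE; apply: le_trans (cabs_sum _ _ _) _.
by apply: sum_cond_fset_le => j; exact: cabs_ge0.
Qed.

End SumExchange.

Section Hilbert.
Variables (R : realType) (I : choiceType).
Local Notation C := (cplx R).
Local Notation H := (l2 R I).
Implicit Types (x y : H) (A : {fset I}).

Lemma sqsum_le (x : I -> C) (b : R) : (forall A, \sum_(i <- A) cabs (x i) ^+ 2 <= b) ->
  (sqsum x <= b%:E)%E.
Proof.
move=> xb; apply: ge_ereal_sup => _ [F [Ffin _] <-].
by rewrite fsbig_finite //= sumEFin lee_fin; exact: xb.
Qed.

Lemma square_summableP (x : I -> C) : x \in @square_summable R I <->
  exists b : R, forall A, \sum_(i <- A) cabs (x i) ^+ 2 <= b.
Proof. by rewrite -sqsum_ltyP; split => [/asboolP|?]; last exact/asboolP. Qed.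

Lemma l2norm_ge0 x : 0 <= l2norm x. Proof. exact: sqrtr_ge0. Qed.

Lemma sum_le_l2norm x A : \sum_(i <- A) cabs (x i) ^+ 2 <= l2norm x ^+ 2.
Proof.
have xfin : (sqsum x < +oo)%E by apply/asboolP; exact: (l2_valP x).
have x0 : (0 <= sqsum x)%E.
  by apply: esum_ge0 => i _; rewrite lee_fin sqr_ge0.
rewrite /l2norm sqr_sqrtr ?fine_ge0 // -lee_fin fineK ?ge0_fin_numE //.
apply: esum_ge; exists [set` A] => //.
by rewrite fsbig_finite //= set_fsetK -sumEFin.
Qed.

Lemma l2norm_le x (b : R) : 0 <= b ->
  (forall A, \sum_(i <- A) cabs (x i) ^+ 2 <= b ^+ 2) -> l2norm x <= b.
Proof.
move=> b0 xb; have xb' := sqsum_le xb.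
have x0 : (0 <= sqsum x)%E.
  by apply: esum_ge0 => i _; rewrite lee_fin sqr_ge0.
rewrite /l2norm -(ger0_norm b0) -sqrtr_sqr ler_wsqrtr //.
by rewrite -lee_fin fineK // ge0_fin_numE // (le_lt_trans xb') // ltry.
Qed.

Lemma cabs_le_l2norm x i : cabs (x i) <= l2norm x.
Proof.
rewrite -(ler_sqr (cabs_ge0 _) (l2norm_ge0 x)).
by have := sum_le_l2norm x [fset i]%fset; rewrite big_seq_fset1.
Qed.

Lemma l2_eq x y : (forall i, x i = y i) -> x = y.
Proof. by move=> xy; apply: val_inj; apply/funext. Qed.

Lemma std_basisE i j : (std_basis i : H) j = (j == i)%:R.
Proof. by []. Qed.

Lemma inner_abs_summable x y : abs_summable (fun i => x i * (y i)^*).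
Proof.
exists (l2norm x ^+ 2 + l2norm y ^+ 2) => A.
apply: (@le_trans _ _ (\sum_(i <- A) (cabs (x i) ^+ 2 + cabs (y i) ^+ 2))).
  apply: ler_sum => i _; rewrite cabsM cabs_conj.
  set a := cabs _; set b := cabs _.
  have := sqr_ge0 (a - b); have := sqr_ge0 a; have := sqr_ge0 b; nra.
by rewrite big_split /=; apply: lerD; exact: sum_le_l2norm.
Qed.

Lemma is_sum_inner x y : is_sum (fun i => x i * (y i)^*) (inner x y).
Proof.
by have [l sl] := abs_summable_is_sum (inner_abs_summable x y); rewrite /inner (is_sum_sum sl).
Qed.

Lemma inner_fin (x y : I -> C) A :
  (forall i, i \notin A -> x i * (y i)^* = 0) -> inner x y = \sum_(i <- A) x i * (y i)^*.
Proof. by move=> H0; apply: is_sum_sum; exact: is_sum_fin. Qed.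

Lemma inner_std_basis (x : I -> C) i : inner x (std_basis i : H) = x i.
Proof.
rewrite (@inner_fin _ _ [fset i]%fset) ?big_seq_fset1 ?std_basisE ?eqxx ?conjC1 ?mulr1 //.
by move=> j; rewrite inE std_basisE => /negbTE ->; rewrite conjC0 mulr0.
Qed.

Lemma inner_self_ge0 x : 0 <= inner x x.
Proof.
have [l xl le] := nonneg_sum_tail (fun i => sqr_ge0 (cabs (x i))) (sum_le_l2norm x).
suff -> : inner x x = cplx_of l.
  by rewrite cplx_of_ge0; have := xl fset0; rewrite big_seq_fset0.
apply: is_sum_sum; under eq_fun do rewrite cabs_sqr.
apply/is_sumP => e /le [A HA]; exists A => B AB.
rewrite -cplx_of_sum -(rmorphB (real_complex R)) (cabs_of (l - _)).
rewrite ger0_norm ?subr_ge0 // ltrBlDr -ltrBlDl.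
by apply: (lt_le_trans HA); apply: sum_fset_mono => // i; exact: sqr_ge0.
Qed.

End Hilbert.

Lemma l2_fin_sumE (R : realType) (I : choiceType) (A : {fset I}) (a : I -> cplx R) j :
  (\sum_(i <- A) a i *: std_basis i : l2 R I) j = if j \in A then a j else 0.
Proof.
rewrite (_ : l2_val _ j = \sum_(i <- A) a i * (j == i)%:R).
  case: ifPn => jA.
    rewrite (big_fsetD1 j) //= eqxx mulr1 big1_fset ?addr0 // => i.
    by rewrite !inE eq_sym => /andP[/negbTE -> _] _; rewrite mulr0.
  rewrite big1_fset // => i iA _; case: eqP => [ji|_]; last by rewrite mulr0.
  by rewrite ji iA in jA.
by apply: (big_ind2 (fun (u : l2 R I) (c : cplx R) => u j = c)) => // u c v d <- <-.
Qed.

Section BandedOperators.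
Variables (R : realType) (I : choiceType).
Local Notation C := (cplx R).
Local Notation H := (l2 R I).

(** Rows and columns of uniformly bounded size with bounded entries. The class contains the edge
    operator and the root [Q], is closed under conjugate transposition, and every kernel in it
    defines a bounded operator. *)
Definition banded (row col : I -> {fset I}) (K : I -> I -> C) : Prop :=
  [/\ forall i j, (j \in row i) = (i \in col j),
      exists M : nat, forall i, (#|` row i| <= M)%N /\ (#|` col i| <= M)%N &
      exists b : R, forall i j, cabs (K i j) <= b].

Definition kernel_app (row : I -> {fset I}) (K : I -> I -> C) (x : I -> C) (i : I) : C :=
  \sum_(j <- row i) K i j * x j.

Lemma banded_sum_le row col K : banded row col K ->
  exists M : nat, forall (x : I -> R) (b : R), (forall i, 0 <= x i) ->
    (forall A : {fset I}, \sum_(i <- A) x i <= b) ->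
    forall A : {fset I}, \sum_(i <- A) \sum_(j <- row i) x j <= M%:R * b.
Proof.
move=> [rc [M cM] _]; exists M => x b x0 xb A.
pose B := (\bigcup_(i <- A) row i)%fset.
rewrite (exchange_fset (B := B) _ rc); last by move=> i iA; exact: bigfcup_sup.
apply: (@le_trans _ _ (\sum_(j <- B) M%:R * x j)); last first.
  by rewrite -mulr_sumr; apply: ler_wpM2l.
apply: ler_sum => j _; apply: le_trans (sum_cond_fset_le _ _ _) _ => //.
by apply: sum_const_fset_le => //; case: (cM j).
Qed.

Lemma kernel_app_bounded row col K : banded row col K ->
  exists2 k : R, 0 <= k & forall (x : I -> C) (b : R),
    (forall A : {fset I}, \sum_(i <- A) cabs (x i) ^+ 2 <= b) ->
    forall A : {fset I}, \sum_(i <- A) cabs (kernel_app row K x i) ^+ 2 <= k ^+ 2 * b.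
Proof.
move=> bK; have [M' HM'] := banded_sum_le bK; have [rc [M cM] [b0 Kb]] := bK.
have b1 : 0 <= `|b0| by exact: normr_ge0.
(* [M] comes from Cauchy-Schwarz along a row and [M'] from the number of rows a column meets;
   [(M' + 1) ^ 2] dominates [M'] without a square root. *)
exists (`|b0| * M%:R * (M'%:R + 1)) => [|x b xb A].
  by rewrite !mulr_ge0 // addr_ge0.
have b0' : 0 <= b by have := xb fset0; rewrite big_seq_fset0.
apply: (@le_trans _ _ (\sum_(i <- A) (`|b0| * M%:R) ^+ 2 * \sum_(j <- row i) cabs (x j) ^+ 2)).
  apply: ler_sum => i _.
  apply: (@le_trans _ _ ((\sum_(j <- row i) `|b0| * cabs (x j)) ^+ 2)).
    apply: lerXn2r; rewrite ?nnegrE ?cabs_ge0 //.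
      by apply: sumr_ge0 => j _; rewrite mulr_ge0 // cabs_ge0.
    apply: le_trans (cabs_sum _ _ _) _; apply: ler_sum => j _; rewrite cabsM.
    apply: ler_wpM2r; first exact: cabs_ge0.
    by apply: le_trans (Kb _ _) (ler_norm _).
  have -> : \sum_(j <- row i) `|b0| * cabs (x j) = `|b0| * \sum_(j <- row i) cabs (x j).
    by rewrite mulr_sumr.
  rewrite [X in X <= _]exprMn [(_ * M%:R) ^+ 2]exprMn -[X in _ <= X]mulrA.
  apply: ler_wpM2l; first exact: sqr_ge0.
  by apply: sqr_sum_le => [|j]; [case: (cM i)|exact: cabs_ge0].
rewrite -mulr_sumr [X in _ <= X * _]exprMn -[X in _ <= X]mulrA.
apply: ler_wpM2l; first exact: sqr_ge0.
apply: le_trans (HM' _ _ _ xb A) _; first by move=> i; exact: sqr_ge0.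
apply: ler_wpM2r => //; have : 0 <= M'%:R :> R by []. nra.
Qed.

Lemma banded_operator row col K : banded row col K ->
  exists T : {linear H -> H}, bounded_op T /\ forall x, T x =1 kernel_app row K x.
Proof.
move=> /kernel_app_bounded [k k0 Hk].
have mem (x : H) : kernel_app row K x \in @square_summable R I.
  by apply/square_summableP; eexists; exact: Hk (sum_le_l2norm x).
pose f (x : H) : H := L2 (mem x).
have lin : linear f.
  move=> a x y; apply: l2_eq => i; rewrite /= /kernel_app.
  rewrite [RHS](_ : _ = a * (\sum_(j <- row i) K i j * x j) + \sum_(j <- row i) K i j * y j) //.
  rewrite mulr_sumr -big_split /=; apply: eq_bigr => j _.
  transitivity (K i j * (a * x j + y j)); first by [].
  by rewrite mulrDr mulrCA.
pose T : {linear H -> H} := HB.pack f (GRing.isLinear.Build _ _ _ _ f lin).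
exists T; split=> //; exists k => x; apply: l2norm_le.
  by rewrite mulr_ge0 // l2norm_ge0.
by move=> A; rewrite exprMn; apply: Hk; exact: sum_le_l2norm.
Qed.

(** Both inner products are the same absolutely convergent double sum, taken by rows and by columns.
    It is dominated through [a b <= a^2 + b^2]. *)
Lemma banded_adjoint row col K (S T : H -> H) : banded row col K ->
  (forall x, T x =1 kernel_app row K x) ->
  (forall y, S y =1 kernel_app col (fun j i => (K i j)^*) y) ->
  adjoint_of S T.
Proof.
move=> bK TE SE x y; have [rc [M cM] [b0 Kb]] := bK.
symmetry; apply: is_sum_sum.
under eq_fun => j do rewrite SE /kernel_app rmorph_sum mulr_sumr.
have -> : (fun j => \sum_(i <- col j) x j * ((K i j)^* * y i)^*) =
          fun j => \sum_(i <- col j) (K i j * x j * (y i)^*).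
  apply/funext => j; apply: eq_bigr => i _.
  by rewrite rmorphM /= conjCK mulrA [x j * _]mulrC.
apply: (is_sum_exchange (row := row) rc); last first.
  have := @is_sum_inner _ _ (T x) y; congr is_sum; apply/funext => i.
  by rewrite TE /kernel_app mulr_suml.
have [M1 /(_ _ _ (fun i => sqr_ge0 (cabs (x i))) (sum_le_l2norm x)) H1] := banded_sum_le bK.
exists (`|b0| * (M1%:R * l2norm x ^+ 2 + M%:R * l2norm y ^+ 2)) => A.
apply: (@le_trans _ _ (\sum_(i <- A) `|b0| *
   (\sum_(j <- row i) cabs (x j) ^+ 2 + M%:R * cabs (y i) ^+ 2))).
  apply: ler_sum => i _.
  apply: (@le_trans _ _ (\sum_(j <- row i) `|b0| * (cabs (x j) ^+ 2 + cabs (y i) ^+ 2))).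
    apply: ler_sum => j _; rewrite !cabsM cabs_conj -mulrA.
    apply: ler_pM; rewrite ?mulr_ge0 ?cabs_ge0 //.
      by apply: le_trans (Kb _ _) (ler_norm _).
    set a := cabs _; set b := cabs _.
    have := sqr_ge0 (a - b); have := sqr_ge0 a; have := sqr_ge0 b; nra.
  rewrite -mulr_sumr; apply: ler_wpM2l => //; rewrite big_split /=; apply: lerD => //.
  by apply: sum_const_fset_le; [case: (cM i)|exact: sqr_ge0].
rewrite -mulr_sumr; apply: ler_wpM2l => //; rewrite big_split /=; apply: lerD => //.
by rewrite -mulr_sumr; apply: ler_wpM2l => //; exact: sum_le_l2norm.
Qed.

(** Density of finite combinations: cutting [x] off to a finite set that carries all but [d ^ 2] of
    its square norm moves it by at most [d]. Hence a bounded operator is determined by its values on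
    the basis. *)
Lemma bounded_eq0 (L : {linear H -> H}) : bounded_op L ->
  (forall i, L (std_basis i) = 0) -> forall x, L x = 0.
Proof.
move=> [k Lk] L0 x.
have Lfin (A : {fset I}) (a : I -> C) : L (\sum_(i <- A) a i *: std_basis i) = 0.
  by rewrite linear_sum big1 // => i _; rewrite linearZ /= L0 scaler0.
suff Lx0 : l2norm (L x) = 0.
  apply: l2_eq => i; apply/eqP; rewrite -cabs_eq0 eq_le cabs_ge0 andbT.
  by rewrite -Lx0; exact: cabs_le_l2norm.
apply/eqP; rewrite eq_le l2norm_ge0 andbT; apply/ler_addgt0Pr => e e0; rewrite add0r.
have k1 : 0 < `|k| + 1 by rewrite ltr_wpDl.
pose d := e / (`|k| + 1); have d0 : 0 < d by rewrite divr_gt0.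
have d20 : 0 < d ^+ 2 by rewrite exprn_gt0.
have [l xl le] := nonneg_sum_tail (fun i => sqr_ge0 (cabs (x i))) (sum_le_l2norm x).
have [A HA] := le _ d20.
pose y := \sum_(i <- A) x i *: (std_basis i : H).
have -> : L x = L (x - y) by rewrite linearB /= Lfin subr0.
apply: le_trans (Lk _) _.
have dx : l2norm (x - y) <= d.
  apply: l2norm_le; first exact: ltW.
  move=> B; apply: (@le_trans _ _ (\sum_(i <- (B `\` A)%fset) cabs (x i) ^+ 2)).
    have -> : \sum_(i <- B) cabs ((x - y) i) ^+ 2 =
        \sum_(i <- B | i \in (B `\` A)%fset) cabs (x i) ^+ 2.
      rewrite [RHS]big_mkcond /=; apply: eq_big_seq => i iB.
      transitivity (cabs (x i - y i) ^+ 2); first by [].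
      rewrite /y l2_fin_sumE !inE iB andbT.
      by case: (i \in A); rewrite /= ?subrr ?subr0 // cabs0 expr0n.
    by apply: sum_cond_fset_le => i; exact: sqr_ge0.
  have dis : [disjoint A & B `\` A]%fset.
    by apply/fdisjointP => i iA; rewrite !inE iA.
  have := xl (A `|` (B `\` A))%fset; rewrite sum_fsetU_disjoint //.
  by move: HA; lra.
apply: (@le_trans _ _ ((`|k| + 1) * d)); last first.
  by rewrite /d mulrCA divff ?mulr1 // gt_eqF.
apply: (@le_trans _ _ ((`|k| + 1) * l2norm (x - y))).
  apply: ler_wpM2r; first exact: l2norm_ge0.
  by apply: le_trans (ler_norm k) _; rewrite lerDl.
by apply: ler_wpM2l => //; exact: ltW.
Qed.

End BandedOperators.

(** * Fourth roots of finite Gram matrices *)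

Section GramRoot.
Import mathcomp.algebra.spectral.
Local Open Scope sesquilinear_scope.
Variable C : numClosedFieldType.

(** The Gram matrix is diagonal in a unitary basis, with eigenvalues the square norms of the columns
    of [A U^*]. Their nonnegative fourth roots are real, so [Q] is hermitian. *)
Lemma gram_fourth_root m n (A : 'M[C]_(m, n)) :
  exists2 Q : 'M[C]_n, Q ^t* = Q & Q *m (Q *m (Q *m Q)) = A ^t* *m A.
Proof.
pose G := A ^t* *m A.
have GT : G ^t* = G by rewrite /G trmx_mul map_mxM trmxCK.
have /orthomx_spectralP : G \is normalmx by apply/normalmxP; rewrite GT.
set U := spectralmx G; set d := spectral_diag G => GE.
have UU : U \is unitarymx := spectral_unitarymx G.
have UU1 : U *m U ^t* = 1%:M by apply/unitarymxP.
rewrite invmx_unitary // in GE.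
have d0 i : 0 <= d 0 i.
  have E : diag_mx d = (A *m U ^t*) ^t* *m (A *m U ^t*).
    rewrite trmx_mul map_mxM trmxCK -mulmxA [A ^t* *m _]mulmxA -/G GE.
    by rewrite !mulmxA UU1 mul1mx -mulmxA UU1 mulmx1.
  have -> : d 0 i = diag_mx d i i by rewrite mxE eqxx mulr1n.
  rewrite E mxE; apply: sumr_ge0 => k _.
  by rewrite [X in X * _]mxE [X in X^*]mxE mulrC mul_conjC_ge0.
pose e := map_mx (fun x => sqrtC (sqrtC x)) d.
pose Q := U ^t* *m diag_mx e *m U.
exists Q.
  rewrite /Q !trmx_mul !map_mxM trmxCK mulmxA tr_diag_mx map_diag_mx.
  congr (_ *m diag_mx _ *m _); apply/rowP => i; rewrite !mxE.
  by apply: CrealP; apply: ger0_real; rewrite !sqrtC_ge0.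
have QM a b : U ^t* *m diag_mx a *m U *m (U ^t* *m diag_mx b *m U) =
    U ^t* *m (diag_mx a *m diag_mx b) *m U.
  by rewrite !mulmxA -[_ *m U *m U^t*]mulmxA UU1 mulmx1.
rewrite /Q QM mulmx_diag QM mulmx_diag QM mulmx_diag -/G [RHS]GE.
congr (_ *m diag_mx _ *m _); apply/rowP => i; rewrite !mxE.
set t := sqrtC (sqrtC _).
by rewrite !mulrA -(expr2 t) sqrtCK -mulrA -(expr2 t) sqrtCK -expr2 sqrtCK.
Qed.

(** For hermitian [Q] the entry [(Q *m Q) j j] is the square norm of column [j]. *)
Lemma hermitian_entry_le n (Q : 'M[C]_n) i j : Q ^t* = Q ->
  `|Q i j| ^+ 2 <= (Q *m Q) j j.
Proof.
move=> QT; have QE a b : Q a b = (Q b a)^* by rewrite -[in LHS]QT !mxE.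
rewrite mxE (bigD1 i) //= [Q j i]QE mulrC -normCK lerDl; apply: sumr_ge0 => k _.
by rewrite [Q j k]QE mulrC mul_conjC_ge0.
Qed.

End GramRoot.

Section FiniteGramRoot.
Variables (R : realType) (I J : choiceType).
Local Notation C := (cplx R).
Local Notation "A ^h" := (map_mx Num.conj A^T) (at level 8).

Lemma hermitian_entry_cabs n (Q : 'M[C]_n) i j : Q ^h = Q ->
  cabs (Q i j) ^+ 2 <= cabs ((Q *m Q) j j).
Proof.
move=> /(@hermitian_entry_le _ _ _ i j) H; move: (H).
rewrite -[X in _ <= X]ger0_norm; last by apply: le_trans H; rewrite exprn_ge0.
by rewrite !normC_cabs -(rmorphXn (real_complex R)) /= (lecR (_ ^+ 2)).
Qed.

(** The matrix root as a kernel on [I], extended by zero outside [F]. The last clause is the trace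
    estimate: a diagonal entry of [Q Q], which will be a block of [|T|], is at most the norm of the
    corresponding column of [a]. *)
Lemma fset_gram_root (F : {fset I}) (D : {fset J}) (a : J -> I -> C) :
  let G i j := \sum_(d <- D) (a d i)^* * a d j in
  exists q : I -> I -> C,
    let app (x : I -> C) i := \sum_(j <- F) q i j * x j in
    [/\ forall i j, q j i = (q i j)^*,
        forall i j, cabs (q i j) ^+ 4 <= cabs (G j j),
        forall x i, i \in F -> app (app (app (app x))) i = \sum_(j <- F) G i j * x j &
        forall i, cabs (\sum_(k <- F) q i k * q k i) ^+ 2 <= cabs (G i i)].
Proof.
move=> G.
pose n := #|{: F}|.
pose A : 'M[C]_(#|{: D}|, n) := \matrix_(d, i) a (val (enum_val d)) (val (enum_val i)).
have [Q QT Q4] := gram_fourth_root A.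
pose q (i j : I) : C := match insub i : option F, insub j : option F with
  | Some i', Some j' => Q (enum_rank i') (enum_rank j') | _, _ => 0 end.
exists q => app.
have sumF (h : I -> C) : \sum_(k <- F) h k = \sum_(k < n) h (val (enum_val k)).
  rewrite big_seq_fsetE /= (reindex (@enum_val _ {: F})) //=.
  exact: (onW_bij _ (@enum_val_bij _)).
have qE (i j : F) : q (val i) (val j) = Q (enum_rank i) (enum_rank j).
  by rewrite /q !valK.
have qE' (i j : 'I_n) : q (val (enum_val i)) (val (enum_val j)) = Q i j.
  by rewrite qE !enum_valK.
have GE (i j : 'I_n) : G (val (enum_val i)) (val (enum_val j)) = (A ^h *m A) i j.
  rewrite /G mxE big_seq_fsetE /= (reindex (@enum_val _ {: D})) /=; last first.
    exact: (onW_bij _ (@enum_val_bij _)).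
  by apply: eq_bigr => d _; rewrite !mxE.
have QE i j : Q j i = (Q i j)^* by rewrite -[in LHS]QT !mxE.
have q2 (i j : 'I_n) : \sum_(k <- F) q (val (enum_val i)) k * q k (val (enum_val j)) = (Q *m Q) i j.
  by rewrite sumF mxE; apply: eq_bigr => k _; rewrite !qE'.
have Q2T : (Q *m Q) ^h = Q *m Q by rewrite trmx_mul map_mxM QT.
have q0 i j : i \notin F -> q i j = 0 by move=> iF; rewrite /q insubF //; exact: negbTE.
have q0' i j : j \notin F -> q i j = 0.
  by move=> iF; rewrite /q; case: insubP => // u _ _; rewrite insubF //; exact: negbTE.
have inF i : i \in F -> exists k : 'I_n, i = val (enum_val k).
  by move=> iF; exists (enum_rank [` iF]%fset); rewrite enum_rankK.
have bound2 (i j : 'I_n) : cabs ((Q *m Q) i j) ^+ 2 <= cabs ((A^h *m A) j j).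
  by have := hermitian_entry_cabs i j Q2T; rewrite -Q4 !mulmxA.
split.
- move=> i j; have [iF|iF] := boolP (i \in F); last by rewrite (q0 i) // q0' // conjC0.
  have [jF|jF] := boolP (j \in F); last by rewrite (q0 j) // q0' // conjC0.
  have [[i' ->] [j' ->]] := (inF _ iF, inF _ jF); by rewrite !qE' QE.
- move=> i j; have [iF|iF] := boolP (i \in F); last by rewrite q0 // cabs0 expr0n cabs_ge0.
  have [jF|jF] := boolP (j \in F); last by rewrite q0' // cabs0 expr0n cabs_ge0.
  have [[i' ->] [j' ->]] := (inF _ iF, inF _ jF); rewrite qE' GE.
  apply: le_trans (bound2 j' j'); rewrite -[4%N]/(2 * 2)%N exprM.
  apply: lerXn2r; rewrite ?nnegrE ?sqr_ge0 ?cabs_ge0 //.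
  exact: hermitian_entry_cabs.
- move=> x i /inF [i' ->].
  pose X : 'cV[C]_n := \col_k x (val (enum_val k)).
  have appE (y : I -> C) (Y : 'cV[C]_n) : (forall k : 'I_n, y (val (enum_val k)) = Y k 0) ->
      forall k : 'I_n, app y (val (enum_val k)) = (Q *m Y) k 0.
    by move=> yY k; rewrite /app sumF mxE; apply: eq_bigr => l _; rewrite qE' yY.
  have xX (k : 'I_n) : x (val (enum_val k)) = X k 0 by rewrite mxE.
  rewrite (appE _ _ (appE _ _ (appE _ _ (appE _ _ xX)))) !mulmxA -[Q *m Q *m Q *m Q]mulmxA.
  rewrite -[Q *m Q *m (Q *m Q)]mulmxA Q4 mxE sumF.
  by apply: eq_bigr => k _; rewrite GE xX.
- move=> i; have [iF|iF] := boolP (i \in F).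
    by have [i' ->] := inF _ iF; rewrite q2 GE; exact: bound2.
  rewrite big1 ?cabs0 ?expr0n ?cabs_ge0 // => k _.
  by rewrite q0 // mul0r.
Qed.

End FiniteGramRoot.

(** * The edge operator is of trace class *)

Lemma l2_subE (R : realType) (I : choiceType) (x y : l2 R I) i : (x - y) i = x i - y i.
Proof. by []. Qed.

Lemma sum_sqr_le (R : realType) (I : Type) (s : seq I) (h : I -> R) :
  (forall i, 0 <= h i) -> \sum_(i <- s) h i ^+ 2 <= (\sum_(i <- s) h i) ^+ 2.
Proof.
move=> h0; elim: s => [|i s IH]; first by rewrite !big_nil expr0n.
rewrite !big_cons sqrrD -addrA lerD2l; apply: le_trans IH _.
by rewrite lerDr mulrn_wge0 // mulr_ge0 // sumr_ge0.
Qed.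

Lemma banded_sym (R : realType) (I : choiceType) row col (K : I -> I -> cplx R) :
  banded row col K -> banded col row (fun j i => (K i j)^*).
Proof.
move=> [rc [M cM] [b Kb]]; split; first by move=> i j; rewrite rc.
  by exists M => i; case: (cM i).
by exists b => i j; rewrite cabs_conj.
Qed.

Lemma bounded_op_sub (R : realType) (I : choiceType) (S T : {linear l2 R I -> l2 R I}) :
  bounded_op S -> bounded_op T -> bounded_op (S \- T).
Proof.
move=> [k Sk] [l Tl]; exists (2 * (`|k| + `|l|)) => x.
have x0 := l2norm_ge0 x; have k0 := normr_ge0 k; have l0 := normr_ge0 l.
have Sk' : l2norm (S x) <= `|k| * l2norm x.
  by apply: le_trans (Sk x) _; apply: ler_wpM2r => //; exact: ler_norm.
have Tl' : l2norm (T x) <= `|l| * l2norm x.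
  by apply: le_trans (Tl x) _; apply: ler_wpM2r => //; exact: ler_norm.
apply: l2norm_le => [|A]; first by rewrite !mulr_ge0 // addr_ge0.
apply: (@le_trans _ _ (\sum_(i <- A) 2 * (cabs (S x i) ^+ 2 + cabs (T x i) ^+ 2))).
  apply: ler_sum => i _.
  have : cabs ((S \- T) x i) <= cabs (S x i) + cabs (T x i).
    by apply: le_trans (cabsD (S x i) (- T x i)) _; rewrite cabsN.
  have := cabs_ge0 ((S \- T) x i); have := cabs_ge0 (S x i); have := cabs_ge0 (T x i).
  set a := cabs _; set b := cabs _; set c := cabs _ => a0 b0 c0 H.
  have : c ^+ 2 <= (b + a) ^+ 2 by apply: lerXn2r; rewrite ?nnegrE ?addr_ge0.
  have := sqr_ge0 (a - b); nra.
rewrite -mulr_sumr big_split /=.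
have := sum_le_l2norm (S x) A; have := sum_le_l2norm (T x) A.
have : l2norm (S x) ^+ 2 <= (`|k| * l2norm x) ^+ 2.
  by apply: lerXn2r; rewrite ?nnegrE ?mulr_ge0 ?l2norm_ge0.
have : l2norm (T x) ^+ 2 <= (`|l| * l2norm x) ^+ 2.
  by apply: lerXn2r; rewrite ?nnegrE ?mulr_ge0 ?l2norm_ge0.
rewrite !exprMn; set kk := `|k|; set ll := `|l|; set X := l2norm x ^+ 2.
have X0 : 0 <= X by exact: sqr_ge0.
have kl0 : 0 <= kk * ll * X by rewrite !mulr_ge0.
have k20 : 0 <= kk ^+ 2 * X by rewrite mulr_ge0 // sqr_ge0.
have l20 : 0 <= ll ^+ 2 * X by rewrite mulr_ge0 // sqr_ge0.
move=> H1 H2 H3 H4.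
have -> : 2 ^+ 2 * (kk + ll) ^+ 2 * X = 4 * (kk ^+ 2 * X) + 8 * (kk * ll * X) + 4 * (ll ^+ 2 * X) by ring.
lra.
Qed.

Lemma bounded_op_comp (R : realType) (I : choiceType) (S T : l2 R I -> l2 R I) :
  bounded_op S -> bounded_op T -> bounded_op (S \o T).
Proof.
move=> [k Sk] [l Tl]; exists (`|k| * l) => x /=.
apply: le_trans (Sk _) _; rewrite -mulrA.
apply: (@le_trans _ _ (`|k| * l2norm (T x))).
  by apply: ler_wpM2r; [exact: l2norm_ge0|exact: ler_norm].
by apply: ler_wpM2l.
Qed.

Lemma esum_lty_bound (R : realType) (I : choiceType) (f : I -> R) :
  (forall i, 0 <= f i) -> (\esum_(i in [set: I]) (f i)%:E < +oo)%E ->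
  exists B : R, forall A : {fset I}, \sum_(i <- A) f i <= B.
Proof.
move=> f0 ffin; exists (fine (\esum_(i in [set: I]) (f i)%:E)%E) => A.
rewrite -lee_fin fineK; last first.
  by rewrite ge0_fin_numE //; apply: esum_ge0 => i _; rewrite lee_fin.
apply: esum_ge; exists [set` A] => //.
by rewrite fsbig_finite //= set_fsetK -sumEFin.
Qed.

(** * Finite sets of neighbouring edges *)

Section EdgeSets.
Variables (V : choiceType) (X : sgraph V).

Lemma OE_eq (e f : OE X) : org e = org f -> tgt e = tgt f -> e = f.
Proof.
move=> o t; apply: val_inj.
by rewrite [val e]surjective_pairing [val f]surjective_pairing; congr pair.
Qed.

Lemma edge_fsets : bounded_valency X ->
  exists (M : nat) (out inn : V -> {fset OE X}), forall v,
    [/\ forall e, (e \in out v) = (org e == v), forall e, (e \in inn v) = (tgt e == v),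
        (#|` out v| <= M)%N & (#|` inn v| <= M)%N].
Proof.
move=> [M _ HM]; exists M.
have Hout v : exists2 A : {fset OE X}, (forall e, (e \in A) <-> org e = v) & (#|` A| <= M)%N.
  apply: bounded_fset => s us sv; rewrite -(size_map (@tgt _ X)).
  apply: (HM v); last first.
    by apply/allP => _ /mapP[e /sv <- ->]; exact: (valP e).
  by rewrite map_inj_in_uniq // => e f /sv ev /sv fv; apply: OE_eq; rewrite ev.
have Hinn v : exists2 A : {fset OE X}, (forall e, (e \in A) <-> tgt e = v) & (#|` A| <= M)%N.
  apply: bounded_fset => s us sv; rewrite -(size_map (@org _ X)).
  apply: (HM v); last first.
    by apply/allP => _ /mapP[e /sv <- ->]; rewrite adj_sym; exact: (valP e).
  rewrite map_inj_in_uniq // => e f /sv ev /sv fv o; apply: OE_eq => //.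
  by rewrite ev.
have /choice[out outP] : forall v, exists A : {fset OE X},
    (forall e, (e \in A) <-> org e = v) /\ (#|` A| <= M)%N.
  by move=> v; have [A ? ?] := Hout v; exists A.
have /choice[inn innP] : forall v, exists A : {fset OE X},
    (forall e, (e \in A) <-> tgt e = v) /\ (#|` A| <= M)%N.
  by move=> v; have [A ? ?] := Hinn v; exists A.
exists out, inn => v; have [[oa ob] [ia ib]] := (outP v, innP v).
split => // e; apply/idP/eqP.
- by move=> /oa.
- by move=> /oa.
- by move=> /ia.
- by move=> /ia.
Qed.

Lemma succ_fsets (E : set (OE X)) : bounded_valency X ->
  exists (M : nat) (pre suc : OE X -> {fset OE X}), forall e,
    [/\ forall e', (e' \in suc e) = `[< successor E e e' >],
        forall e', (e' \in pre e) = `[< successor E e' e >],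
        (#|` pre e| <= M)%N & (#|` suc e| <= M)%N].
Proof.
move=> /edge_fsets[M [out [inn H]]].
exists M, (fun e => [fset e' in inn (org e) | `[< successor E e' e >]]%fset),
  (fun e => [fset e' in out (tgt e) | `[< successor E e e' >]]%fset) => e.
have [H1 H2 H3 H4] := H (org e); have [G1 G2 G3 G4] := H (tgt e); split.
- move=> e'; rewrite !inE /= G1; apply: andb_idl => /asboolP[-> _]; exact: eqxx.
- move=> e'; rewrite !inE /= H2; apply: andb_idl => /asboolP[-> _]; exact: eqxx.
- apply: leq_trans H4; apply: fsubset_leq_card; apply/fsubsetP => e'.
  by rewrite !inE => /andP[].
- apply: leq_trans G3; apply: fsubset_leq_card; apply/fsubsetP => e'.
  by rewrite !inE => /andP[].
Qed.

End EdgeSets.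

Section EdgeOperator.
Variables (R : realType) (V : choiceType) (X : sgraph V) (w : OE X -> R) (E : set (OE X)).
Local Notation C := (cplx R).
Local Notation H := (l2 R (OE X)).
Hypothesis Xb : bounded_valency X.
Hypothesis w0 : forall e, 0 < w e.
Hypothesis wsum : exists W : R, forall A : {fset OE X}, \sum_(e <- A) w e <= W.

(** Row [e'], column [e]: the coefficient of [e'] in the image of the basis vector [e]. *)
Definition edge_kernel (e' e : OE X) : C :=
  if `[< successor E e e' >] then cplx_of (w e') else 0.

Lemma cabs_edge_kernel_le e' e : cabs (edge_kernel e' e) <= w e'.
Proof.
rewrite /edge_kernel; case: ifP => _; first by rewrite cabs_of ger0_norm // ltW.
by rewrite cabs0 ltW.
Qed.

Lemma edge_kernel_banded : exists pre suc : OE X -> {fset OE X},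
  [/\ banded pre suc edge_kernel,
      forall e e', (e' \in suc e) = `[< successor E e e' >] &
      forall e e', (e' \in pre e) = `[< successor E e' e >]].
Proof.
have [M [pre [suc H]]] := succ_fsets E Xb; exists pre, suc; split; last 2 first.
- by move=> e; have [] := H e.
- by move=> e; have [] := H e.
split.
- by move=> i j; have [_ -> _ _] := H i; have [-> _ _ _] := H j.
- by exists M => i; have [] := H i.
have [W HW] := wsum; exists W => i j; apply: le_trans (cabs_edge_kernel_le _ _) _.
by have := HW [fset i]%fset; rewrite big_seq_fset1.
Qed.

Lemma edge_operator_basis (T : {linear H -> H}) : is_edge_operator w E T ->
  forall e e', T (std_basis e) e' = edge_kernel e' e.
Proof.
move=> [_ TE] e e'; have [pre [suc [_ sucP _]]] := edge_kernel_banded.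
rewrite TE (_ : [set e'0 | _] = [set` suc e]); last first.
  by apply/seteqP; split => f /=; rewrite sucP => /asboolP.
by rewrite fsbig_finite //= set_fsetK l2_fin_sumE sucP.
Qed.

Lemma kernel_app_basis (pre : OE X -> {fset OE X}) (K : OE X -> OE X -> C) e e' :
  kernel_app pre K (std_basis e : H) e' = if e \in pre e' then K e' e else 0.
Proof.
rewrite /kernel_app; case: ifPn => ee'.
  rewrite (big_fsetD1 e) //= eqxx mulr1 big1_fset ?addr0 // => i.
  by rewrite !inE => /andP[/negbTE -> _] _; rewrite mulr0.
rewrite big1_fset // => i iA _; rewrite std_basisE.
by case: eqP => [ie|_]; [rewrite -ie iA in ee'|rewrite mulr0].
Qed.

Lemma edge_operator_exists : exists T, is_edge_operator w E T.
Proof.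
have [pre [suc [bK sucP preP]]] := edge_kernel_banded.
have [T [Tb TE]] := banded_operator bK; exists T; split => // e.
apply: l2_eq => e'; rewrite TE kernel_app_basis preP.
rewrite (_ : [set e'0 | _] = [set` suc e]); last first.
  by apply/seteqP; split => f /=; rewrite sucP => /asboolP.
rewrite fsbig_finite //= set_fsetK l2_fin_sumE sucP /edge_kernel.
by case: ifP => // ->.
Qed.

(** An edge operator is prescribed on the basis only; boundedness makes it agree everywhere with the
    operator of the kernel, so that its adjoint can be read off the transpose. *)
Lemma edge_operatorE (T : {linear H -> H}) (pre suc : OE X -> {fset OE X}) :
  is_edge_operator w E T -> banded pre suc edge_kernel ->
  (forall e e', (e' \in pre e) = `[< successor E e' e >]) ->
  forall x, T x =1 kernel_app pre edge_kernel x.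
Proof.
move=> eT bK preP; have [T0 [T0b T0E]] := banded_operator bK.
suff TT0 x : T x = T0 x by move=> x i; rewrite TT0 T0E.
have Lb := bounded_op_sub (proj1 eT) T0b.
apply/eqP; rewrite -subr_eq0; apply/eqP; apply: (bounded_eq0 Lb _ x) => e.
transitivity (T (std_basis e) - T0 (std_basis e)); first by [].
apply: l2_eq => e'; rewrite l2_subE edge_operator_basis // T0E kernel_app_basis preP /edge_kernel.
by case: ifP; rewrite subrr.
Qed.

(* [T^* T] is block diagonal, with one finite block for each vertex [v], acting on
   the span of the edges with target [v]. *)
Lemma edge_operator_trace_class (T : {linear H -> H}) :
  is_edge_operator w E T -> trace_class T.
Proof.
move=> eT; have [pre [suc [bK sucP preP]]] := edge_kernel_banded.
have TE := edge_operatorE eT bK preP.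
have [M [out [inn io]]] := edge_fsets Xb.
have inP v e : (e \in inn v) = (tgt e == v) by have [] := io v.
have outP v e : (e \in out v) = (org e == v) by have [] := io v.
have [W HW] := wsum.
split; first by case: eT.
have /choice[q qP] := fun v => fset_gram_root (inn v) (out v) edge_kernel.
pose row (e : OE X) := inn (tgt e).
pose K i j : C := q (tgt i) i j.
have W0 : 0 <= W by have := HW fset0; rewrite big_seq_fset0.
(* The left side is the square norm of the image of the basis vector [i], bounded by the square of
   its l1 norm. *)
have Gle i : cabs (\sum_(d <- out (tgt i)) (edge_kernel d i)^* * edge_kernel d i) <=
    (\sum_(d <- suc i) w d) ^+ 2.
  apply: le_trans (cabs_sum _ _ _) _.
  apply: (@le_trans _ _ (\sum_(d <- suc i) w d ^+ 2)).
    rewrite (big_fset_cond (A := suc i) _ (B := out (tgt i))); last first.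
      by apply/fsubsetP => d; rewrite sucP outP => /asboolP[-> _].
    rewrite [leRHS]big_mkcond /=; apply: ler_sum => d _.
    rewrite cabsM cabs_conj -expr2 sucP /edge_kernel.
    case: ifP => _; last by rewrite cabs0 expr0n.
    by rewrite cabs_of ger0_norm // ltW.
  by apply: sum_sqr_le => d; exact: ltW.
have Gle2 v j : cabs (\sum_(d <- out v) (edge_kernel d j)^* * edge_kernel d j) <= W ^+ 2.
  apply: le_trans (cabs_sum _ _ _) _.
  apply: (@le_trans _ _ ((\sum_(d <- out v) w d) ^+ 2)); last first.
    by apply: lerXn2r; rewrite ?nnegrE ?sumr_ge0 // ?W0 // => d _; exact: ltW.
  apply: le_trans (sum_sqr_le _ _); last by move=> d; exact: ltW.
  apply: ler_sum => d _; rewrite cabsM cabs_conj -expr2.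
  by apply: lerXn2r; rewrite ?nnegrE ?cabs_ge0 ?cabs_edge_kernel_le // ltW.
have suc0 i : 0 <= \sum_(d <- suc i) w d by apply: sumr_ge0 => d _; exact: ltW.
have bq : banded row row K.
  split.
  - by move=> i j; rewrite !inP eq_sym.
  - by exists M => i; have [] := io (tgt i).
  (* Entries satisfy [cabs (q v i j) ^ 4 <= W ^ 2]; this is at most [(W + 1) ^ 4] also when
     [W < 1]. *)
  exists (W + 1) => i j; rewrite /K.
  have [_ qb _ _] := qP (tgt i).
  rewrite -(@ler_pXn2r _ 4) ?nnegrE ?cabs_ge0 ?addr_ge0 //.
  apply: le_trans (qb i j) _; apply: le_trans (Gle2 _ _) _.
  rewrite -[4%N]/(2 * 2)%N exprM; apply: lerXn2r; rewrite ?nnegrE ?sqr_ge0 //; nra.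
have [Q [Qb QE]] := banded_operator bq.
pose P : {linear H -> H} := Q \o Q.
have QQ : adjoint_of Q Q.
  apply: (banded_adjoint bq QE) => y i; rewrite QE /kernel_app.
  apply: eq_big_seq => j; rewrite inP => /eqP ji; rewrite /K ji.
  by have [-> _ _ _] := qP (tgt i).
have [S [Sb SE]] := banded_operator (banded_sym bK).
exists P; split.
  split; first exact: bounded_op_comp.
    by move=> x; rewrite /= QQ; exact: inner_self_ge0.
  exists S; split => //; first exact: (banded_adjoint bK TE SE).
  move=> x; apply: l2_eq => i; rewrite /=.
  have [_ _ q4 _] := qP (tgt i).
  (* All [j] in the block of [i] share the same [row], so four applications of [Q] evaluated at [i]
     never leave the block. *)
  have rowE (f : OE X -> C) j : j \in inn (tgt i) -> 
      kernel_app row K f j = \sum_(k <- inn (tgt i)) q (tgt i) j k * f k.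
    by rewrite inP => /eqP ji; rewrite /kernel_app /row /K ji.
  have ii : i \in inn (tgt i) by rewrite inP.
  have := q4 x i ii; rewrite /=.
  have step (f g : OE X -> C) j : j \in inn (tgt i) ->
     (forall k, k \in inn (tgt i) -> f k = g k) ->
     kernel_app row K f j = \sum_(k <- inn (tgt i)) q (tgt i) j k * g k.
    move=> jF fg; rewrite rowE //; apply: eq_big_seq => k kF; congr (_ * _); exact: fg.
  have -> : Q (Q (Q (Q x))) i = \sum_(j <- inn (tgt i)) q (tgt i) i j *
      \sum_(j0 <- inn (tgt i)) q (tgt i) j j0 *
      \sum_(j1 <- inn (tgt i)) q (tgt i) j0 j1 *
      \sum_(j2 <- inn (tgt i)) q (tgt i) j1 j2 * x j2.
    rewrite QE; apply: (step _ _ _) => // k kF; rewrite QE; apply: (step _ _ _) => // l lF.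
    by rewrite QE; apply: (step _ _ _) => // m mF; rewrite QE; apply: (step _ _ _).
  move=> ->; rewrite SE /kernel_app.
  transitivity (\sum_(d <- suc i) \sum_(j <- pre d) edge_kernel d j * x j * (edge_kernel d i)^*); last first.
    by apply: eq_bigr => d _; rewrite TE /kernel_app mulr_sumr; apply: eq_bigr => j _; rewrite mulrC.
  (* The ranges of [d] and [j] are enlarged to all edges leaving and entering [tgt i]; the kernel
     vanishes on the edges added. *)
  rewrite [RHS](big_fset_cond (A := suc i) _ (B := out (tgt i))); last first.
    by apply/fsubsetP => d; rewrite sucP outP => /asboolP[-> _].
  rewrite [RHS]big_mkcond /=.
  under eq_bigr do rewrite mulr_suml.
  rewrite exchange_big /=; apply: eq_big_seq => d; rewrite outP => /eqP od.
  rewrite sucP; case: ifPn => id; last first.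
    by apply: big1 => j _; rewrite [edge_kernel d i]/edge_kernel (negbTE id) conjC0 !mul0r.
  rewrite [RHS](big_fset_cond (A := pre d) _ (B := inn (tgt i))); last first.
    by apply/fsubsetP => j; rewrite preP inP -od => /asboolP[->].
  rewrite [RHS]big_mkcond /=; apply: eq_bigr => j _; rewrite preP.
  case: ifPn => jd; first by rewrite -mulrA mulrC.
  by rewrite [edge_kernel d j]/edge_kernel (negbTE jd) mulr0 mul0r.
have diag i : inner (P (std_basis i)) (std_basis i : H) =
    \sum_(k <- inn (tgt i)) q (tgt i) i k * q (tgt i) k i.
  rewrite inner_std_basis /= QE /kernel_app; apply: eq_big_seq => k kF.
  rewrite QE kernel_app_basis /K /row; move: kF; rewrite inP => /eqP ->.
  by rewrite inP eqxx.
have dle i : cabs (inner (P (std_basis i)) (std_basis i : H)) <= \sum_(d <- suc i) w d.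
  rewrite -(ler_sqr (cabs_ge0 _) (suc0 i)); apply: le_trans (Gle i).
  by rewrite diag; have [_ _ _] := qP (tgt i); exact.
apply: abs_summable_is_sum.
(* Each [w d] is counted once for every predecessor of [d], hence a bounded number of times. *)
have [M1 /(_ w W (fun d => ltW (w0 d)) HW) HM1] := banded_sum_le (banded_sym bK).
exists (M1%:R * W) => A; apply: le_trans (HM1 A); apply: ler_sum => i _; exact: dle.
Qed.

End EdgeOperator.

(** * Principal minors and the Fredholm determinant *)

Section FsetEnumeration.
Variable I : choiceType.

Lemma fset_nth_inj (F : {fset I}) : injective (@fset_nth I F).
Proof. by move=> a b /val_inj /enum_val_inj. Qed.

Lemma fset_nth_in (F : {fset I}) a : @fset_nth I F a \in F.
Proof. exact: valP. Qed.

Lemma fset_nthP (F : {fset I}) i : i \in F -> exists a, @fset_nth I F a = i.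
Proof. by move=> iF; exists (enum_rank [` iF]%fset); rewrite /fset_nth enum_rankK. Qed.

Definition fset_of_nths (A : {fset I}) (J : {set 'I_#|{: A}|}) : {fset I} :=
  [fset x in [seq @fset_nth I A i | i <- enum J]]%fset.

Lemma fset_of_nthsP (A : {fset I}) (J : {set 'I_#|{: A}|}) (i : I) :
  reflect (exists2 a, a \in J & i = fset_nth a) (i \in fset_of_nths J).
Proof.
rewrite !inE; apply: (iffP mapP) => -[a aJ ->]; exists a => //.
  by move: aJ; rewrite mem_enum.
by rewrite mem_enum.
Qed.

Lemma sum_fpowerset (T : nmodType) (A : {fset I}) (g : {fset I} -> T) :
  \sum_(F <- fpowerset A) g F = \sum_(J : {set 'I_#|{: A}|}) g (fset_of_nths J).
Proof.
have FJI : injective (@fset_of_nths A).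
  move=> J J' E; apply/setP => i.
  apply/idP/idP => iJ.
    have /fset_of_nthsP[j jJ /fset_nth_inj ->] // : fset_nth i \in fset_of_nths J'.
    by rewrite -E; apply/fset_of_nthsP; exists i.
  have /fset_of_nthsP[j jJ /fset_nth_inj ->] // : fset_nth i \in fset_of_nths J.
  by rewrite E; apply/fset_of_nthsP; exists i.
have -> : fpowerset A = [fset x in [seq fset_of_nths J | J <- enum {: {set 'I_#|{: A}|}}]]%fset.
  apply/fsetP => F; rewrite fpowersetE !inE /=; apply/fsubsetP/mapP.
    move=> FA; exists (finset (fun i => @fset_nth I A i \in F)); first by rewrite mem_enum.
    apply/fsetP => i; apply/idP/fset_of_nthsP => [iF|[a aF ->]].
      have [a ai] := fset_nthP (FA _ iF).
      by exists a; rewrite ?finset.in_set ?ai.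
    by move: aF; rewrite finset.in_set.
  by move=> [J _ ->] i /fset_of_nthsP[a _ ->]; exact: fset_nth_in.
rewrite (big_fset_seq (T := {fset I})); last by rewrite map_inj_uniq // enum_uniq.
by rewrite big_map big_enum.
Qed.

End FsetEnumeration.

(** * Expansion of a determinant in principal minors *)

Section PrincipalMinors.
Variable S : comNzRingType.

(** Both sides are the determinant of the block matrix [P], multiplied by the unipotent [L] on the
    left and on the right. *)
Lemma det_sylvester n k (U : 'M[S]_(n, k)) (W : 'M[S]_(k, n)) :
  \det (1%:M + U *m W) = \det (1%:M + W *m U).
Proof.
pose P := block_mx 1%:M (- U) W 1%:M.
pose L := block_mx 1%:M U 0 1%:M.
have detL : \det L = 1 by rewrite det_ublock !det1 mulr1.
have PL : P *m L = block_mx 1%:M 0 W (1%:M + W *m U).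
  rewrite /P /L mulmx_block !mulmx1 !mul1mx !mulmx0 !addr0 subrr.
  by congr block_mx; rewrite addrC.
have LP : L *m P = block_mx (1%:M + U *m W) 0 W 1%:M.
  rewrite /P /L mulmx_block !mulmx1 !mul1mx !mul0mx !add0r addNr.
  by congr block_mx; rewrite ?addr0.
have := det_mulmx P L; rewrite PL detL mulr1 det_lblock det1 mul1r => ->.
by have := det_mulmx L P; rewrite LP detL mul1r det_lblock det1 mulr1.
Qed.

Definition mixed_mx n (J : {set 'I_n}) (N : 'M[S]_n) : 'M[S]_n :=
  \matrix_(i, j) if i \in J then N i j else (i == j)%:R.

(** Multilinearity in the rows, carried out inside the Leibniz formula. *)
Lemma det_1D n (N : 'M[S]_n) :
  \det (1%:M + N) = \sum_(J : {set 'I_n}) \det (mixed_mx J N).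
Proof.
rewrite /determinant exchange_big /=; apply: eq_bigr => s _.
rewrite -mulr_sumr; congr (_ * _).
under eq_bigr do rewrite !mxE addrC.
rewrite bigA_distr; apply: eq_bigr => J _; apply: eq_bigr => i _.
by rewrite mxE.
Qed.

(** The mixed matrix is the identity plus a product through dimension [k], so the Sylvester identity
    reduces it to size [k] at once, without expanding along the identity rows. *)
Lemma det_mixed_mx n k (f : 'I_k -> 'I_n) (N : 'M[S]_n) : injective f ->
  \det (mixed_mx [set f a | a : 'I_k] N) = \det (\matrix_(a, b) N (f a) (f b)).
Proof.
move=> fI.
pose U : 'M[S]_(n, k) := \matrix_(i, a) (i == f a)%:R.
pose W : 'M[S]_(k, n) := \matrix_(a, j) (N (f a) j - (f a == j)%:R).
have -> : mixed_mx [set f a | a : 'I_k] N = 1%:M + U *m W.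
  apply/matrixP => i j; rewrite !mxE; case: ifPn => [/imsetP[a _ ->]|iJ].
    rewrite (bigD1 a) //= !mxE eqxx mul1r big1 ?addr0; last first.
      by move=> b ba; rewrite !mxE (inj_eq fI) eq_sym (negbTE ba) mul0r.
    by rewrite addrC subrK.
  rewrite big1 ?addr0 // => a _; rewrite !mxE; case: eqP => [ia|_]; last by rewrite mul0r.
  by move: iJ; rewrite ia imset_f.
rewrite det_sylvester; congr determinant; apply/matrixP => a b; rewrite !mxE.
rewrite (bigD1 (f b)) //= !mxE eqxx mulr1 big1 ?addr0.
  by rewrite (inj_eq fI) addrC subrK.
by move=> i ib; rewrite !mxE (negbTE ib) mulr0.
Qed.

Variable I : choiceType.

Definition fset_mx (K : I -> I -> S) (F : {fset I}) : 'M[S]_#|{: F}| :=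
  \matrix_(a, b) K (fset_nth a) (fset_nth b).

Lemma det_1D_fset (K : I -> I -> S) (A : {fset I}) :
  \det (1%:M + fset_mx K A) = \sum_(F <- fpowerset A) \det (fset_mx K F).
Proof.
rewrite det_1D sum_fpowerset; apply: eq_bigr => J _.
pose FJ (J' : {set 'I_#|{: A}|}) := fset_of_nths J'.
have FJE (J' : {set 'I_#|{: A}|}) i : (fset_nth i \in FJ J') = (i \in J').
  by apply/fset_of_nthsP/idP => [[j jJ /fset_nth_inj ->]//|iJ]; exists i.
have /choice[f fE] : forall a : 'I_#|{: FJ J}|, exists i : 'I_#|{: A}|, fset_nth i = fset_nth a.
  by move=> a; have := fset_nth_in a => /fset_of_nthsP[i _ ->]; exists i.
have fI : injective f.
  by move=> a b E; apply: (@fset_nth_inj _ (FJ J)); rewrite -!fE E.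
have {1}-> : J = [set f a | a : 'I_#|{: FJ J}|].
  apply/setP => i; apply/idP/imsetP => [iJ|[a _ ->]].
    have := FJE J i; rewrite iJ => /fset_nthP[a ai]; exists a => //.
    by apply: (@fset_nth_inj _ A); rewrite fE.
  by rewrite -FJE fE fset_nth_in.
rewrite det_mixed_mx //; congr determinant; apply/matrixP => a b.
by rewrite !mxE !fE.
Qed.

End PrincipalMinors.

Lemma det_1BX_fset (S : comNzRingType) (I : choiceType) (K : I -> I -> S) (A : {fset I}) :
  \det (1%:M - 'X *: map_mx polyC (fset_mx K A)) =
  \sum_(F <- fpowerset A) ((-1) ^+ #|` F| * \det (fset_mx K F)) *: 'X^#|` F|.
Proof.
pose K' i j : {poly S} := - ('X * (K i j)%:P).
have -> : - ('X *: map_mx polyC (fset_mx K A)) = fset_mx K' A.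
  by apply/matrixP => i j; rewrite !mxE.
rewrite det_1D_fset; apply: eq_bigr => F _.
have -> : fset_mx K' F = (- 'X) *: map_mx polyC (fset_mx K F).
  by apply/matrixP => i j; rewrite !mxE mulNr.
rewrite detZ det_map_mx -[X in (- 'X) ^+ X]cardfE -mul_polyC polyCM (exprNn 'X) polyC_exp polyCN.
by rewrite mulrAC.
Qed.

(** * Diagonal entries of exterior powers as minors *)

Section ExteriorPower.
Variables (R : realType) (I : choiceType).
Local Notation C := (cplx R).
Local Notation H := (l2 R I).

(** The wedge of the basis vectors of [F] is supported on the enumerations [nu s] of [F], with value
    the sign of [s] over [sqrt k!]. At [nu s] the other wedge is the determinant with the same sign
    and factor, so the inner product has [k!] equal terms [\det M / k!]. *)
Lemma ext_power_diagE (S : H -> H) (F : {fset I}) :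
  ext_power_diag S F =
  \det (fset_mx (fun i j : I => S (std_basis i) j) F).
Proof.
rewrite /ext_power_diag; set k := #|{: F}|; set M := fset_mx _ F.
pose nu (s : 'S_k) : {ffun 'I_k -> I} := [ffun a => fset_nth (s a)].
have nuI : injective nu.
  move=> s t /ffunP E; apply/permP => a; have := E a; rewrite !ffunE.
  exact: fset_nth_inj.
pose c : C := (sqrtC (k`!%:R : C))^-1.
have cc : c * c^* = (k`!%:R)^-1.
  have -> : c^* = c.
    by apply: CrealP; apply: ger0_real; rewrite invr_ge0 sqrtC_ge0 ler0n.
  by rewrite -invfM -expr2 sqrtCK.
have k0 : k`!%:R != 0 :> C by rewrite pnatr_eq0 -lt0n fact_gt0.
rewrite (@inner_fin _ _ _ _ [fset x in [seq nu s | s <- enum {: 'S_k}]]%fset); last first.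
  move=> j jn; rewrite [X in _ * X^*](_ : _ = 0) ?conjC0 ?mulr0 //.
  rewrite /wedge_prod big1 ?mulr0 // => s _.
  apply/eqP; rewrite mulf_eq0; apply/orP; right; apply/prodf_eq0.
  case: (pickP (fun a => (std_basis (fset_nth (s a)) : H) (j a) == 0)) => [a|H0]; first by exists a.
  move: jn; rewrite !inE /= => /negP; case; apply/mapP; exists s; first by rewrite mem_enum.
  apply/ffunP => a; rewrite ffunE; have : ((j a == fset_nth (s a))%:R == 0 :> C) = false := H0 a.
  by case: (j a =P fset_nth (s a)) => // _; rewrite eqxx.
rewrite (big_fset_seq (T := {ffun 'I_k -> I})); last by rewrite map_inj_uniq // enum_uniq.
rewrite big_map big_enum /=.
transitivity (\sum_(s : 'S_k) (k`!%:R)^-1 * \det M); last first.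
  by rewrite sumr_const card_Sn -mulrnAl -(mulr_natr (_^-1)) mulVf // mul1r.
apply: eq_bigr => s _.
have -> : wedge_prod (fun a : 'I_k => std_basis (fset_nth a) : H) (nu s) = c * (-1) ^+ s.
  rewrite /wedge_prod -/c (bigD1 s) //= [X in _ * (_ * X + _)]big1; last first.
    by move=> a _; rewrite ?std_basisE ffunE eqxx.
  rewrite mulr1 big1 ?addr0 // => t ts.
  apply/eqP; rewrite mulf_eq0; apply/orP; right; apply/prodf_eq0.
  have /existsP[a ta] : [exists a, t a != s a].
    apply: contraT; rewrite negb_exists => /forallP H0; case/eqP: ts.
    by apply/permP => a; have := H0 a; rewrite negbK => /eqP.
  exists a => //; rewrite ?std_basisE ffunE (inj_eq (@fset_nth_inj _ _)).
  by rewrite [s a == _]eq_sym (negbTE ta).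
have -> : wedge_prod (fun a : 'I_k => S (std_basis (fset_nth a))) (nu s) =
    c * ((-1) ^+ s * \det M).
  rewrite /wedge_prod -/c; congr (_ * _).
  rewrite -(det_tr M) -det_perm -det_mulmx -row_permE.
  apply: eq_bigr => t _; congr (_ * _); apply: eq_bigr => a _.
  by rewrite !mxE ffunE.
rewrite rmorphM /= rmorph_sign mulrACA cc; congr (_ * _).
by rewrite mulrAC -signr_addb addbb expr0 mul1r.
Qed.

End ExteriorPower.

Section DeterminantBounds.
Variables (R : realType).
Local Notation C := (cplx R).

(** The product of the column sums expands over all maps of the index set; the Leibniz formula sees
    only those that are permutations. *)
Lemma cabs_det_le n (N : 'M[C]_n) :
  cabs (\det N) <= \prod_(b < n) \sum_(a < n) cabs (N a b).
Proof.
rewrite -det_tr bigA_distr_bigA /=; apply: le_trans (cabs_sum _ _ _) _.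
rewrite [leRHS](bigID (fun f : {ffun 'I_n -> 'I_n} => injectiveb f)) /=.
apply: (@le_trans _ _ (\sum_(f : {ffun 'I_n -> 'I_n} | injectiveb f) \prod_b cabs (N (f b) b))).
  rewrite (reindex (fun s : 'S_n => val s)) /=; last first.
    have s0 : 'S_n := 1%g.
    exists (insubd s0) => [s _|f]; first by rewrite valKd.
    by rewrite inE => fI; rewrite val_insubd fI.
  rewrite [leRHS](eq_bigl xpredT); last by case.
  apply: ler_sum => s _.
  rewrite cabsM cabsX cabsN cabs1 expr1n mul1r cabs_prod.
  by rewrite le_eqVlt; apply/orP; left; apply/eqP; apply: eq_bigr => b _; rewrite mxE pvalE.
rewrite lerDl; apply: sumr_ge0 => f _; apply: prodr_ge0 => b _; exact: cabs_ge0.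
Qed.

Variable I : choiceType.

Lemma cabs_det_fset_mx_le (K : I -> I -> C) (y : I -> R) (F : {fset I}) :
  (forall b (A : {fset I}), \sum_(a <- A) cabs (K a b) <= y b) ->
  cabs (\det (fset_mx K F)) <= \prod_(b <- F) y b.
Proof.
move=> Ky; apply: le_trans (cabs_det_le _) _.
rewrite big_seq_fsetE /= (reindex (@enum_val _ {: F})) /=; last first.
  exact: (onW_bij _ (@enum_val_bij _)).
apply: ler_prod => b _; apply/andP; split.
  by apply: sumr_ge0 => a _; exact: cabs_ge0.
apply: le_trans (Ky _ F); rewrite big_seq_fsetE /= (reindex (@enum_val _ {: F})) /=; last first.
  exact: (onW_bij _ (@enum_val_bij _)).
by rewrite le_eqVlt; apply/orP; left; apply/eqP; apply: eq_bigr => a _; rewrite mxE.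
Qed.

Lemma sum_fpowerset_prod (y : I -> R) (A : {fset I}) :
  \sum_(F <- fpowerset A) \prod_(b <- F) y b = \prod_(b <- A) (1 + y b).
Proof.
rewrite sum_fpowerset.
transitivity (\sum_(J : {set 'I_#|{: A}|})
    \prod_(i < #|{: A}|) (if i \in J then y (fset_nth i) else 1)).
  apply: eq_bigr => J _.
  rewrite big_fset_seq; last by rewrite (map_inj_uniq (@fset_nth_inj _ _)) enum_uniq.
  by rewrite big_map big_enum big_mkcond.
rewrite -bigA_distr big_seq_fsetE /= [RHS](reindex (@enum_val _ {: A})) /=; last first.
  exact: (onW_bij _ (@enum_val_bij _)).
by apply: eq_bigr => i _; rewrite addrC.
Qed.

(** Summed over all finite sets at once, the bounds for the minors form a product of factors
    [1 + r y b <= exp (r y b)]. As [r] is arbitrary, the determinant series converges everywhere. *)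
Lemma sum_minors_le (K : I -> I -> C) (y : I -> R) (Y r : R) (FF : {fset {fset I}}) :
  0 <= r -> (forall i, 0 <= y i) ->
  (forall b (A : {fset I}), \sum_(a <- A) cabs (K a b) <= y b) ->
  (forall A : {fset I}, \sum_(a <- A) y a <= Y) ->
  \sum_(F <- FF) cabs (\det (fset_mx K F)) * r ^+ #|` F| <= expR (r * Y).
Proof.
move=> r0 y0 Ky yY; pose A := (\bigcup_(F <- FF) F)%fset.
apply: (@le_trans _ _ (\sum_(F <- FF) \prod_(b <- F) (r * y b))).
  apply: ler_sum => F _; rewrite big_split /= mulrC.
  rewrite big_const_seq count_predT iter_mulr_1.
  by apply: ler_wpM2l; [exact: exprn_ge0|exact: cabs_det_fset_mx_le].
apply: (@le_trans _ _ (\sum_(F <- fpowerset A) \prod_(b <- F) (r * y b))).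
  apply: (sum_fset_mono (R := R)).
    by move=> F; apply: prodr_ge0 => b _; rewrite mulr_ge0.
  by apply/fsubsetP => F FFF; rewrite fpowersetE; exact: bigfcup_sup.
rewrite sum_fpowerset_prod.
apply: (@le_trans _ _ (\prod_(b <- A) expR (r * y b))).
  by apply: ler_prod => b _; rewrite expR_ge1Dx addr_ge0 // mulr_ge0.
by rewrite -expR_sum ler_expR -mulr_sumr ler_wpM2l.
Qed.

End DeterminantBounds.

Section FredholmSeries.
Variables (R : realType) (I : choiceType).
Local Notation C := (cplx R).
Variables (K : I -> I -> C) (y : I -> R) (Y : R).
Hypothesis y0 : forall i, 0 <= y i.
Hypothesis Ky : forall b (A : {fset I}), \sum_(a <- A) cabs (K a b) <= y b.
Hypothesis yY : forall A : {fset I}, \sum_(a <- A) y a <= Y.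

Local Notation subsets k := {F : {fset I} | #|` F| == k}.

Definition minor_sum (k : nat) : C :=
  sum (fun F : subsets k => \det (fset_mx K (val F))).

Definition fredholm_coef (k : nat) : C := (-1) ^+ k * minor_sum k.

Lemma minors_bound (r : R) k (FF : {fset subsets k}) : 0 <= r ->
  \sum_(F <- FF) cabs (\det (fset_mx K (val F))) * r ^+ k <= expR (r * Y).
Proof.
move=> r0; pose s := [seq val F | F <- enum_fset FF].
have us : uniq s by rewrite map_inj_uniq ?fset_uniq //; exact: val_inj.
have := sum_minors_le [fset x in s]%fset r0 y0 Ky yY.
rewrite big_fset_seq // big_map; apply: le_trans; rewrite le_eqVlt; apply/orP; left.
by apply/eqP; apply: eq_bigr => F _; rewrite (eqP (valP F)).
Qed.

Lemma is_sum_minor_sum k :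
  is_sum (fun F : subsets k => \det (fset_mx K (val F))) (minor_sum k).
Proof.
have [|l sl] := @abs_summable_is_sum R _ (fun F : subsets k => \det (fset_mx K (val F))).
  exists (expR (1 * Y)) => FF; apply: le_trans (minors_bound FF ler01).
  by apply: ler_sum => F _; rewrite expr1n mulr1.
by rewrite /minor_sum (is_sum_sum sl).
Qed.

Lemma fredholm_coef_le (r : R) k : 0 <= r -> cabs (fredholm_coef k) * r ^+ k <= expR (r * Y).
Proof.
move=> r0; rewrite /fredholm_coef cabsM cabsX cabsN cabs1 expr1n mul1r.
have [->|rk0] := eqVneq (r ^+ k) 0; first by rewrite mulr0 expR_ge0.
have rk : 0 < r ^+ k by rewrite lt_def rk0 exprn_ge0.
rewrite -ler_pdivlMr //; apply: (is_sum_le (A0 := fset0) _ (@is_sum_minor_sum k)) => FF _.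
rewrite ler_pdivlMr //; apply: le_trans (minors_bound FF r0).
by rewrite -mulr_suml; apply: ler_wpM2r; [exact: ltW|exact: cabs_sum].
Qed.

Lemma fredholm_coef_entire : ps_entire fredholm_coef.
Proof. by move=> r r0; exists (expR (r * Y)) => k; apply: fredholm_coef_le; exact: ltW. Qed.

(** The kernel is read from source to image: [K i j] is the [j] coordinate of the image of [i]. This
    is the order produced by [ext_power_diagE] and the one in which words are multiplied later. *)
Lemma is_fredholm_det_psum (S : l2 R I -> l2 R I) (u : C) :
  (forall i j, S (std_basis i) j = K i j) ->
  is_fredholm_det (fun x => u *: S x) (psum fredholm_coef u).
Proof.
move=> SK; exists (fun k => u ^+ k * minor_sum k); split.
  move=> k; rewrite /is_ext_power_trace.
  have := is_sumZ (a := u ^+ k) (@is_sum_minor_sum k).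
  congr is_sum; apply/funext => F; rewrite ext_power_diagE.
  have -> : fset_mx (fun i j : I => (u *: S (std_basis i)) j) (val F) =
      u *: fset_mx K (val F).
    by apply/matrixP => a b; rewrite !mxE -SK.
  by rewrite detZ -[X in u ^+ X](eqP (valP F)) cardfE.
have r0 : 0 < cabs u + 1 by rewrite ltr_wpDl // cabs_ge0.
have [B HB] := fredholm_coef_entire r0.
have [|_] := psumP (z := u) HB r0; first by rewrite ltrDl.
rewrite (_ : (fun k => fredholm_coef k * u ^+ k) = (fun k => (-1) ^+ k * (u ^+ k * minor_sum k))) //.
by apply/funext => k; rewrite /fredholm_coef -mulrA [u ^+ k * _]mulrC.
Qed.

Definition compression_det (A : {fset I}) : {poly C} :=
  \det (1%:M - 'X *: map_mx polyC (fset_mx K A)).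

Lemma compression_det_coef (A : {fset I}) k :
  (compression_det A)`_k =
  (-1) ^+ k * \sum_(F <- fpowerset A | #|` F| == k) \det (fset_mx K F).
Proof.
rewrite /compression_det det_1BX_fset coef_sum mulr_sumr [RHS]big_mkcond /=.
apply: eq_bigr => F _; rewrite coefZ coefXn eq_sym.
by case: eqP => [->|_]; rewrite ?mulr1 ?mulr0.
Qed.

(** Up to sign, the coefficient for [A] is the partial sum of [minor_sum] over the subsets of [A]
    with [k] elements, and any finitely many subsets fit into one [A]. *)
Lemma compression_det_coef_cvg k (e : R) : 0 < e ->
  exists A0 : {fset I}, forall A, (A0 `<=` A)%fset ->
    cabs (fredholm_coef k - (compression_det A)`_k) < e.
Proof.
move=> e0; have /is_sumP/(_ e e0)[FF HFF] := @is_sum_minor_sum k.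
exists (\bigcup_(F <- FF) val F)%fset => A FA.
rewrite compression_det_coef -mulrBr cabsM cabsX cabsN cabs1 expr1n mul1r.
pose s : seq (subsets k) := pmap insub (enum_fset (fpowerset A)).
have us : uniq s by apply: pmap_sub_uniq; exact: fset_uniq.
have := HFF [fset x in s]%fset; rewrite big_fset_seq //.
have -> : \sum_(F <- s) \det (fset_mx K (val F)) =
    \sum_(F <- fpowerset A | #|` F| == k) \det (fset_mx K F).
  rewrite -(big_map val xpredT (fun F => \det (fset_mx K F))).
  rewrite pmap_filter; last exact: insubK.
  by rewrite big_filter; apply: eq_bigl => F; rewrite isSome_insub.
apply; apply/fsubsetP => F FFF; rewrite !inE /= mem_pmap_sub /=.
rewrite -[_ \in _]/(val F \in fpowerset A) fpowersetE.
apply: fsubset_trans FA; apply/fsubsetP => i iF.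
by apply/bigfcupP; exists F; rewrite ?FFF.
Qed.

End FredholmSeries.

(** * Newton identities and primitive words *)

Section NewtonIdentities.
Variable C : numFieldType.
Implicit Types f g S : {poly C}.

(* [X f' + S f = 0] modulo [X^(n+1)]: [S] plays the role of [- X f' / f], a power
   series whose coefficients are the power sums. *)
Definition newton n f S := forall k, (k <= n)%N -> ('X * f^`() + S * f)`_k = 0.

Lemma coefM_low n f g : (forall k, (k <= n)%N -> f`_k = 0) ->
  forall k, (k <= n)%N -> (f * g)`_k = 0.
Proof.
move=> f0 k kn; rewrite coefM big1 // => i _; rewrite f0 ?mul0r //.
by apply: leq_trans kn; rewrite -ltnS.
Qed.

Lemma newton_mul n f g S T : newton n f S -> newton n g T -> newton n (f * g) (S + T).
Proof.
move=> fS gT k kn; rewrite derivM.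
have -> : 'X * (f^`() * g + f * g^`()) + (S + T) * (f * g) =
    ('X * f^`() + S * f) * g + ('X * g^`() + T * g) * f by ring.
by rewrite coefD !(coefM_low (n := n)) // addr0.
Qed.

Lemma newton_prod n (I : eqType) (s : seq I) (f S : I -> {poly C}) :
  (forall i, i \in s -> newton n (f i) (S i)) ->
  newton n (\prod_(i <- s) f i) (\sum_(i <- s) S i).
Proof.
elim: s => [_ k _|i s IH fS]; first by rewrite !big_nil derivC mulr0 mul0r addr0 coef0.
rewrite !big_cons; apply: newton_mul; first by apply: fS; rewrite mem_head.
by apply: IH => j js; apply: fS; rewrite inE js orbT.
Qed.

(** As [S] has no constant term, order [k + 1] of the relation expresses [k + 1] times that
    coefficient through lower ones, and [k + 1] is invertible. The induction is run on the
    difference, which satisfies the same linear relation. *)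
Lemma newton_uniq n f g S : S`_0 = 0 -> f`_0 = g`_0 -> newton n f S -> newton n g S ->
  forall k, (k <= n)%N -> f`_k = g`_k.
Proof.
move=> S0 fg0 fS gS k; have [m] := ubnP k; elim: m k => // m IH [//|k] km kn.
apply/eqP; rewrite -subr_eq0 -coefB; set h := f - g.
have h0 j : (j <= k)%N -> h`_j = 0.
  move=> jk; apply/eqP; rewrite coefB subr_eq0; apply/eqP; apply: IH.
    by apply: leq_ltn_trans jk _.
  by apply: leq_trans jk _; exact: ltnW.
have : ('X * h^`() + S * h)`_k.+1 = 0.
  rewrite derivB mulrBr [S * _]mulrBr addrACA -opprD coefB fS // gS // subr0 //.
rewrite coefD coefXM coef_deriv /= coefM big_ord_recl /= S0 mul0r add0r.
rewrite big1 ?addr0; last by move=> i _; rewrite subSS h0 ?mulr0 // leq_subr.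
by move=> /eqP; rewrite -mulr_natr mulf_eq0 pnatr_eq0 orbF.
Qed.

(** The series [- X f' / f] for [f = 1 - a X^l], truncated at order [n]. *)
Definition power_sums n (l : nat) (a : C) : {poly C} :=
  \poly_(j < n.+1) (if (0 < j)%N && (l %| j)%N then l%:R * a ^+ (j %/ l) else 0).

Lemma newton_factor n l a : (0 < l)%N -> newton n (1 - a *: 'X^l) (power_sums n l a).
Proof.
move=> l0 k kn; set S := power_sums n l a.
have SE j : (j <= n)%N -> S`_j =
    if (0 < j)%N && (l %| j)%N then l%:R * a ^+ (j %/ l) else 0.
  by move=> jn; rewrite coef_poly ltnS jn.
rewrite derivB derivC sub0r derivZ derivXn mulrN -scalerAr mulrnAr -exprS prednK //.
rewrite mulrBr mulr1 -scalerAr coefD coefN coefZ coefMn coefXn coefB coefZ coefMXn SE //.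
have [kl|lk] := ltnP k l.
  rewrite (ltn_eqF kl) mul0rn !mulr0 oppr0 addr0 add0r.
  by case: ifP => // /andP[k0 /(dvdn_leq k0)]; rewrite leqNgt kl.
rewrite SE; last by apply: leq_trans kn; exact: leq_subr.
have k0 : (0 < k)%N by exact: leq_trans lk.
rewrite k0 /= subn_gt0.
have [->|kl] := eqVneq k l; first by rewrite ltnn dvdnn divnn l0 expr1 mulr0 subr0 mulrC addNr.
have lk' : (l < k)%N by rewrite ltn_neqAle eq_sym kl.
rewrite mul0rn mulr0 oppr0 add0r lk' /= dvdn_subl //.
case: ifP => [dk|_]; last by rewrite mulr0 subr0.
have -> : (k %/ l)%N = ((k - l) %/ l).+1 by rewrite -[k in LHS](subnK lk) divnDr // divnn l0 addn1.
by rewrite exprS mulrCA subrr.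
Qed.

End NewtonIdentities.

Section Schur.
Import mathcomp.algebra.mxred mathcomp.algebra.spectral.
Variable C : numClosedFieldType.

Lemma trig_mulmx n (A B : 'M[C]_n) : is_trig_mx A -> is_trig_mx B ->
  is_trig_mx (A *m B) /\ forall i, (A *m B) i i = A i i * B i i.
Proof.
move=> /is_trig_mxP At /is_trig_mxP Bt; split.
  apply/is_trig_mxP => i j ij; rewrite mxE big1 // => k _.
  have [ik|ki] := ltnP i k; first by rewrite At // mul0r.
  by rewrite Bt ?mulr0 //; apply: leq_ltn_trans ij.
move=> i; rewrite mxE (bigD1 i) //= big1 ?addr0 // => k ki.
have [ik|] := ltnP i k; first by rewrite At // mul0r.
by rewrite leq_eqVlt => /orP[/eqP/val_inj ki'|lt]; [rewrite ki' eqxx in ki|rewrite Bt ?mulr0].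
Qed.

(** By Schur's theorem [N] is unitarily triangularizable; [d] lists its eigenvalues. The exponent in
    ['X^1] is kept so that each factor fits [newton_factor] with length 1. *)
Lemma triangular_trace_det n (N : 'M[C]_n) : exists d : 'I_n -> C,
  (forall j, \tr (iter j (mulmx N) 1%:M) = \sum_i d i ^+ j) /\
  \det (1%:M - 'X *: map_mx polyC N) = \prod_i (1 - d i *: 'X^1).
Proof.
have [P PU] : cotrigonalizable_in (@unitarymx C n n) [:: N].
  by apply: cotrigonalization => A B; rewrite !inE => /eqP -> /eqP ->.
have Pu := unitarymx_unit PU.
rewrite /= /similar_to andbT conjumx //; set T := P *m N *m invmx P => Tt.
have NE : N = invmx P *m T *m P.
  by rewrite /T !mulmxA mulVmx // mul1mx -mulmxA mulVmx // mulmx1.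
clearbody T.
exists (fun i => T i i); split.
  move=> j.
  have -> : iter j (mulmx N) 1%:M = invmx P *m iter j (mulmx T) 1%:M *m P.
    elim: j => [|j /= ->]; first by rewrite /= mulmx1 mulVmx.
    by rewrite {1}NE !mulmxA -[_ *m P *m invmx P]mulmxA mulmxV // mulmx1.
  rewrite mxtrace_mulC mulmxA mulmxV // mul1mx.
  have [_ HT] : is_trig_mx (iter j (mulmx T) 1%:M) /\
      forall i, (iter j (mulmx T) 1%:M) i i = T i i ^+ j.
    elim: j => [|j [IH1 IH2]] /=.
      split; last by move=> i; rewrite mxE eqxx expr0.
      by apply/is_trig_mxP => i k ik; rewrite mxE -val_eqE /= ltn_eqF.
    have [H1 H2] := trig_mulmx Tt IH1; split => // i.
    by rewrite H2 IH2 exprS.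
  by apply: eq_bigr => i _; rewrite HT.
have -> : 1%:M - 'X *: map_mx polyC N =
    map_mx polyC (invmx P) *m (1%:M - 'X *: map_mx polyC T) *m map_mx polyC P.
  rewrite mulmxBr mulmxBl mulmx1 -map_mxM mulVmx // map_mx1.
  by rewrite -scalemxAr -scalemxAl -!map_mxM -NE.
rewrite !det_mulmx mulrC mulrA -det_mulmx -map_mxM mulmxV // map_mx1 det1 mul1r.
have Xt : is_trig_mx (1%:M - 'X *: map_mx polyC T).
  apply/is_trig_mxP => i k ik; rewrite !mxE -val_eqE /= ltn_eqF // sub0r.
  by move/is_trig_mxP: Tt => ->; rewrite // polyC0 mulr0 oppr0.
rewrite det_trig //; apply: eq_bigr => i _; rewrite !mxE eqxx.
by rewrite expr1 -mul_polyC mulrC.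
Qed.

End Schur.

(** * Primitive words and their powers *)

Section PrimitiveWords.
Variable T : eqType.
Implicit Types (r s t : seq T).

Definition rep q r : seq T := flatten (nseq q r).

Lemma repS q r : rep q.+1 r = r ++ rep q r. Proof. by []. Qed.

Lemma repSr q r : rep q.+1 r = rep q r ++ r.
Proof. by elim: q => [|q IH]; [rewrite repS cats0|rewrite repS {1}IH repS catA]. Qed.

Lemma size_rep q r : size (rep q r) = (q * size r)%N.
Proof. by elim: q => // q IH; rewrite repS size_cat IH mulSn. Qed.

(** Phrased by rotations rather than by powers, so that the rotations of a primitive word of length
    [l] are [l] distinct words. *)
Definition primitive r := (0 < size r)%N && all (fun d => rot d r != r) (iota 1 (size r).-1).

Lemma primitiveP r : reflect ((0 < size r)%N /\ forall d, (0 < d < size r)%N -> rot d r <> r)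
  (primitive r).
Proof.
apply: (iffP andP) => -[r0 H]; split => //.
  move=> d /andP[d0 dr] /eqP; apply/negP; apply: (allP H).
  by rewrite mem_iota d0 add1n prednK.
apply/allP => d; rewrite mem_iota add1n prednK // => H'; apply/eqP; exact: H.
Qed.

Lemma cat_comm_rep q (a b : seq T) : size b = (q * size a)%N -> b ++ a = a ++ b -> b = rep q a.
Proof.
elim: q b => [|q IH] b; first by rewrite mul0n => /size0nil.
rewrite mulSn => sb ba.
have ab : take (size a) b = a.
  have := congr1 (take (size a)) ba; rewrite [RHS]take_size_cat // takel_cat //.
  by rewrite sb leq_addr.
rewrite -(cat_take_drop (size a) b) ab repS; congr (_ ++ _); apply: IH.
  by rewrite size_drop sb addKn.
move: ba; rewrite -{1 2}(cat_take_drop (size a) b) ab -catA => /eqP.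
by rewrite eqseq_cat // eqxx => /eqP.
Qed.

Lemma rot_rep_period t d : (0 < size t)%N -> (0 < d)%N -> (d <= size t)%N -> rot d t = t ->
  forall q, (q * d <= size t)%N -> rot (q * d) t = t.
Proof.
move=> t0 d0 dt rt; elim=> [|q IH]; first by rewrite mul0n rot0.
rewrite mulSn => qd; rewrite rotD // IH //.
by apply: leq_trans qd; rewrite leq_addl.
Qed.

(** [l] is the least positive rotation fixing [t]. Euclidean division shows that it divides the
    length, and a smaller period of the prefix would be a smaller period of [t]. *)
Lemma primitive_root t : (0 < size t)%N ->
  exists l, [/\ (0 < l)%N, (l %| size t)%N, primitive (take l t) & t = rep (size t %/ l) (take l t)].
Proof.
move=> t0.
have ex : exists d, (0 < d)%N && (rot d t == t) by exists (size t); rewrite t0 rot_size eqxx.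
case: (ex_minnP ex) => l /andP[l0 /eqP rl] lmin.
have lt : (l <= size t)%N by apply: lmin; rewrite t0 rot_size eqxx.
have ldiv : (l %| size t)%N.
  rewrite /dvdn; apply: contraT => m0.
  have qd : (size t %/ l * l <= size t)%N by exact: leq_trunc_div.
  have := lmin (size t %% l)%N; rewrite lt0n m0 /= leqNgt ltn_mod l0.
  suff -> : rot (size t %% l)%N t == t by move=> /(_ isT).
  have := rot_size t; rewrite {1}(divn_eq (size t) l) addnC rotD; last first.
    by rewrite addnC -divn_eq.
  by rewrite (rot_rep_period t0 l0 lt rl) // => ->.
have trep : t = rep (size t %/ l) (take l t).
  have E : size (take l t) = l by rewrite size_takel.
  have q0 : (0 < size t %/ l)%N by rewrite divn_gt0.
  rewrite -(prednK q0) repS -{1}(cat_take_drop l t); congr (_ ++ _).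
  apply: cat_comm_rep; last by rewrite cat_take_drop -[RHS]rl.
  by rewrite size_drop E -subn1 mulnBl mul1n divnK.
exists l; split=> //.
apply/primitiveP; rewrite size_takel //; split=> // d /andP[d0 dl] rd.
have : (l <= d)%N; last by rewrite leqNgt dl.
apply: lmin; rewrite d0 /=; apply/eqP; rewrite [in LHS]trep [RHS]trep.
set r := take l t in rd *; have sr : size r = l by rewrite size_takel.
have q0 : (0 < size t %/ l)%N by rewrite divn_gt0.
move: rd; rewrite -{2}(cat_take_drop d r) /rot.
set a := take d r; set b := drop d r => rd.
have comm q : a ++ rep q r = rep q r ++ a.
  elim: q => [|q IH]; first by rewrite cats0.
  have ra : r ++ a = a ++ r.
    by rewrite -[r in LHS](cat_take_drop d r) -/a -/b -catA rd /a /b cat_take_drop.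
  by rewrite repS -catA -IH !catA ra.
have sa : size a = d by rewrite size_takel // sr ltnW.
rewrite -(prednK q0) repS.
have -> : r ++ rep (size t %/ l).-1 r = a ++ (b ++ rep (size t %/ l).-1 r).
  by rewrite catA /a /b cat_take_drop.
by rewrite -sa drop_size_cat // take_size_cat // -catA -comm catA rd catA.
Qed.

Lemma rot_rep r q : rot (size r) (rep q r) = rep q r.
Proof. by case: q => // q; rewrite {1}repS rot_size_cat repSr. Qed.

Lemma primitive_rep_period r q d : primitive r -> (0 < d < size r)%N ->
  rot d (rep q.+1 r) <> rep q.+1 r.
Proof.
move=> /primitiveP[r0 rp] dr; have /andP[d0 dr'] := dr; apply/eqP.
apply/negP => /eqP E; apply: (rp d dr).
have [t tE] : exists t, rot d (rep q.+1 r) = rot d r ++ t.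
  rewrite repS /rot drop_cat dr' takel_cat; last by rewrite ltnW.
  case: q {E} => [|q]; first by exists [::]; rewrite /= !cats0.
  exists (drop d r ++ rep q r ++ take d r).
  have rE : r = take d r ++ drop d r by rewrite cat_take_drop.
  by rewrite repS {2}rE !catA.
have := congr1 (take (size r)) E.
by rewrite tE repS [RHS]take_size_cat // -[in X in take X](size_rot d r) take_size_cat.
Qed.

Definition root_length l t := [&& (0 < l)%N, (l %| size t)%N, primitive (take l t) &
  t == rep (size t %/ l) (take l t)].

Lemma root_length_ex t : (0 < size t)%N -> exists2 l, (0 < l <= size t)%N & root_length l t.
Proof.
move=> t0; have [l [l0 ld lp lt]] := primitive_root t0; exists l.
  by rewrite l0 dvdn_leq.
by apply/and4P; split=> //; apply/eqP.
Qed.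

(** Rotation by the shorter of two root lengths fixes [t], which the primitivity of the longer root
    forbids. *)
Lemma root_length_uniq t l1 l2 : (0 < size t)%N -> root_length l1 t -> root_length l2 t -> l1 = l2.
Proof.
wlog lt : l1 l2 / (l1 < l2)%N => [H t0 H1 H2|].
  by case: (ltngtP l1 l2) => // ll; [exact: H|apply/esym; exact: H].
move=> t0 /and4P[l10 ld1 lp1 /eqP t1] /and4P[l20 ld2 lp2 /eqP t2].
have q0 : (0 < size t %/ l2)%N by rewrite divn_gt0 // dvdn_leq.
have : rot l1 t <> t.
  rewrite t2 -(prednK q0); apply: primitive_rep_period => //.
  by rewrite l10 size_takel // dvdn_leq.
by case; have := rot_rep (take l1 t) (size t %/ l1); rewrite -t1 size_takel // dvdn_leq.
Qed.

Lemma root_length_rep q r : primitive r -> (0 < q)%N -> root_length (size r) (rep q r).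
Proof.
move=> rp q0; have [r0 _] := primitiveP _ rp.
have E : take (size r) (rep q r) = r by rewrite -(prednK q0) repS take_size_cat.
by apply/and4P; split; rewrite ?E // ?size_rep ?dvdn_mull // mulnK.
Qed.

Lemma cycle_rep (e : rel T) q r : (0 < q)%N -> path.cycle e (rep q r) = path.cycle e r.
Proof.
case: q => // q _; case: r => [|x p]; first by elim: q.
have H k : path.cycle e (rep k.+1 (x :: p)) = path e x (flatten (nseq k.+1 (rcons p x))).
  rewrite repS /= rcons_cat /=; congr (path e x _).
  elim: k p {q} => [|k IH] p; first by rewrite !cats0 cats1.
  by rewrite repS rcons_cat /= -IH cat_rcons.
rewrite H; elim: q => [|q IH]; first by rewrite /= cats0.
by rewrite -[nseq q.+2 _]/(rcons p x :: nseq q.+1 _) [flatten _]/= cat_path last_rcons IH /= andbb.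
Qed.

End PrimitiveWords.

Section Words.
Variable T : choiceType.

Definition words (A : seq T) k : seq (seq T) :=
  iter k (fun W => [seq x :: s | x <- A, s <- W]) [:: [::]].

Lemma wordsS (A : seq T) k : words A k.+1 = [seq x :: s | x <- A, s <- words A k].
Proof. by []. Qed.

Lemma big_words (S : nmodType) (A : seq T) k (F : seq T -> S) :
  \sum_(t <- words A k.+1) F t = \sum_(x <- A) \sum_(s <- words A k) F (x :: s).
Proof. by rewrite wordsS big_allpairs_dep. Qed.

Lemma mem_words (A : seq T) k s : (s \in words A k) = (size s == k) && all (mem A) s.
Proof.
elim: k s => [|k IH] s /=; first by rewrite inE; case: s.
case: s => [|x s]; first by apply/negbTE/negP => /allpairsP[[? ?] []].
rewrite eqSS andbCA -IH /=; apply/allpairsP/andP => [[[y t] [/= yA tW [-> ->]]]//|[xA sW]].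
by exists (x, s).
Qed.

Lemma words_uniq (A : seq T) k : uniq A -> uniq (words A k).
Proof.
move=> uA; elim: k => // k IH /=; apply: allpairs_uniq => //.
by move=> [x s] [y t] _ _ /= [-> ->].
Qed.

End Words.

Section CyclicWeight.
Variables (S : comNzRingType) (T : choiceType).

Fixpoint path_entry (K : T -> T -> S) x s y :=
  if s is z :: s' then K x z * path_entry K z s' y else K x y.

(** The value 0 on the empty word is a default; traces of powers are taken for positive
    exponents. *)
Definition cyclic_entry K s := if s is x :: s' then path_entry K x s' x else 0.

Lemma iter_mulmx_entry (K : T -> T -> S) (A : {fset T}) m i j :
  (iter m.+1 (mulmx (fset_mx K A)) 1%:M) i j =
  \sum_(s <- words A m) path_entry K (fset_nth i) s (fset_nth j).
Proof.
elim: m i j => [|m IH] i j; first by rewrite /= mulmx1 mxE big_seq1.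
rewrite iterS mxE big_words big_seq_fsetE /=.
rewrite [RHS](reindex (@enum_val _ {: A})) /=; last exact: (onW_bij _ (@enum_val_bij _)).
by apply: eq_bigr => k _; rewrite IH mxE mulr_sumr.
Qed.

Lemma trace_words (K : T -> T -> S) (A : {fset T}) m : (0 < m)%N ->
  \tr (iter m (mulmx (fset_mx K A)) 1%:M) = \sum_(s <- words A m) cyclic_entry K s.
Proof.
case: m => // m _; rewrite /mxtrace big_words big_seq_fsetE /=.
rewrite [RHS](reindex (@enum_val _ {: A})) /=; last exact: (onW_bij _ (@enum_val_bij _)).
by apply: eq_bigr => k _; rewrite -iterS iter_mulmx_entry.
Qed.

(** The weight sits on the second letter of each step, and around a cycle every letter comes second
    exactly once. *)
Lemma cyclic_entry_cycle (w : T -> S) (e : rel T) s : s != [::] ->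
  cyclic_entry (fun a b => if e a b then w b else 0) s =
  if path.cycle e s then \prod_(a <- s) w a else 0.
Proof.
case: s => // x s _ /=.
have H y : path_entry (fun a b => if e a b then w b else 0) y s x =
   if path e y (rcons s x) then \prod_(a <- rcons s x) w a else 0.
  elim: s y => [|z s IH] y /=; first by rewrite andbT big_seq1.
  by rewrite IH big_cons; case: (e y z); case: path; rewrite ?mulr0 ?mul0r.
rewrite H; case: ifP => // _; apply: perm_big.
by rewrite perm_rcons.
Qed.

End CyclicWeight.

Lemma prod_rep (S : comNzRingType) (T : Type) (w : T -> S) q (r : seq T) :
  \prod_(a <- flatten (nseq q r)) w a = (\prod_(a <- r) w a) ^+ q.
Proof. by elim: q => [|q IH]; rewrite ?big_nil ?expr0 //= big_cat IH exprS. Qed.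

Section PrimitiveSums.
Variables (S : comNzRingType) (T : choiceType) (w : T -> S) (e : rel T) (A : {fset T}).

Local Notation wt r := (\prod_(a <- r) w a).

(** Words are sorted by the length of their root, which exists and is unique. A power is cyclic for
    [e] exactly when its root is. *)
Lemma sum_cyclic_words k : (0 < k)%N ->
  \sum_(t <- words A k | path.cycle e t) wt t =
  \sum_(l <- iota 1 k | (l %| k)%N)
    \sum_(r <- words A l | primitive r && path.cycle e r) wt r ^+ (k %/ l).
Proof.
move=> k0.
transitivity (\sum_(t <- words A k | path.cycle e t)
    \sum_(l <- iota 1 k | root_length l t) wt t).
  rewrite big_seq_cond [RHS]big_seq_cond; apply: eq_bigr => t /andP[].
  rewrite mem_words => /andP[/eqP st _] _.
  have t0 : (0 < size t)%N by rewrite st.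
  have [l0 /andP[l00 l0k] l0t] := root_length_ex t0.
  rewrite [RHS]big_mkcond [RHS](bigD1_seq l0) ?iota_uniq //=; last by rewrite mem_iota l00 add1n ltnS -st.
  rewrite l0t [X in _ = _ + X]big1_seq ?addr0 // => l /andP[ll _]; case: ifP => // lt.
  by rewrite (root_length_uniq t0 lt l0t) eqxx in ll.
rewrite (exchange_big_dep xpredT) //= [RHS]big_mkcond /=.
rewrite big_seq [RHS]big_seq; apply: eq_bigr => l; rewrite mem_iota add1n ltnS => /andP[l0 lk].
case: ifPn => [dl|dl]; last first.
  rewrite big1_seq // => t /andP[/andP[_ /and4P[_ ld _ _]]].
  by rewrite mem_words => /andP[/eqP st _]; rewrite st (negbTE dl) in ld.
have q0 : (0 < k %/ l)%N by rewrite divn_gt0.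
rewrite -big_filter -[RHS]big_filter.
set L1 := [seq t <- _ | _]; set L2 := [seq r <- _ | _].
rewrite (perm_big [seq rep (k %/ l) r | r <- L2]); last first.
  apply: uniq_perm; first by rewrite filter_uniq // words_uniq // fset_uniq.
    rewrite map_inj_in_uniq ?filter_uniq ?words_uniq ?fset_uniq //.
    move=> r r'; rewrite !mem_filter !mem_words => /and3P[_ /eqP sr _] /and3P[_ /eqP sr' _].
    rewrite -(prednK q0) !repS => /eqP; rewrite eqseq_cat ?sr ?sr' //.
    by case/andP => /eqP.
  move=> t; apply/idP/mapP.
    rewrite mem_filter mem_words => /and3P[/andP[ct /and4P[_ ld lp /eqP tE]] /eqP st tA].
    rewrite st in tE; exists (take l t); last by [].
    rewrite mem_filter mem_words lp size_takel ?st // eqxx /=.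
    rewrite -(cycle_rep e _ q0) -tE ct /=.
    by apply/allP => x /mem_take; exact: (allP tA).
  move=> [r]; rewrite mem_filter mem_words => /and3P[/andP[rp rc] /eqP sr rA] ->.
  rewrite mem_filter mem_words cycle_rep // rc /= -{1}sr root_length_rep //=.
  rewrite size_rep sr divnK // eqxx /=.
  by apply/allP => x /flattenP[s /nseqP[-> _]]; exact: (allP rA).
rewrite big_map; apply: eq_bigr => r _; exact: prod_rep.
Qed.

End PrimitiveSums.

(** * Products over primitive cyclic words *)

Section PrimeProduct.
Variables (C : numClosedFieldType) (T J : choiceType) (w : T -> C) (e : rel T).
Variables (phi : seq T -> J) (wt : J -> C) (len : J -> nat).

(** Cycles enter this section only through the map [phi], which identifies words up to rotation; the
    argument is independent of graphs. *)
Definition prime_word r := primitive r && path.cycle e r.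

Hypothesis phiP : forall r r', prime_word r -> prime_word r' ->
  phi r = phi r' <-> exists d, r' = rot d r.
Hypothesis wtE : forall r, prime_word r -> wt (phi r) = \prod_(a <- r) w a.
Hypothesis lenE : forall r, prime_word r -> len (phi r) = size r.

Lemma prime_word_rot r d : prime_word r -> prime_word (rot d r).
Proof.
move=> /andP[/primitiveP[r0 rp] rc]; apply/andP; split; last by rewrite rot_cycle.
apply/primitiveP; rewrite size_rot; split => // k kr; rewrite rot_rot => /rot_inj.
exact: rp.
Qed.

Definition prime_words (A : {fset T}) n : seq (seq T) :=
  [seq r <- [seq s | l <- iota 1 n, s <- words A l] | prime_word r].

Lemma mem_prime_words (A : {fset T}) n r :
  (r \in prime_words A n) = [&& prime_word r, (size r <= n)%N & all (mem A) r].
Proof.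
rewrite mem_filter; case pr: (prime_word r) => //=.
have r0 : (0 < size r)%N by case/andP: pr => /primitiveP[].
apply/allpairsPdep/andP => [[l [s [+ + ->]]]|[rn rA]].
  rewrite mem_iota add1n ltnS mem_words => /andP[_ ln] /andP[/eqP -> ->].
  by rewrite ln.
by exists (size r), r; rewrite mem_iota add1n ltnS r0 rn mem_words eqxx rA.
Qed.

Lemma prime_words_uniq (A : {fset T}) n : uniq (prime_words A n).
Proof.
apply: filter_uniq; apply: allpairs_uniq_dep; first exact: iota_uniq.
  by move=> l _; exact: words_uniq (fset_uniq A).
have H (p : {_ : nat & seq T}) :
    p \in [seq existT (fun=> seq T) l s | l <- iota 1 n, s <- words A l] -> tag p = size (tagged p).
  move=> /allpairsPdep[l [s [_ sl ->]]].
  move: sl; rewrite mem_words /=.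
  by move=> /andP[/eqP ->].
move=> [l s] [l' s'] /H /= -> /H /= ->; by move=> ->.
Qed.

Definition prime_classes (A : {fset T}) n : {fset J} :=
  [fset phi r | r in [fset x in prime_words A n]%fset]%fset.

Lemma prime_classesP (A : {fset T}) n p :
  reflect (exists2 r, r \in prime_words A n & p = phi r) (p \in prime_classes A n).
Proof.
apply: (iffP idP) => [/imfsetP[r rP ->]|[r rP ->]]; first by exists r; rewrite // ?inE // in rP *.
by apply/imfsetP; exists r => //; rewrite !inE.
Qed.

(** The fibre consists of the rotations of [r0], and primitivity makes those by less than its length
    distinct. *)
Lemma sum_fiber (A : {fset T}) n r0 (c : C) : r0 \in prime_words A n ->
  \sum_(r <- prime_words A n | phi r == phi r0) c = (size r0)%:R * c.
Proof.
move=> r0P; have := r0P; rewrite mem_prime_words => /and3P[pr0 sr0 r0A].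
have [r00 rp] := primitiveP _ (proj1 (andP pr0)).
rewrite -big_filter (perm_big [seq rot d r0 | d <- iota 0 (size r0)]); last first.
  apply: uniq_perm; first by rewrite filter_uniq // prime_words_uniq.
    rewrite map_inj_in_uniq ?iota_uniq // => d d'; rewrite !mem_iota !add0n /=.
    wlog dd : d d' / (d < d')%N => [H dr dr' E|dr dr' E].
      by case: (ltngtP d d') => // ?; [exact: H|symmetry; apply: H].
    exfalso; apply: (rp (d' - d)%N).
      by rewrite subn_gt0 dd /=; apply: leq_ltn_trans dr'; exact: leq_subr.
    have E' : rot d' r0 = rot d (rot (d' - d) r0).
      by rewrite -rotD subnKC // ltnW.
    by move: E; rewrite E' => /rot_inj.
  move=> r; rewrite mem_filter; apply/andP/mapP.
    move=> [/eqP E]; rewrite mem_prime_words => /and3P[pr _ _].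
    have [d ->] := proj1 (phiP pr0 pr) (esym E).
    have [dl|ld] := ltnP d (size r0); first by exists d; rewrite // mem_iota.
    by exists 0%N; rewrite ?mem_iota ?rot0 ?rot_oversize.
  move=> [d _ ->]; have pd := prime_word_rot d pr0; split.
    by apply/eqP/esym/phiP => //; exists d.
  rewrite mem_prime_words pd size_rot sr0 /=.
  by apply/allP => x; rewrite mem_rot; exact: (allP r0A).
by rewrite big_map big_const_seq count_predT size_iota iter_addr_0 mulr_natl.
Qed.

(** Both polynomials have constant coefficient 1, so it is enough to match their power sums. The
    trace of the [j]-th power is a sum over primitive words whose length divides [j]; a class of
    length [l] holds [l] of them, which is the factor [l%:R] in [power_sums]. *)
Lemma prime_product_coef (A : {fset T}) n k : (k <= n)%N ->
  (\prod_(p <- prime_classes A n) (1 - wt p *: 'X^(len p)))`_k =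
  (\det (1%:M - 'X *: map_mx polyC (fset_mx (fun a b => if e a b then w b else 0) A)))`_k.
Proof.
set K := fun a b : T => if e a b then w b else 0.
have [d [dtr ->]] := triangular_trace_det (fset_mx K A).
pose S1 := \sum_(p <- prime_classes A n) power_sums n (len p) (wt p).
pose S2 : {poly C} := \sum_i power_sums n 1 (d i).
have S2E : S2 = S1.
  apply/polyP => j; rewrite /S1 /S2 !coef_sum.
  under eq_bigr do rewrite coef_poly.
  under [RHS]eq_bigr do rewrite coef_poly.
  have [jn|jn] := ltnP j n.+1; last by rewrite !big1.
  case: (posnP j) => [->|j0]; first by rewrite !big1.
  rewrite /=; under eq_bigr do rewrite dvd1n divn1 mul1r.
  rewrite -dtr trace_words //.
  transitivity (\sum_(t <- words A j | path.cycle e t) \prod_(a <- t) w a).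
    rewrite [RHS]big_mkcond big_seq [RHS]big_seq; apply: eq_bigr => t.
    rewrite mem_words => /andP[/eqP tj _]; apply: cyclic_entry_cycle.
    by rewrite -size_eq0 tj -lt0n.
  rewrite sum_cyclic_words //.
  pose F r : C := if (size r %| j)%N then (\prod_(a <- r) w a) ^+ (j %/ size r) else 0.
  transitivity (\sum_(r <- prime_words A n) F r).
    rewrite big_filter [RHS]big_mkcond big_allpairs_dep /=.
    (* Words longer than [j] drop out, as their length cannot divide [j]. *)
    rewrite -(subnKC (ltnSE jn)) iotaD big_cat /= [X in _ = _ + X]big1_seq ?addr0; last first.
      move=> l /andP[_]; rewrite mem_iota => /andP[lj _].
      rewrite big1_seq // => s /andP[_]; rewrite mem_words => /andP[/eqP sl _].
      rewrite /F sl; case: ifP => // _; case: ifP => // /(dvdn_leq j0).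
      by rewrite leqNgt -add1n lj.
    rewrite big_mkcond; apply: eq_bigr => l _.
    case: ifPn => lj; last first.
      rewrite big1_seq // => s /andP[_]; rewrite mem_words => /andP[/eqP sl _].
      by rewrite /F sl (negbTE lj) if_same.
    rewrite big_mkcond big_seq [RHS]big_seq; apply: eq_bigr => s.
    by rewrite mem_words => /andP[/eqP sl _]; rewrite /F sl lj.
  rewrite -[LHS](big_fset_seq (T := seq T)); last exact: prime_words_uniq.
  rewrite (partition_big_imfset _ phi) /=.
  rewrite big_seq [RHS]big_seq; apply: eq_bigr => p /prime_classesP[r0 r0P ->].
  have pr0 : prime_word r0 by move: r0P; rewrite mem_prime_words => /andP[].
  rewrite big_mkcond big_fset_seq; last exact: prime_words_uniq.
  rewrite -big_mkcond /= lenE // wtE //.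
  transitivity (\sum_(r <- prime_words A n | phi r == phi r0) F r0).
    rewrite big_seq_cond [RHS]big_seq_cond; apply: eq_bigr => r /andP[].
    rewrite mem_prime_words => /and3P[pr _ _] /eqP E.
    by rewrite /F -(lenE pr) -(wtE pr) E lenE // wtE.
  by rewrite sum_fiber // /F; case: ifP => // _; rewrite mulr0.
apply: (newton_uniq (S := S1)).
- by rewrite /S1 coef_sum big1 // => p _; rewrite coef_poly.
- have H0 (I : Type) (s : seq I) (l : I -> nat) (a : I -> C) : all (fun i => (0 < l i)%N) s ->
      (\prod_(i <- s) (1 - a i *: 'X^(l i)))`_0 = 1.
    elim: s => [|i s IH] /=; first by rewrite big_nil coef1.
    move=> /andP[li ls]; rewrite big_cons coef0M IH // mulr1 coefB coef1 coefZ coefXn.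
    by rewrite (ltn_eqF li) mulr0 subr0.
  rewrite !H0 //; first by apply/allP.
  apply/allP => p /prime_classesP[r rP ->].
  have pr : prime_word r by move: rP; rewrite mem_prime_words => /andP[].
  by rewrite lenE //; case/andP: pr => /primitiveP[].
- apply: newton_prod => p /prime_classesP[r rP ->]; apply: newton_factor.
  have pr : prime_word r by move: rP; rewrite mem_prime_words => /andP[].
  by rewrite lenE //; case/andP: pr => /primitiveP[].
- by rewrite -S2E; apply: newton_prod => i _; exact: newton_factor.
Qed.

End PrimeProduct.

(** * Prime cycles as primitive words in the oriented edges *)

Section EdgeWords.
Variables (V : choiceType) (X : sgraph V) (E : set (OE X)).
Implicit Types (r : seq (OE X)) (s t : seq V).

Definition linked (e e' : OE X) : bool := org e' == tgt e.

Definition succb (e e' : OE X) : bool := `[< successor E e e' >].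

(** Inverse to [path_edges] on closed paths. In terms of edges the endpoint is no longer repeated
    and a cyclic shift is simply [rot 1]. *)
Definition verts r : seq V := if r is e :: _ then org e :: map (@tgt _ X) r else [::].

Lemma succb_linked e e' : succb e e' -> linked e e'.
Proof. by move=> /asboolP[/eqP]. Qed.

Lemma cycle_succb_linked r : path.cycle succb r -> path.cycle linked r.
Proof. exact: (sub_cycle succb_linked). Qed.

Lemma rot_rot_ex (T : Type) (r : seq T) m n : exists k, rot m (rot n r) = rot k r.
Proof.
have red k : exists2 k', (k' <= size r)%N & forall r' : seq T, size r' = size r -> rot k r' = rot k' r'.
  have [kr|rk] := leqP k (size r); first by exists k.
  by exists 0%N => // r' sr; rewrite rot0 rot_oversize // sr ltnW.
have [[m' m'r mE] [n' n'r nE]] := (red m, red n).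
by eexists; rewrite (mE (rot n r)) ?size_rot // nE // rot_add_mod.
Qed.

Lemma rot_inv_ex (T : Type) (r : seq T) n : exists k, r = rot k (rot n r).
Proof. by exists (size (rot n r) - n)%N; rewrite -/(rotr n _) rotK. Qed.

Lemma path_edges_cons x y s (xy : adj X x y) :
  path_edges X (x :: y :: s) = exist _ (x, y) xy :: path_edges X (y :: s).
Proof.
rewrite /path_edges /= insubT; congr cons; exact: val_inj.
Qed.

Lemma path_edgesP x s : path (adj X) x s ->
  [/\ size (path_edges X (x :: s)) = size s, map (@tgt _ X) (path_edges X (x :: s)) = s,
      (if path_edges X (x :: s) is e :: r then (org e == x) && path linked e r else true) &
      (if path_edges X (x :: s) is e :: r then tgt (last e r) == last x s else true)].
Proof.
elim: s x => [|y s IH] x //= /andP[xy ys].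
have [H1 H2 H3 H4] := IH y ys.
rewrite (path_edges_cons s xy) /= H1 H2 eqxx /=.
move: H1 H2 H3 H4; case: (path_edges X (y :: s)) => [|e r] /=.
  by move=> /esym/size0nil ->; split => //; rewrite eqxx.
move=> _ _ /andP[oe er] ->; split => //.
by rewrite er andbT.
Qed.

Lemma path_edgesK s : closed_path X s ->
  [/\ path_edges X s != [::], verts (path_edges X s) = s & path.cycle linked (path_edges X s)].
Proof.
case: s => // x s /and3P[/= xs s0 /eqP sx].
have [H1 H2 H3 H4] := path_edgesP xs.
move: H1 H2 H3 H4; case: (path_edges X (x :: s)) => [/esym/size0nil|e r].
  by move=> s00; rewrite s00 in s0.
move=> _ H2 /andP[/eqP oe er] /eqP te; split => //.
  by rewrite /verts oe H2.
by rewrite /= rcons_path er /= /linked te sx oe.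
Qed.

Lemma vertsK r : r != [::] -> path.cycle linked r ->
  closed_path X (verts r) /\ path_edges X (verts r) = r.
Proof.
case: r => // e r _ /=; rewrite rcons_path => /andP[er /eqP re].
have H x f q : org f = x -> path linked f q ->
    path (adj X) x (map (@tgt _ X) (f :: q)) /\ path_edges X (x :: map (@tgt _ X) (f :: q)) = f :: q.
  elim: q x f => [|g q IH] x f fx /=.
    move=> _; have xf : adj X x (tgt f) by rewrite -fx; exact: (valP f).
    rewrite xf; split => //; rewrite (path_edges_cons _ xf); congr cons.
    exact: OE_eq.
  move=> /andP[/eqP fg gq]; have xf : adj X x (tgt f) by rewrite -fx; exact: (valP f).
  have [H1 H2] := IH (tgt f) g fg gq.
  split; first by rewrite xf.
  rewrite (path_edges_cons _ xf) -[tgt g :: _]/(map (@tgt _ X) (g :: q)) H2; congr cons.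
  exact: OE_eq.
have [H1 H2] := H (org e) e r erefl er.
split; last exact: H2.
by rewrite /verts /closed_path /= last_map -re eqxx andbT; exact: H1.
Qed.

Lemma size_verts r : plen (verts r) = size r.
Proof. by case: r => // e r; rewrite /plen /= size_map. Qed.

Lemma cycle_shift_verts r : path.cycle linked r -> cycle_shift (verts r) = verts (rot 1 r).
Proof.
case: r => // e [|f r]; first by rewrite /= andbT => /eqP ->.
rewrite rot1_cons /= => /andP[/eqP fe _].
by rewrite /verts /= fe map_rcons.
Qed.

Lemma cycle_shift_closed s : closed_path X s ->
  closed_path X (cycle_shift s) /\ path_edges X (cycle_shift s) = rot 1 (path_edges X s).
Proof.
move=> /path_edgesK[r0 rs rc]; rewrite -{1 2}rs cycle_shift_verts //.
by apply: vertsK; rewrite ?rot_cycle // -size_eq0 size_rot size_eq0.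
Qed.

Lemma closed_path_eqP s t : closed_path_eq X s t ->
  (closed_path X s <-> closed_path X t) /\
  (closed_path X s -> exists k, path_edges X t = rot k (path_edges X s)).
Proof.
elim=> {s t} [s t [sc ->]|s|s t _ [H1 H2]|s t u _ [H1 H2] _ [H3 H4]].
- have [H1 H2] := cycle_shift_closed sc; split => //.
  by exists 1%N.
- by split => // _; exists 0%N; rewrite rot0.
- split; first by split => /H1.
  move=> /H1 /H2 [k ->]; have [k' E'] := rot_inv_ex (path_edges X s) k.
  by exists k'.
- split; first by rewrite H1.
  move=> sc; have [k kE] := H2 sc; have [l lE] := H4 (proj1 H1 sc).
  by rewrite lE kE; exact: rot_rot_ex.
Qed.

Lemma closed_path_eq_rot r k : r != [::] -> path.cycle linked r ->
  closed_path_eq X (verts r) (verts (rot k r)).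
Proof.
move=> r0 rc.
have H n : (n <= size r)%N -> closed_path_eq X (verts r) (verts (rot n r)).
  elim: n => [|n IH] nr; first by rewrite rot0; exact: rst_refl.
  apply: rst_trans (IH (ltnW nr)) _; apply: rst_step.
  have [] := @vertsK (rot n r); rewrite ?rot_cycle // -?size_eq0 ?size_rot ?size_eq0 //.
  by move=> H1 _; split => //; rewrite cycle_shift_verts ?rot_cycle // rotS.
have [kr|rk] := leqP k (size r); first exact: H.
by rewrite (rot_oversize (ltnW rk)); exact: rst_refl.
Qed.

Lemma cycle_of_eq s t : closed_path_eq X s t -> cycle_of X s = cycle_of X t.
Proof.
move=> st; apply/seteqP; split => u /=; first by apply: rst_trans; exact: rst_sym.
exact: rst_trans.
Qed.

(** A return [x_(j-1) = x_(j+1)] means that an edge is followed by its reverse, the case that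
    [successor] allows only for edges in [E]. The passage from the last edge to the first is not
    tested here. *)
Lemma regular_verts r : path.cycle linked r ->
  regular_path E (verts r) <-> sorted succb r.
Proof.
move=> rc.
have ls : sorted linked r by move: rc; case: r => //= e r; rewrite rcons_path => /andP[].
have sz : size (verts r) = (if r is _ :: _ then (size r).+1 else 0%N).
  by case: r {rc ls} => //= e r; rewrite size_map.
have nthS x0 e0 j : (j < size r)%N -> nth x0 (verts r) j.+1 = tgt (nth e0 r j).
  by case: r {rc ls sz} => // e r jr; rewrite /verts [LHS]/= -(nth_map e0 x0).
have nth0' x0 e0 j : (j < size r)%N -> nth x0 (verts r) j = org (nth e0 r j).
  case: j => [|j jr]; first by case: r {rc ls sz nthS}.
  rewrite (nthS x0 e0) ?(ltnW jr) //.
  by move/sortedP: ls => /(_ e0 j jr)/eqP.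
split=> [reg|sr].
  case: r rc ls {sz} nthS nth0' reg => // e0 r0; set r := e0 :: r0 => rc ls nthS nth0' reg.
  apply/(sortedP e0) => i ir; apply/asboolP.
  have li : linked (nth e0 r i) (nth e0 r i.+1) by move/sortedP: ls => /(_ e0 i ir).
  split; first exact/eqP.
  have [rev|nrev] := pselect (nth e0 r i.+1 = rev_edge (nth e0 r i)); last by left.
  right; have := reg (org e0) i.+1; rewrite size_verts ir -[i.+1.-1]/i.
  rewrite (nth0' _ e0 i) ?(ltnW ir) // (nthS _ e0 i.+1) // rev => /(_ isT erefl)[e Ee ve].
  suff -> : nth e0 r i = e by [].
  apply: val_inj; rewrite ve (nthS _ e0) ?(ltnW ir) //.
  by rewrite -surjective_pairing.
move=> x0 [//|j]; rewrite size_verts /= => jr.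
have [e0 _] : exists e0 : OE X, True by case: r jr {rc ls sz nthS nth0' sr} => // e0 *; exists e0.
rewrite (nth0' _ e0 j) ?(ltnW jr) // (nthS _ e0 j.+1) // (nthS _ e0 j) ?(ltnW jr) // => E0.
move/sortedP: sr => /(_ e0 j jr) /asboolP[og [nrev|Ee]].
  case: nrev; apply: OE_eq; [exact: og|exact: esym].
exists (nth e0 r j) => //; exact: surjective_pairing.
Qed.

(** One representative does not see the step from its last edge to its first, but the representative
    shifted by one does; this is why regularity is required of the whole class. *)
Lemma cycle_regular r : r != [::] -> path.cycle linked r ->
  (forall t, cycle_of X (verts r) t -> regular_path E t) <-> path.cycle succb r.
Proof.
move=> r0 rc; have [cr rK] := vertsK r0 rc; split=> [reg|sc t rt].
  have rot0' k : rot k r != [::] by rewrite -size_eq0 size_rot size_eq0.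
  have S k : sorted succb (rot k r).
    apply/regular_verts; first by rewrite rot_cycle.
    by apply: reg; exact: closed_path_eq_rot.
  have := S 1%N; have := S 0%N; rewrite rot0 {S}.
  case: r r0 rc {reg rK cr rot0'} => // e [|f r] _.
    (* A closed word with a single edge would be a loop. *)
    rewrite /= andbT => /eqP oe; have := valP e.
    by rewrite -/(org e) -/(tgt e) oe adj_irr.
  rewrite rot1_cons /= => _ /andP[-> fr].
  by rewrite !rcons_path fr => /andP[_ ->].
have [H1 H2] := closed_path_eqP rt.
have [k kE] := H2 cr; have /path_edgesK[_ tE tc] := proj1 H1 cr.
rewrite -tE; apply/regular_verts => //; rewrite kE rK.
have : path.cycle succb (rot k r) by rewrite rot_cycle.
by case: (rot k r) => //= e q; rewrite rcons_path => /andP[].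
Qed.

Lemma xget_cycle_of s : closed_path_eq X s (xget [::] (cycle_of X s)).
Proof. by case: xgetP => [y -> //|/(_ s)]; case; exact: rst_refl. Qed.

Lemma cycle_length_verts r : cycle_length (cycle_of X (verts r)) = size r.
Proof.
by rewrite /cycle_length -(closed_path_eq_plen (xget_cycle_of (verts r))) size_verts.
Qed.

Lemma cycle_weight_verts (R : realType) (w : OE X -> R) r : r != [::] -> path.cycle linked r ->
  cycle_weight w (cycle_of X (verts r)) = \prod_(e <- r) w e.
Proof.
move=> r0 rc; have [_ rK] := vertsK r0 rc.
by rewrite /cycle_weight -(closed_path_eq_weight w (xget_cycle_of (verts r))) /path_weight rK.
Qed.

Lemma repeat_path_verts q r : (0 < q)%N -> path.cycle linked r ->
  repeat_path q (verts r) = verts (rep q r).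
Proof.
case: q => // q _; case: r => [|e r] rc; first by rewrite /= /rep; elim: q.
rewrite /repeat_path /verts repS /=; congr (_ :: _).
rewrite map_cat; congr (_ :: _ ++ _).
by elim: q => //= q ->; rewrite map_cat.
Qed.

Lemma is_cycleP c : is_cycle E c <-> exists r, [/\ r != [::], path.cycle succb r & c = cycle_of X (verts r)].
Proof.
split=> [[[s sc ->] reg]|[r [r0 rc ->]]].
  have [r0 rs rc] := path_edgesK sc; exists (path_edges X s); split => //; last by rewrite rs.
  by apply/cycle_regular => //; rewrite rs.
have rl := cycle_succb_linked rc; have [cr _] := vertsK r0 rl.
split; first by exists (verts r).
exact/cycle_regular.
Qed.

(** Powers of cycles correspond to powers of edge words. A word that is not primitive is a power of
    its shorter root; conversely, a power of a shorter cycle is fixed by a proper rotation, and this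
    property passes to every representative. *)
Lemma prime_cycleP c : is_prime_cycle E c <->
  exists2 r, prime_word succb r & c = cycle_of X (verts r).
Proof.
split=> [[/is_cycleP[r [r0 rc ->]] np]|[r /andP[rp rc] ->]].
  exists r => //; apply/andP; split => //.
  have rs : (0 < size r)%N by rewrite lt0n size_eq0.
  have [l [l0 ld lp lE]] := primitive_root rs.
  have lr := dvdn_leq rs ld.
  have [El|nl] := eqVneq l (size r); first by move: lp; rewrite El take_size.
  case: np; exists (size r %/ l)%N, (cycle_of X (verts (take l r))).
  have q0 : (0 < size r %/ l)%N by rewrite divn_gt0.
  have tc : path.cycle succb (take l r) by rewrite -(cycle_rep _ _ q0) -lE.
  have t0 : take l r != [::] by rewrite -size_eq0 size_takel // -lt0n.
  split.
  - by apply/is_cycleP; exists (take l r).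
  - by rewrite !cycle_length_verts size_takel // ltn_neqAle nl.
  exists (verts (take l r)); first exact: rst_refl.
  by rewrite repeat_path_verts ?cycle_succb_linked // -lE.
have /primitiveP[rs rpp] := rp.
have r0 : r != [::] by rewrite -size_eq0 -lt0n.
have rl := cycle_succb_linked rc; have [cr rK] := vertsK r0 rl.
split; first by apply/is_cycleP; exists r.
move=> [k [c0 [/is_cycleP[r' [r'0 r'c ->]]]]]; rewrite !cycle_length_verts => lt.
move=> [s sr' cE].
have r'l := cycle_succb_linked r'c; have [cr' r'K] := vertsK r'0 r'l.
have [H1 /(_ cr')[d dE]] := closed_path_eqP sr'.
have cs := proj1 H1 cr'; have [s0 sE sl] := path_edgesK cs.
have : cycle_of X (repeat_path k s) (verts r) by rewrite -cE; exact: rst_refl.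
(* For exponent 0 the repeated path is a single vertex, which is not a closed path. *)
case: k {cE} => [|k].
  rewrite -sE; case: (path_edges X s) s0 => // e q _ /=.
  by move=> /closed_path_eqP[[_ /(_ cr)]].
rewrite -sE repeat_path_verts // => /closed_path_eqP[H3 H4].
have [|m mE] := H4; first exact/H3.
have Rl : path.cycle linked (rep k.+1 (path_edges X s)) by rewrite cycle_rep.
have R0 : rep k.+1 (path_edges X s) != [::] by rewrite -size_eq0 size_rep muln_eq0 size_eq0.
have [_ RK] := vertsK R0 Rl; rewrite rK RK in mE.
apply: (rpp (size (path_edges X s))).
  rewrite lt0n size_eq0 s0 /=; move: lt; congr (_ < _)%N.
  by rewrite dE r'K size_rot.
by rewrite mE rot_rot rot_rep.
Qed.

Lemma cycle_of_vertsP r r' : prime_word succb r -> prime_word succb r' ->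
  cycle_of X (verts r) = cycle_of X (verts r') <-> exists d, r' = rot d r.
Proof.
move=> /andP[/primitiveP[rs _] rc] /andP[/primitiveP[rs' _] rc'].
have r0 : r != [::] by rewrite -size_eq0 -lt0n.
have r0' : r' != [::] by rewrite -size_eq0 -lt0n.
have rl := cycle_succb_linked rc; have rl' := cycle_succb_linked rc'.
have [[cr rK] [cr' rK']] := (vertsK r0 rl, vertsK r0' rl').
split=> [eqc|[d ->]]; last by apply: cycle_of_eq; exact: closed_path_eq_rot.
have : cycle_of X (verts r) (verts r') by rewrite eqc; exact: rst_refl.
by move=> /closed_path_eqP[_ /(_ cr)]; rewrite rK rK'.
Qed.

End EdgeWords.

(** * The Euler product *)

Section ProductEstimates.
Variable R : realType.
Local Notation C := (cplx R).

Lemma prod_1D_le (I : Type) (s : seq I) (y : I -> R) : (forall i, 0 <= y i) ->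
  \sum_(i <- s) y i <= 2^-1 -> \prod_(i <- s) (1 + y i) <= 1 + 2 * \sum_(i <- s) y i.
Proof.
move=> y0; elim: s => [|i s IH]; first by rewrite !big_nil mulr0 addr0.
rewrite !big_cons => H.
have S0 : 0 <= \sum_(j <- s) y j by exact: sumr_ge0.
have y0i := y0 i.
have {}IH := IH (le_trans (ler_wpDl y0i (lexx _)) H).
apply: (@le_trans _ _ ((1 + y i) * (1 + 2 * \sum_(j <- s) y j))).
  by apply: ler_wpM2l => //; rewrite addr_ge0.
by move: S0 y0i H; set S := \sum_(j <- s) _; set z := y i; nra.
Qed.

Lemma cabs_prod_1B_sub1 (I : Type) (s : seq I) (x : I -> C) :
  cabs (\prod_(i <- s) (1 - x i) - 1) <= \prod_(i <- s) (1 + cabs (x i)) - 1.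
Proof.
elim: s => [|i s IH]; first by rewrite !big_nil subrr cabs0 subrr.
rewrite !big_cons; set p := \prod_(j <- s) (1 - x j); set q := \prod_(j <- s) (1 + cabs (x j)) in IH *.
have -> : (1 - x i) * p - 1 = (p - 1) - x i * (p - 1) - x i by ring.
have xi := cabs_ge0 (x i).
apply: le_trans (cabsD _ _) _; rewrite cabsN.
have : cabs (p - 1 - x i * (p - 1)) <= cabs (p - 1) + cabs (x i) * cabs (p - 1).
  by apply: le_trans (cabsD _ _) _; rewrite cabsN cabsM.
have : cabs (x i) * cabs (p - 1) <= cabs (x i) * (q - 1) by exact: ler_wpM2l.
by move: IH; lra.
Qed.

Lemma cabs_prod_1B_near1 (I : Type) (s : seq I) (x : I -> C) :
  \sum_(i <- s) cabs (x i) <= 2^-1 ->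
  cabs (\prod_(i <- s) (1 - x i) - 1) <= 2 * \sum_(i <- s) cabs (x i).
Proof.
move=> H; apply: le_trans (cabs_prod_1B_sub1 _ _) _.
by have := prod_1D_le (fun i => cabs_ge0 (x i)) H; lra.
Qed.

Lemma cabsB_ge (x y : C) : cabs x - cabs y <= cabs (x - y).
Proof. by have := cabsD (x - y) y; rewrite subrK; lra. Qed.

(** The weighted sum of absolute coefficients is submultiplicative. The cutoff [m] is arbitrary in
    the induction because multiplication by a power of ['X] shifts the range of summation. *)
Lemma prod_factor_coef_le (I : Type) (s : seq I) (a : I -> C) (l : I -> nat) (r : R) m :
  0 <= r ->
  \sum_(0 <= k < m) cabs (\prod_(i <- s) (1 - a i *: 'X^(l i)))`_k * r ^+ k <=
  \prod_(i <- s) (1 + cabs (a i) * r ^+ l i).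
Proof.
move=> r0; elim: s m => [|i s IH] m.
  rewrite !big_nil; case: m => [|m]; first by rewrite big_geq.
  rewrite big_nat_recl //= coef1 eqxx cabs1 expr0 mulr1 big1_seq ?addr0 // => k _.
  by rewrite (_ : (1 : {poly C})`_k.+1 = 0) ?cabs0 ?mul0r // coef1.
rewrite !big_cons; set f := \prod_(j <- s) (1 - a j *: 'X^(l j)) in IH *.
set Q := \prod_(j <- s) (1 + cabs (a j) * r ^+ l j) in IH *.
have c0 := cabs_ge0 (a i); have rl : 0 <= r ^+ l i by exact: exprn_ge0.
apply: (@le_trans _ _ (\sum_(0 <= k < m) cabs f`_k * r ^+ k + cabs (a i) * r ^+ l i *
    \sum_(0 <= k < m) (if (k < l i)%N then 0 else cabs f`_(k - l i) * r ^+ (k - l i)))).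
  rewrite [X in _ <= _ + X]mulr_sumr -[X in _ <= X]big_split /=; apply: ler_sum => k _.
  rewrite mulrBl mul1r -scalerAl coefB coefZ ['X^_ * _]mulrC coefMXn.
  have [kl|lk] := ltnP k (l i); first by rewrite !mulr0 subr0 addr0.
  have -> : cabs (a i) * r ^+ l i * (cabs f`_(k - l i) * r ^+ (k - l i)) =
      cabs (a i) * cabs f`_(k - l i) * r ^+ k.
    have -> : r ^+ k = r ^+ l i * r ^+ (k - l i) by rewrite -exprD subnKC.
    exact: mulrACA.
  rewrite -mulrDl; apply: ler_wpM2r; first exact: exprn_ge0.
  by apply: le_trans (cabsD _ _) _; rewrite cabsN cabsM.
rewrite mulrDl mul1r; apply: lerD; first exact: IH.
apply: ler_wpM2l; first by rewrite mulr_ge0.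
have [ml|lm] := leqP m (l i).
  rewrite big1_seq; first by have := IH 0%N; rewrite big_geq.
  move=> k /andP[_]; rewrite mem_index_iota => /andP[_ km].
  by rewrite (leq_trans km ml).
rewrite (big_cat_nat (n := l i)) //=; last exact: ltnW.
rewrite big1_seq ?add0r; last first.
  by move=> k /andP[_]; rewrite mem_index_iota => /andP[_ ->].
rewrite -{1}[l i]add0n big_addn; apply: le_trans (IH (m - l i)%N).
rewrite le_eqVlt; apply/orP; left; apply/eqP; apply: eq_bigr => k _.
by rewrite ltnNge leq_addl /= addnK.
Qed.

Lemma psum_poly (f : {poly C}) u : psum (fun k => f`_k) u = f.[u].
Proof.
apply: psum_unique; apply/cvg_cabsP => e e0; exists (size f) => // n /= sn.
rewrite /series /= horner_coef -(big_mkord xpredT (fun k => f`_k * u ^+ k)).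
rewrite (big_cat_nat (n := size f) (leq0n _) sn) /=.
rewrite [X in _ - (_ + X)]big1_seq ?addr0 ?subrr ?cabs0 // => k /andP[_].
by rewrite mem_index_iota => /andP[sk _]; rewrite nth_default ?mul0r.
Qed.

Lemma sum_words_prod (T : choiceType) (A : seq T) (f : T -> R) k :
  \sum_(s <- words A k) \prod_(a <- s) f a = (\sum_(a <- A) f a) ^+ k.
Proof.
elim: k => [|k IH]; first by rewrite /= big_seq1 big_nil expr0.
rewrite big_words exprS -IH mulr_suml; apply: eq_bigr => x _.
by rewrite mulr_sumr; apply: eq_bigr => s _; rewrite big_cons.
Qed.

(** The sum is bounded by that over all nonempty words, a geometric series of value at most
    [q / (1 - q)], which is 1/4 for [q = 1/5]. *)
Lemma sum_prime_words_le (T : choiceType) (e : rel T) (A : {fset T}) (f : T -> R) n :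
  (forall a, 0 <= f a) -> \sum_(a <- A) f a <= 5^-1 ->
  \sum_(s <- prime_words e A n) \prod_(a <- s) f a <= 4^-1.
Proof.
move=> f0 fA; set q := \sum_(a <- A) f a in fA.
have q0 : 0 <= q by exact: sumr_ge0.
apply: (@le_trans _ _ (\sum_(s <- [seq s | l <- iota 1 n, s <- words A l]) \prod_(a <- s) f a)).
  rewrite big_filter big_mkcond; apply: ler_sum => s _; case: ifP => // _.
  exact: prodr_ge0.
rewrite big_allpairs_dep /=.
under eq_bigr do rewrite sum_words_prod.
have -> : \sum_(l <- iota 1 n) q ^+ l = q * \sum_(i < n) q ^+ i.
  rewrite -[iota 1 n]/(iota (1 + 0) n) iotaDl big_map mulr_sumr -(big_mkord xpredT (fun i => q * q ^+ i)).
  by rewrite /index_iota subn0; apply: eq_bigr => i _; rewrite add1n exprS.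
have := subrX1 q n; set S := \sum_(i < n) _ => E.
have qn : 0 <= q ^+ n by exact: exprn_ge0.
have S0 : 0 <= S by apply: sumr_ge0 => i _; exact: exprn_ge0.
nra.
Qed.

End ProductEstimates.

(** * Convergence of the product over prime cycles *)

Section EulerProduct.
Variables (R : realType) (V : choiceType) (X : sgraph V) (w : OE X -> R) (E : set (OE X)).
Local Notation C := (cplx R).
Hypothesis w0 : forall e, 0 < w e.
Variable W : R.
Hypothesis wW : forall A : {fset OE X}, \sum_(e <- A) w e <= W.

Local Notation phi r := (cycle_of X (verts r)).
Local Notation prime_word := (prime_word (succb E)).
Local Notation prime_words := (prime_words (succb E)).
Local Notation "'cw' c" := (cplx_of (cycle_weight w c) : C) (at level 10).

Lemma prime_word_neq0 r : prime_word r -> r != [::].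
Proof. by case/andP => /primitiveP[+ _] _; rewrite -size_eq0 -lt0n. Qed.

Lemma prime_word_weight r : prime_word r -> cycle_weight w (phi r) = \prod_(e <- r) w e.
Proof.
move=> pr; apply: cycle_weight_verts; first exact: prime_word_neq0.
by apply: (cycle_succb_linked (E := E)); case/andP: pr.
Qed.

(** Chosen so that the numbers [w e * radius] sum to at most 1/5, the threshold of
    [sum_prime_words_le]. Adding 1 to [W] covers [W = 0] and gives [radius <= 1]. *)
Definition radius : R := (5 * (W + 1))^-1.

Let W0 : 0 <= W. Proof. by have := wW fset0; rewrite big_seq_fset0. Qed.

Lemma radius_gt0 : 0 < radius.
Proof. by rewrite invr_gt0 mulr_gt0 // ltr_wpDl. Qed.

Lemma radius_le1 : radius <= 1.
Proof. by rewrite invf_le1 ?mulr_gt0 ?ltr_wpDl //; move: W0; lra. Qed.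

Lemma prime_cycles_words (B : {fset prime_cycles E}) :
  exists (A : {fset OE X}) (n : nat), forall p, p \in B ->
    exists2 r, r \in prime_words A n & val p = phi r.
Proof.
have /choice[rep repP] : forall p : prime_cycles E, exists r, prime_word r /\ val p = phi r.
  move=> p; have := valP p; rewrite inE => /prime_cycleP[r pr pE]; by exists r.
exists (\bigcup_(p <- B) [fset e in rep p])%fset, (\max_(p <- B) size (rep p)) => p pB.
have [pr pE] := repP p; exists (rep p) => //.
rewrite mem_prime_words pr /=; apply/andP; split.
  by rewrite (big_rem p) //= leq_maxl.
by apply/allP => e er; apply/bigfcupP; exists p; rewrite ?pB // !inE.
Qed.

(** One word is chosen for each cycle; distinct cycles get distinct words, so the sum over words
    dominates. *)
Lemma sum_prime_cycles_le (B : {fset prime_cycles E}) :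
  \sum_(p <- B) cycle_weight w (val p) * radius ^+ cycle_length (val p) <= 4^-1.
Proof.
have [A [n AP]] := prime_cycles_words B.
pose f e := w e * radius.
have f0 e : 0 <= f e by rewrite mulr_ge0 ?ltW ?radius_gt0.
have fA : \sum_(e <- A) f e <= 5^-1.
  rewrite -mulr_suml /radius ler_pdivrMr ?mulr_gt0 ?ltr_wpDl // mulKf //.
  by apply: le_trans (wW A) _; rewrite lerDl.
apply: le_trans (sum_prime_words_le (succb E) n f0 fA).
have /choice[rep repP] : forall p : prime_cycles E, exists r,
    p \in B -> r \in prime_words A n /\ val p = phi r.
  move=> p; have [pB|pB] := boolP (p \in B); last by exists [::].
  by have [r rP pE] := AP p pB; exists r.
have urep : uniq [seq rep p | p <- enum_fset B].
  rewrite map_inj_in_uniq ?fset_uniq // => p q pB qB E0; apply: val_inj.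
  by have [[_ ->] [_ ->]] := (repP p pB, repP q qB); rewrite E0.
apply: (@le_trans _ _ (\sum_(r <- [fset r in [seq rep p | p <- enum_fset B]]%fset) \prod_(e <- r) f e)).
  rewrite big_fset_seq // big_map big_seq [leRHS]big_seq.
  rewrite le_eqVlt; apply/orP; left; apply/eqP; apply: eq_bigr => p pB.
  have [] := repP p pB; rewrite mem_prime_words => /and3P[pr _ _] ->.
  rewrite prime_word_weight // cycle_length_verts /f big_split /=.
  by rewrite big_const_seq count_predT iter_mulr_1.
apply: (@le_trans _ _ (\sum_(r <- [fset r in prime_words A n]%fset) \prod_(e <- r) f e)).
  apply: (sum_fset_mono (R := R)); first by move=> r; exact: prodr_ge0.
  apply/fsubsetP => r; rewrite !inE /= => /mapP[p pB ->].
  by have [] := repP p pB.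
by rewrite big_fset_seq // prime_words_uniq.
Qed.

Lemma cycle_weight_ge0 (p : prime_cycles E) : 0 <= cycle_weight w (val p).
Proof.
have := valP p; rewrite inE => /prime_cycleP[r pr ->].
by rewrite prime_word_weight // prodr_ge0 // => e _; exact: ltW.
Qed.

Lemma cabs_euler_term_le (u : C) (p : prime_cycles E) : cabs u <= radius ->
  cabs (cw (val p) * u ^+ cycle_length (val p)) <=
  cycle_weight w (val p) * radius ^+ cycle_length (val p).
Proof.
move=> ur; rewrite cabsM cabs_of ger0_norm ?cycle_weight_ge0 // cabsX.
apply: ler_wpM2l; first exact: cycle_weight_ge0.
by apply: lerXn2r; rewrite ?nnegrE ?cabs_ge0 // ltW // radius_gt0.
Qed.

Lemma sum_euler_terms_le (u : C) (B : {fset prime_cycles E}) : cabs u <= radius ->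
  \sum_(p <- B) cabs (cw (val p) * u ^+ cycle_length (val p)) <= 4^-1.
Proof.
move=> ur; apply: le_trans (sum_prime_cycles_le B).
by apply: ler_sum => p _; exact: cabs_euler_term_le.
Qed.

Lemma euler_partial_prod_near1 (u : C) (B : {fset prime_cycles E}) : cabs u <= radius ->
  cabs (\prod_(p <- B) euler_factor w u (val p) - 1) <= 2^-1.
Proof.
move=> ur; have S := sum_euler_terms_le B ur.
apply: le_trans (cabs_prod_1B_near1 _) _; first by apply: le_trans S _; lra.
by move: S; lra.
Qed.

Lemma euler_partial_prod_ge (u : C) (B : {fset prime_cycles E}) : cabs u <= radius ->
  2^-1 <= cabs (\prod_(p <- B) euler_factor w u (val p)).
Proof.
move=> /(euler_partial_prod_near1 B); set p := \prod_(_ <- _) _ => H.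
by have := cabsB_ge 1 p; rewrite cabsBC cabs1; lra.
Qed.

Lemma euler_factor_neq0 (u : C) (p : set (seq V)) : cabs u <= radius ->
  is_prime_cycle E p -> euler_factor w u p != 0.
Proof.
move=> ur pp; have pP : p \in prime_cycles E by rewrite inE.
pose q : prime_cycles E := SigSub pP.
have := euler_partial_prod_ge [fset q]%fset ur; rewrite big_seq_fset1 -cabs_gt0.
by apply: lt_le_trans.
Qed.

Let K (a b : OE X) : C := if succb E a b then cplx_of (w b) else 0.
Let classes A n := prime_classes (succb E) (fun r => phi r) A n.

Lemma prime_cycles_product_coef (A : {fset OE X}) n k : (k <= n)%N ->
  (\prod_(p <- classes A n) (1 - cw p *: 'X^(cycle_length p)))`_k = (compression_det K A)`_k.
Proof.
apply: (prime_product_coef (J := set (seq V)) (e := succb E) (w := fun e => cplx_of (w e) : C)).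
- by move=> r r'; exact: cycle_of_vertsP.
- by move=> r pr; rewrite prime_word_weight // cplx_of_prod.
- by move=> r _; exact: cycle_length_verts.
Qed.

(** [classes A n] is a finite set of cycles, while the infinite product is indexed by the subtype of
    prime cycles. *)
Lemma classes_fset (A : {fset OE X}) n : exists B : {fset prime_cycles E},
  (forall p, (p \in B) = (val p \in classes A n)) /\
  forall (S : Type) (idx : S) (op : Monoid.com_law idx) (f : set (seq V) -> S),
    \big[op/idx]_(p <- B) f (val p) = \big[op/idx]_(p <- classes A n) f p.
Proof.
pose s : seq (prime_cycles E) := pmap insub (enum_fset (classes A n)).
have us : uniq s by apply: pmap_sub_uniq; exact: fset_uniq.
exists [fset p in s]%fset; split.
  by move=> p; rewrite !inE /= mem_pmap_sub.
move=> S idx op f; rewrite big_fset_seq // -(big_map val xpredT f).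
rewrite pmap_filter; last exact: insubK.
rewrite big_filter [LHS]big_mkcond big_seq [RHS]big_seq; apply: eq_bigr => p.
move=> /prime_classesP[r]; rewrite mem_prime_words => /and3P[pr _ _] pE.
rewrite isSome_insub ifT // inE; apply/prime_cycleP; by exists r.
Qed.

Variable M : nat.
Hypothesis KM : forall b (A : {fset OE X}), \sum_(a <- A) cabs (K a b) <= M%:R * w b.

Let Mw0 e : 0 <= M%:R * w e. Proof. by rewrite mulr_ge0 // ltW. Qed.
Let MwW (A : {fset OE X}) : \sum_(e <- A) M%:R * w e <= M%:R * W.
Proof. by rewrite -mulr_sumr ler_wpM2l. Qed.

Let coef := fredholm_coef K.

Lemma pow2_small (b e : R) : 0 < e -> exists n, b / 2 ^+ n.+1 < e.
Proof.
move=> e0; exists (Num.truncn (b / e)).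
rewrite ltr_pdivrMr ?exprn_gt0 // mulrC -ltr_pdivrMr //.
apply: lt_le_trans (truncnS_gt _) _.
by rewrite -natrX ler_nat ltnW // ltn_expl.
Qed.

Lemma compressions_approx n (e : R) : 0 < e -> exists A0 : {fset OE X},
  forall A, (A0 `<=` A)%fset -> forall k, (k <= n)%N ->
    cabs (coef k - (compression_det K A)`_k) < e.
Proof.
move=> e0; elim: n => [|n [A0 H0]].
  have [A0 H0] := compression_det_coef_cvg Mw0 KM MwW 0 e0.
  by exists A0 => A AA k; rewrite leqn0 => /eqP ->; exact: H0.
have [A1 H1] := compression_det_coef_cvg Mw0 KM MwW n.+1 e0.
exists (A0 `|` A1)%fset => A; rewrite fsubUset => /andP[a0 a1] k.
rewrite leq_eqVlt => /orP[/eqP ->|]; first exact: H1.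
by rewrite ltnS; exact: H0.
Qed.

(* The product over the prime words of length at most [n] in the finite alphabet [A]
   agrees up to order [n] with the determinant of the compression to [A]; the tails
   beyond order [n] are small uniformly in [A]. *)
Lemma euler_product_cvg (u : C) (e : R) : cabs u <= radius / 2 -> 0 < e ->
  exists B0 : {fset prime_cycles E}, forall B, (B0 `<=` B)%fset ->
    cabs (psum coef u - \prod_(p <- B) euler_factor w u (val p)) < e.
Proof.
move=> ur2 e0; have rho0 := radius_gt0; have rho1 := radius_le1.
have ur : cabs u <= radius by apply: le_trans ur2 _; move: rho0; lra.
have u1 : cabs u <= 1 by exact: le_trans ur _.
pose x (p : prime_cycles E) : C := cw (val p) * u ^+ cycle_length (val p).
pose h (p : prime_cycles E) : R := cycle_weight w (val p) * radius ^+ cycle_length (val p).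
have h0 p : 0 <= h p by rewrite mulr_ge0 ?cycle_weight_ge0 // exprn_ge0 // ltW.
have hs : abs_summable (fun p => cplx_of (h p)).
  exists 4^-1 => B; under eq_bigr do rewrite cabs_of ger0_norm //.
  exact: sum_prime_cycles_le.
(* Of the eight parts, three go to replacing the determinant series by [G] (two tails and the
   coefficients up to [n]), and four to the remaining factors, since [cabs G.[u] <= 2] and
   [cabs (Q - 1) <= 2 * (e / 8)]. *)
have e8 : 0 < e / 8 by rewrite divr_gt0.
have [B1 HB1] := abs_summable_tail hs e8.
have [A1 [n1 HA1]] := prime_cycles_words B1.
have [b cb] := fredholm_coef_entire Mw0 KM MwW rho0.
(* The numerators are those of [psum_tail]: [2 * b] for the determinant series, [2 * 2] for [G],
   whose coefficient bound is 2. *)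
have [n2 Hn2] := pow2_small (2 * b) e8.
have [n3 Hn3] := pow2_small (2 * 2) e8.
pose n := maxn n1 (maxn n2 n3).
have [n1n n2n n3n] : [/\ (n1 <= n)%N, (n2 <= n)%N & (n3 <= n)%N].
  by rewrite /n !leq_max !leqnn !orbT.
have e8n : 0 < e / 8 / n.+1%:R by rewrite divr_gt0.
have [A2 HA2] := compressions_approx n e8n.
pose A := (A1 `|` A2)%fset.
have [B0 [B0P B0prod]] := classes_fset A n.
exists B0 => B B0B.
pose G : {poly C} := \prod_(p <- classes A n) (1 - cw p *: 'X^(cycle_length p)).
have Gu : G.[u] = \prod_(p <- B0) euler_factor w u (val p).
  rewrite (B0prod _ _ _ (euler_factor w u)) horner_prod; apply: eq_bigr => p _.
  by rewrite !hornerE /euler_factor.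
have Gb : ps_bound (fun k => G`_k) radius 2.
  move=> k; have := prod_factor_coef_le (enum_fset (classes A n)) (fun p => cw p)
    (@cycle_length V) k.+1 (ltW rho0).
  rewrite -/G big_nat_recr //= => H.
  have : \prod_(p <- classes A n) (1 + cabs (cw p) * radius ^+ cycle_length p) <= 2.
    rewrite -(B0prod _ _ _ (fun p => 1 + cabs (cw p) * radius ^+ cycle_length p)).
    have S := sum_prime_cycles_le B0.
    have E1 : \prod_(p <- B0) (1 + cabs (cw (val p)) * radius ^+ cycle_length (val p)) =
        \prod_(p <- B0) (1 + h p).
      by apply: eq_bigr => p _; rewrite cabs_of ger0_norm // cycle_weight_ge0.
    rewrite E1; apply: le_trans (prod_1D_le h0 _) _; first by apply: le_trans S _; lra.
    by move: S; rewrite -/h; set S := \sum_(_ <- _) _; lra.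
  apply: le_trans; apply: le_trans H; rewrite lerDr; apply: sumr_ge0 => i _.
  by rewrite mulr_ge0 ?cabs_ge0 // exprn_ge0 // ltW.
have b0 : 0 <= b by apply: le_trans (cb 0%N); rewrite expr0 mulr1 cabs_ge0.
have pow2le m : (m <= n)%N -> (2 ^+ n.+1)^-1 <= (2 ^+ m.+1)^-1 :> R.
  by move=> mn; rewrite lef_pV2 ?posrE ?exprn_gt0 // ler_weXn2l // ler1n.
have t1 : cabs (psum coef u - \sum_(k < n.+1) coef k * u ^+ k) < e / 8.
  apply: le_lt_trans (psum_tail n.+1 cb rho0 ur2) _; apply: le_lt_trans Hn2.
  by apply: ler_wpM2l; [rewrite mulr_ge0|exact: pow2le].
have t2 : cabs (G.[u] - \sum_(k < n.+1) G`_k * u ^+ k) < e / 8.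
  rewrite -psum_poly; apply: le_lt_trans (psum_tail n.+1 Gb rho0 ur2) _; apply: le_lt_trans Hn3.
  by apply: ler_wpM2l; [rewrite mulr_ge0|exact: pow2le].
have t3 : cabs (\sum_(k < n.+1) coef k * u ^+ k - \sum_(k < n.+1) G`_k * u ^+ k) <= e / 8.
  rewrite -sumrB; apply: le_trans (cabs_sum _ _ _) _.
  apply: (@le_trans _ _ (\sum_(k < n.+1) e / 8 / n.+1%:R)); last first.
    by rewrite sumr_const card_ord -[X in X <= _]mulr_natr divfK // pnatr_eq0.
  apply: ler_sum => k _; have kn : (k <= n)%N by rewrite -ltnS.
  rewrite -mulrBl cabsM cabsX prime_cycles_product_coef //.
  have := HA2 A (fsubsetUr _ _) k kn => /ltW H.
  rewrite -[leRHS]mulr1; apply: ler_pM; rewrite ?cabs_ge0 ?exprn_ge0 ?cabs_ge0 //.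
  by rewrite exprn_ile1 // cabs_ge0.
have dG : cabs (psum coef u - G.[u]) < 3 * (e / 8).
  move: t1 t2 t3; set a1 := psum coef u; set a2 := \sum_(k < _) _; set a3 := G.[u]; set a4 := \sum_(k < _) _.
  move=> t1 t2 t3.
  have -> : a1 - a3 = (a1 - a2) + (a2 - a4) + (a4 - a3) by rewrite !addrA !subrK.
  have := cabsD (a1 - a2 + (a2 - a4)) (a4 - a3); have := cabsD (a1 - a2) (a2 - a4).
  by rewrite [cabs (a4 - a3)]cabsBC; lra.
have B1B0 : (B1 `<=` B0)%fset.
  apply/fsubsetP => p pB; rewrite B0P; apply/prime_classesP.
  have [r rP pE] := HA1 p pB; exists r => //.
  move: rP; rewrite !mem_prime_words => /and3P[-> rn /allP rA]; rewrite (leq_trans rn n1n) /=.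
  by apply/allP => a /rA aA; exact: (fsubsetP (fsubsetUl A1 A2) a aA).
rewrite (big_fsetIDsub _ _ B0B) /= -Gu.
set Q := \prod_(_ <- _) _.
have Q1 : cabs (Q - 1) <= 2 * (e / 8).
  have dis : [disjoint B1 & B `\` B0]%fset.
    by apply/fdisjointP => p /(fsubsetP B1B0) pB; rewrite !inE pB.
  have /ltW := HB1 _ dis; under eq_bigr do rewrite cabs_of ger0_norm //.
  move=> H; have S := sum_euler_terms_le (B `\` B0)%fset ur.
  apply: le_trans (cabs_prod_1B_near1 _) _; first by apply: le_trans S _; lra.
  apply: ler_wpM2l => //; apply: le_trans H; apply: ler_sum => p _.
  exact: cabs_euler_term_le.
have G2 : cabs G.[u] <= 2.
  rewrite Gu; have := euler_partial_prod_near1 B0 ur; set g := \prod_(_ <- _) _ => H.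
  by have := cabsB_ge g 1; rewrite cabs1; lra.
have -> : psum coef u - G.[u] * Q = (psum coef u - G.[u]) + G.[u] * (1 - Q) by ring.
have := cabsD (psum coef u - G.[u]) (G.[u] * (1 - Q)); rewrite cabsM [cabs (1 - Q)]cabsBC.
have : cabs G.[u] * cabs (Q - 1) <= 2 * (2 * (e / 8)) by apply: ler_pM; rewrite ?cabs_ge0.
by move: dG; lra.
Qed.

Lemma fredholm_psum_ge (u : C) : cabs u <= radius / 2 -> 2^-1 <= cabs (psum coef u).
Proof.
move=> ur2; have rho0 := radius_gt0.
have ur : cabs u <= radius by apply: le_trans ur2 _; move: rho0; lra.
apply/ler_addgt0Pr => e e0; have [B0 HB0] := euler_product_cvg ur2 e0.
have := HB0 B0 (fsubset_refl _); have := euler_partial_prod_ge B0 ur.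
set g := \prod_(_ <- _) _ => g2 H.
by have := cabsB_ge g (psum coef u); rewrite cabsBC; lra.
Qed.

Lemma is_prod_euler (u : C) : cabs u <= radius / 2 ->
  is_prod (fun p : prime_cycles E => (euler_factor w u (val p))^-1) (psum coef u)^-1.
Proof.
move=> ur2; have rho0 := radius_gt0.
have ur : cabs u <= radius by apply: le_trans ur2 _; move: rho0; lra.
(* The partial products and their limit have modulus at least 1/2, so inversion enlarges the error
   by a factor of at most 4. *)
apply/is_prodP => e e0; have e4 : 0 < e / 4 by rewrite divr_gt0.
have [B0 HB0] := euler_product_cvg ur2 e4; exists B0 => B /HB0 H.
rewrite prodfV; move: H; have := euler_partial_prod_ge B ur.
set g := \prod_(_ <- _) _; have := fredholm_psum_ge ur2; set d := psum coef u => d2 g2 H.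
have d0 : d != 0 by rewrite -cabs_gt0; apply: lt_le_trans d2.
have g0 : g != 0 by rewrite -cabs_gt0; apply: lt_le_trans g2.
have -> : d^-1 - g^-1 = (g - d) / (d * g) by field; rewrite g0 d0.
rewrite cabsM cabsV cabsM cabsBC ltr_pdivrMr; last by rewrite mulr_gt0 // cabs_gt0.
have : 4^-1 <= cabs d * cabs g.
  by rewrite (_ : 4^-1 = 2^-1 * 2^-1 :> R); [apply: ler_pM|field].
by move: H e0; set a := cabs d * cabs g; set t := cabs (d - g); nra.
Qed.

End EulerProduct.

(** * The reciprocal of an entire function *)

Section Meromorphic.
Variable R : realType.
Local Notation C := (cplx R).

(** Near a zero the series is small by continuity, and nonzero because zeros are isolated; the
    latter matters since inversion sends 0 to 0 and would spoil the growth at a pole. *)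
Lemma meromorphic_inv (c : nat -> C) : ps_entire c -> c 0%N != 0 ->
  meromorphic (fun z => (psum c z)^-1) [set z | psum c z = 0].
Proof.
move=> ce c0; have iso := psum_isolated_zeros ce c0; split.
- move=> z; move: (iso z); apply: filterS => y; apply: contra_neq_not.
  by [].
- move=> z /= /eqP dz; apply: derivableV; first exact: dz.
  exact: (psum_entire ce).
- move=> p /= dp; apply/cvgryPge => A.
  have A0 : 0 < `|A| + 1 by rewrite ltr_wpDl.
  have /cvg_at_cabsP/(_ (`|A| + 1)^-1) := @psum_entire_continuous _ c ce p.
  rewrite invr_gt0 => /(_ A0)[d d0 Hd].
  have : \forall u \near p^', cabs (u - p) < d by apply: dnear_cabs; exists d.
  apply: filterS2 (iso p) => u u0 /Hd; rewrite dp sub0r cabsN cabsV => H.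
  have u0' : 0 < cabs (psum c u) by rewrite cabs_gt0.
  apply: (@le_trans _ _ (`|A| + 1)); first by apply: le_trans (ler_norm A) _; rewrite lerDl.
  by rewrite -[leLHS]invrK lef_pV2 ?posrE ?invr_gt0 // ltW.
Qed.

Lemma det_size0 (S : comNzRingType) n (N : 'M[S]_n) : n = 0%N -> \det N = 1.
Proof. by move=> n0; move: N; rewrite n0 => N; exact: det_mx00. Qed.

(** The empty set is the only one with 0 elements. The constant coefficient 1 rules out that the
    determinant vanishes identically. *)
Lemma minor_sum0 (I : choiceType) (K : I -> I -> C) : minor_sum K 0 = 1.
Proof.
have F0P : #|` @fset0 I| == 0%N by rewrite cardfs0.
pose F0 : {F : {fset I} | #|` F| == 0%N} := exist _ fset0 F0P.
apply: is_sum_sum.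
have <- : \sum_(F <- [fset F0]%fset) \det (fset_mx K (val F)) = 1.
  by rewrite big_seq_fset1 det_size0 // -cardfE cardfs0.
apply: is_sum_fin => F; rewrite inE => /negP; case; apply/eqP; apply: val_inj.
by apply/eqP; rewrite -cardfs_eq0; exact: (valP F).
Qed.

End Meromorphic.


Unset Implicit Arguments.

Theorem theorem5p1 (R : realType) (V : choiceType) (X : sgraph V)
    (w : OE X -> R) (E : set (OE X)) :
  connected_graph X ->
  bounded_valency X ->
  (forall e, 0 < w e) ->
  (\esum_(e in [set: OE X]) (w e)%:E < +oo)%E ->
  (exists T, is_edge_operator w E T) /\
  forall T, is_edge_operator w E T ->
    trace_class T /\
    exists (Z : cplx R -> cplx R) (P : set (cplx R)),
      [/\ \forall u \near (0 : cplx R),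
            [/\ forall p, prime_cycles E p -> euler_factor w u p != 0,
                ~ P u &
                is_prod (fun p : prime_cycles E => (euler_factor w u (val p))^-1)
                        (Z u)],
          meromorphic Z P,
          forall z, ~ P z -> Z z != 0,
          entire (recip Z P) &
          forall u, is_fredholm_det (fun x => u *: T x) (recip Z P u)].
Proof.
move=> _ Xb w0 wfin.
have wsum := esum_lty_bound (fun e => ltW (w0 e)) wfin.
have [W wW] := wsum.
split; first exact: edge_operator_exists.
move=> T eT; split; first exact: edge_operator_trace_class eT.
have [M [pre [suc succP]]] := succ_fsets E Xb.
(* The transpose puts the source edge first: column [b] has at most [M] nonzero entries, each equal
   to [w b]. *)
pose K a b := edge_kernel w E b a.
have KM b (A : {fset OE X}) : \sum_(a <- A) cabs (K a b) <= M%:R * w b.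
  have [_ preP preM _] := succP b.
  apply: (@le_trans _ _ (\sum_(a <- A | a \in pre b) w b)).
    rewrite [leRHS]big_mkcond /=; apply: ler_sum => a _; rewrite preP.
    rewrite /K /edge_kernel; case: ifP => _; last by rewrite cabs0.
    by rewrite cabs_of ger0_norm // ltW.
  apply: le_trans (sum_cond_fset_le _ _ _) _; first by move=> _; exact: ltW.
  by apply: sum_const_fset_le => //; exact: ltW.
have Mw0 e : 0 <= M%:R * w e by rewrite mulr_ge0 // ltW.
have MwW (A : {fset OE X}) : \sum_(e <- A) M%:R * w e <= M%:R * W.
  by rewrite -mulr_sumr ler_wpM2l.
pose c := fredholm_coef K.
have ce : ps_entire c := fredholm_coef_entire Mw0 KM MwW.
have c0 : c 0%N != 0 by rewrite /c /fredholm_coef minor_sum0 expr0 mulr1 oner_neq0.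
(* At a zero of the series [Z] has the conventional value 0; these zeros form [P], so [recip]
   returns the series itself at every point. *)
pose Z u := (psum c u)^-1; pose P : set (cplx R) := [set u | psum c u = 0].
have recE : recip Z P = psum c.
  by apply/funext => u; rewrite /recip; case: asboolP => [->//|_]; rewrite invrK.
exists Z, P; rewrite recE; split.
- apply: near_cabs; exists (radius W / 2).
    by rewrite divr_gt0 // (radius_gt0 wW).
  move=> u; rewrite subr0 => /ltW ur2.
  have rho0 := radius_gt0 wW.
  have ur : cabs u <= radius W by apply: le_trans ur2 _; move: rho0; lra.
  split.
  + by move=> p pp; exact: (euler_factor_neq0 w0 wW ur pp).
  + have := fredholm_psum_ge w0 wW KM ur2; rewrite -/c => H Pu.
    by move: H; rewrite Pu cabs0 invr_le0 leNgt ltr0n.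
  + exact: (is_prod_euler w0 wW KM ur2).
- exact: meromorphic_inv.
- by move=> z /eqP; rewrite invr_eq0.
- exact: psum_entire.
- move=> u; apply: (is_fredholm_det_psum Mw0 KM MwW) => e e'.
  exact: edge_operator_basis.
Qed.
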